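(* Let $(\psi,\phi)\in\mathcal N\times\mathcal B$. (1) (i) If $\sigma^2+b>0$ then $\underline\kappa(0^+)=\overline\kappa(0^+)=\frac b{\sigma^2}\in[0,\infty]$. (ii) If $\sigma^2+b=0$ then $\underline\kappa(0^+)\ge\liminf_{y\to0}\overline\mu(y)W(y)$. In particular $\underline\kappa(0^+)=\infty$ if $\overline\Pi(y)=O(y^{-\alpha})$ and $\frac1{\overline\mu(y)}=O(y^\beta)$ as $y\downarrow0$ with $1<\alpha<1+\beta<2$. Furthermore, $\overline\kappa(0^+)=0$ if $\overline\mu(0^+)<\infty$. (2) Assume that $\underline\kappa(0^+)=\overline\kappa(0^+)<\infty$. Then $\kappa\in C^1(\mathbb R^+)$ and $\kappa^{(1)}\in L^1_{loc}(\mathbb R^+)$ if one of the following holds. (i) $\sigma=0$, $W^{(1)},\overline\mu\in C^1(\mathbb R^+)$ and, for some $\delta>0$, $W^{(2)}$ is non-positive on $(0,\delta)$ and $$-\int_0^\delta\frac{y\,\overline\mu^{(1)}(y)}{\int_0^y\overline{\overline\Pi}(r)dr}\,dy<\infty.$$ (ii) $\sigma=0$, $\overline\mu(0^+)<\infty$, $\overline\mu\in C^1(\mathbb R^+)$ and $\overline\mu^{(1)}\in L^1_{loc}(\mathbb R^+)$. (iii) $\sigma>0$ and $\overline\mu\in C(\mathbb R^+)$. Moreover, if in addition $b=0$, $\overline\mu(0^+)<\infty$, $\overline\mu\in C^1(\mathbb R^+)$ and $\overline\mu^{(1)}\in L^1_{loc}(\mathbb R^+)$, then $\kappa\in C^2(\mathbb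 R^+)$.
   Context: Notation. $\mathbb R^+=(0,\infty)$; $f^{(p)}$ is the $p$-th derivative. $\mathcal H(R)$ is the set of functions holomorphic on the open disc $D(0,R)$, with the understanding that $R$ is the radius of convergence of their Taylor series at $0$. $L^1_{loc}(\mathbb R^+)$: measurable $f:\mathbb R^+\to\mathbb R$ with $\int_0^a|f(y)|dy<\infty$ for all $a>0$. $\mathcal N$ is the set of $\psi(u)=\sigma^2u^2+mu+\int_0^\infty(e^{-ur}-1+ur)\Pi(dr)$, $u\ge0$, with $\sigma\ge0$, $m>0$, $\Pi$ a non-negative Borel measure on $\mathbb R^+$, such that $\int^\infty\frac{du}{\psi(u)}<\infty$ and $\psi\in\mathcal H(R_\psi)$ for some $R_\psi>0$. $\mathcal B$ is the set of $\phi(u)=bu+\int_0^\infty(1-e^{-ur})\mu(dr)$, $u\ge0$, with $b\ge0$, $\mu$ a non-negative Borel measure on $\mathbb R^+$ with $\int_0^\infty(1\wedge r)\mu(dr)<\infty$, such that $\phi\in\mathcal H(R_\phi)$ for some $R_\phi>0$. Put $\overline\mu(r)=\int_r^\infty\mu(dy)$, $\overline\Pi(y)=\int_y^\infty\Pi(dr)$, $\overline{\overline\Pi}(y)=\int_y^\infty\overline\Pi(r)dr$. The scale function $W:[0,\infty)\to[0,\infty)$ is given by $\psi(u)\int_0^\infty e^{-uy}W(y)dy=1$, $u>0$ (it satisfies $W(0)=0$, $W\in C^1(\mathbb R^+)$, $W^{(1)}>0$). $\kappa(y)=bW^{(1)}(y)+\int_0^yW^{(1)}(y-r)\overline\mu(r)dr$,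 $y>0$; $\underline\kappa(0^+)=\liminf_{y\downarrow0}\kappa(y)$, $\overline\kappa(0^+)=\limsup_{y\downarrow0}\kappa(y)$. When $\sigma=0<b$, $b/\sigma^2$ means $\infty$. *)

(* Defs.v *)
From HB Require Import structures.
From mathcomp Require Import all_boot all_order all_algebra.
From mathcomp Require Import complex.
From mathcomp Require Import all_classical all_reals all_analysis.

Set Implicit Arguments.
Unset Strict Implicit.
Unset Printing Implicit Defensive.

Import Order.TTheory GRing.Theory Num.Theory.
Import numFieldNormedType.Exports.

Local Open Scope classical_set_scope.
Local Open Scope ring_scope.

(* Measures on (0, +oo) are measures on R that do not charge ]-oo, 0].
   Functions on (0, +oo) or [0, +oo) are functions R -> R whose values elsewhere
   are never used. *)

Definition Cplx (R : realType) : numFieldType := R[i].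

Definition disc (R : realType) (rho : \bar R) : set (Cplx R) :=
  [set z : Cplx R | ((Normc.normc z)%:E < rho)%E].

Definition taylor_coef (R : realType) (F : Cplx R -> Cplx R) (n : nat) :
  Cplx R := derive1n n F 0 / n`!%:R.

Definition convergence_radius (R : realType) (a : nat -> Cplx R) : \bar R :=
  ereal_sup [set (Normc.normc z)%:E |
    z in [set z : Cplx R | cvgn (series (fun n => a n * z ^+ n))]].

(* f, given on [0, +oo), belongs to H(rho). *)
Definition in_H (R : realType) (rho : \bar R) (f : R -> R) : Prop :=
  exists F : Cplx R -> Cplx R,
    [/\ forall z, disc rho z -> derivable F z 1,
        convergence_radius (taylor_coef F) = rho
      & forall u : R, 0 <= u -> (u%:E < rho)%E ->
          F (u%:C%C) = (f u)%:C%C].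

Record in_N (R : realType) (sigma m : R)
    (Pi : {measure set (measurableTypeR R) -> \bar R}) (psi : R -> R) : Prop := {
  N_sigma : 0 <= sigma;
  N_m : 0 < m;
  N_Pi : Pi `]-oo, 0]%classic = 0%E;
  N_psi : forall u : R, 0 <= u ->
    (psi u)%:E = ((sigma ^+ 2 * u ^+ 2 + m * u)%:E +
      \int[Pi]_(r in `]0%R, +oo[) (expR (- (u * r)) - 1 + u * r)%:E)%E;
  N_integrable_oo : exists2 A : R, 0 < A &
    (\int[lebesgue_measure]_(u in `[A, +oo[) ((psi u)^-1)%:E < +oo)%E;
  N_holomorphic : exists2 rho : \bar R, (0 < rho)%E & in_H rho psi
}.

Record in_B (R : realType) (b : R)
    (mu : {measure set (measurableTypeR R) -> \bar R}) (phi : R -> R) : Prop := {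
  B_b : 0 <= b;
  B_mu : mu `]-oo, 0]%classic = 0%E;
  B_mu_integrable :
    (\int[mu]_(r in `]0%R, +oo[) (Num.min 1 r)%:E < +oo)%E;
  B_phi : forall u : R, 0 <= u ->
    (phi u)%:E = ((b * u)%:E +
      \int[mu]_(r in `]0%R, +oo[) (1 - expR (- (u * r)))%:E)%E;
  B_holomorphic : exists2 rho : \bar R, (0 < rho)%E & in_H rho phi
}.

(* The measures of in_N and in_B give finite mass to ]y, +oo[ for y > 0, so
   fine is harmless there. *)
Definition tail (R : realType)
    (nu : {measure set (measurableTypeR R) -> \bar R}) (y : R) : R :=
  fine (nu `]y, +oo[%classic).

Definition tail2 (R : realType)
    (nu : {measure set (measurableTypeR R) -> \bar R}) (y : R) : R :=
  \int[lebesgue_measure]_(r in `]y, +oo[) tail nu r.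

(* f is of class C^k on (0, +oo). *)
Definition Ck (R : realType) (k : nat) (f : R -> R) : Prop :=
  (forall i, (i < k)%N -> forall y : R, 0 < y -> derivable (derive1n i f) y 1) /\
  (forall y : R, 0 < y -> {for y, continuous (derive1n k f)}).

Definition L1loc (R : realType) (f : R -> R) : Prop :=
  measurable_fun (`]0, +oo[ : set (measurableTypeR R)) f /\
  forall a : R, 0 < a ->
    (\int[lebesgue_measure]_(y in `]0%R, a[) `|f y|%:E < +oo)%E.

(* The Laplace transform determines W up to null sets only; the C^1 condition
   selects the one that is continuous on (0, +oo). *)
Record scale_function (R : realType) (psi W : R -> R) : Prop := {
  scale_ge0 : forall y : R, 0 <= y -> 0 <= W y;
  scale_laplace : forall u : R, 0 < u ->
    ((psi u)%:E *
      \int[lebesgue_measure]_(y in `[0%R, +oo[) (expR (- (u * y)) * W y)%:E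
      = 1)%E;
  scale0 : W 0 = 0;
  scale_C1 : Ck 1 W;
  scale_derive_gt0 : forall y : R, 0 < y -> 0 < derive1 W y
}.

(* For W a scale function and mu as in in_B, the integral is finite for every
   y > 0: derive1 W is integrable near 0 and so is tail mu. *)
Definition kappa (R : realType) (b : R)
    (mu : {measure set (measurableTypeR R) -> \bar R}) (W : R -> R) (y : R) : R :=
  b * derive1 W y +
  \int[lebesgue_measure]_(r in `]0, y[) (derive1 W (y - r) * tail mu r).

(* lime_inf and lime_sup are two-sided, hence limf_einf and limf_esup. *)
Definition liminf0 (R : realType) (f : R -> R) : \bar R :=
  limf_einf (fun y => (f y)%:E) 0^'+.

Definition limsup0 (R : realType) (f : R -> R) : \bar R :=
  limf_esup (fun y => (f y)%:E) 0^'+.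

(* f(0+), for f monotone on (0, +oo). *)
Definition lim0 (R : realType) (f : R -> R) : \bar R :=
  lim ((f y)%:E @[y --> 0^'+]).

(* Main.v *)
Require Import Defs.
From HB Require Import structures.
From mathcomp Require Import all_boot all_order all_algebra.
From mathcomp Require Import all_classical all_reals all_analysis.
From mathcomp Require Import measurable_realfun.
From mathcomp Require Import ring lra.

(* Write K := m + tail2 Pi. Then psi u = u^2 (sigma^2 + (Laplace K) u), so the
   injectivity of the Laplace transform turns the definition of W into the
   renewal equation sigma^2 W' + W' * K = 1 on ]0, +oo[, while
   kappa = b W' + W' * tail mu.

   If sigma > 0, a Neumann series gives W' = sigma^-2 + prim d1 - prim d2 with
   d1, d2 nonnegative, continuous and locally integrable. Hence
   W'(0+) = sigma^-2, and a convolution with W' is differentiable.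

   If sigma = 0, then W y is comparable to y / int_0^y K, and W is log-concave:
   a violation would produce an interior minimum of a combination of second
   differences of the second antiderivative of W, where integrating its second
   derivative against the kernel K gives a nonnegative value, although the
   renewal equation makes it negative. Since W' / W is nonincreasing, W' t <= M
   for a small t would bound W' by 2 M on ]t, W t / (2 M)[, which contradicts
   W' * K = 1. Hence W'(0+) = +oo.

   For (2)(i) the convolution is cut at y / 2, so that each half is
   differentiated through the factor evaluated away from 0; the boundary term
   W'(y / 2) tail mu (y / 2) is integrable near 0 because W' h has the primitive
   W h + prim (- W h'), where h := tail mu. *)

Set Implicit Arguments.
Unset Strict Implicit.
Unset Printing Implicit Defensive.

Import Order.TTheory GRing.Theory Num.Theory.
Import numFieldNormedType.Exports.

Local Open Scope classical_set_scope.
Local Open Scope ring_scope.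

(** * Convolution and Laplace transform of nonnegative functions on the half-line *)

(** Nonnegativity shapes the whole proof. Convolutions live in [0, +oo], where associativity and
    Laplace transforms cost only Tonelli; so signed functions are carried as pairs of nonnegative
    ones, and identities are rearranged until no subtraction is left.

    The integrability of 1/psi at infinity enters as W(0+) = 0: otherwise 1/psi would dominate a
    multiple of 1/u. Only then is W the primitive of W', and the transform of W' equal to u / psi u.

    That W' / W is nonincreasing is usually read off from excursion theory; the maximum principle
    replaces this. It works because pairing K with s -> W(x + d - s) gives x + d, affine in d, so
    that K does not see second differences of W, whereas the pairing of K with s -> f''(x0 - s) is m
    f'(x0) plus the Pi-integral of f(x0 - r) - f(x0) + r f'(x0), which has a sign at a minimum.
    Extended by 0, W is merely continuous at 0, hence the passage to its second antiderivative, a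
    C^2 test function on the line. *)

Section Convolution.
Context {R : realType}.
Local Notation leb := (@lebesgue_measure R).
Local Open Scope ereal_scope.
Implicit Types (f g h : measurableTypeR R -> \bar R) (x y u : R).

Lemma measurable_reflection y :
  measurable_fun setT ((fun x => y - x)%R : measurableTypeR R -> measurableTypeR R).
Proof. exact: measurable_funB. Qed.

Lemma measurable_translation y :
  measurable_fun setT ((fun x => y + x)%R : measurableTypeR R -> measurableTypeR R).
Proof. exact: measurable_funD. Qed.

Section affine_change.
Variable y : R.
Let refl : measurableTypeR R -> measurableTypeR R := fun x => (y - x)%R.
Let trans : measurableTypeR R -> measurableTypeR R := fun x => (y + x)%R.
Let mrefl : measurable_fun setT refl := measurable_reflection y.
Let mtrans : measurable_fun setT trans := measurable_translation y.
HB.instance Definition _ := isMeasurableFun.Build _ _ _ _ refl mrefl.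
HB.instance Definition _ := isMeasurableFun.Build _ _ _ _ trans mtrans.

(** Uniqueness of Lebesgue measure reduces this to half-open intervals; the reflection closes the
    other end, which the length does not see. *)
Lemma lebesgue_reflection (A : set R) : measurable A ->
  pushforward leb refl A = leb A.
Proof.
move=> mA; apply/esym/lebesgue_measure_unique => // _ [[a b] _ <-].
rewrite /= /pushforward.
have -> : refl @^-1` `]a, b] = `[(y - b)%R, (y - a)%R[%classic.
  by apply/seteqP; split => x /=; rewrite /refl !in_itv/= => /andP[? ?]; apply/andP; split; lra.
rewrite !lebesgue_measure_itv/= !lte_fin ?ltrD2l ?ltrN2.
by case: ifP => // _; rewrite -!EFinD; congr EFin; lra.
Qed.

Lemma lebesgue_translation (A : set R) : measurable A ->
  pushforward leb trans A = leb A.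
Proof.
move=> mA; apply/esym/lebesgue_measure_unique => // _ [[a b] _ <-].
rewrite /= /pushforward.
have -> : trans @^-1` `]a, b] = `](a - y)%R, (b - y)%R]%classic.
  by apply/seteqP; split => x /=; rewrite /trans !in_itv/= => /andP[? ?]; apply/andP; split; lra.
rewrite !lebesgue_measure_itv/= !lte_fin ltrD2r.
by case: ifP => // _; rewrite -!EFinD; congr EFin; lra.
Qed.

Lemma integral_reflection f : measurable_fun setT f -> (forall x, 0 <= f x) ->
  \int[leb]_x f (y - x)%R = \int[leb]_x f x.
Proof.
move=> mf f0.
rewrite [RHS](eq_measure_integral (pushforward leb refl)); last first.
  by move=> A mA _; apply/esym; exact: lebesgue_reflection.
by rewrite ge0_integral_pushforward.
Qed.

Lemma integral_translation f : measurable_fun setT f -> (forall x, 0 <= f x) ->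
  \int[leb]_x f (y + x)%R = \int[leb]_x f x.
Proof.
move=> mf f0.
rewrite [RHS](eq_measure_integral (pushforward leb trans)); last first.
  by move=> A mA _; apply/esym; exact: lebesgue_translation.
by rewrite ge0_integral_pushforward.
Qed.

End affine_change.

(* Convolutions are taken in [0, +oo] on the whole line, where they need no
   integrability; restr extends a function on ]0, +oo[ by 0. *)
Record causal f : Prop := {
  causal_measurable : measurable_fun setT f;
  causal_ge0 : forall x, 0 <= f x;
  causal_le0 : forall x, (x <= 0)%R -> f x = 0 }.

Definition convol f g : measurableTypeR R -> \bar R :=
  fun y => \int[leb]_r (f r * g (y - r)%R).

Lemma measurable_convol2 f g : measurable_fun setT f -> measurable_fun setT g ->
  measurable_fun setT (fun z : measurableTypeR R * measurableTypeR R => f z.2 * g (z.1 - z.2)%R).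
Proof.
move=> mf mg; apply: emeasurable_funM.
  by apply: measurableT_comp => //; exact: measurable_snd.
apply: (measurableT_comp mg) => /=.
by apply: measurable_funB; [exact: measurable_fst|exact: measurable_snd].
Qed.

Lemma measurable_convol f g : measurable_fun setT f -> measurable_fun setT g ->
  (forall x, 0 <= f x) -> (forall x, 0 <= g x) -> measurable_fun setT (convol f g).
Proof.
move=> mf mg f0 g0.
apply: (@measurable_fun_fubini_tonelli_F _ _ _ _ _ leb
  (fun z : measurableTypeR R * measurableTypeR R => f z.2 * g (z.1 - z.2)%R)).
  exact: measurable_convol2.
by move=> z /=; rewrite mule_ge0.
Qed.

Lemma causal_convol f g : causal f -> causal g -> causal (convol f g).
Proof.
move=> cf cg; split.
- apply: measurable_convol; by [exact: causal_measurable|exact: causal_ge0].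
- by move=> x; apply: integral_ge0 => r _; rewrite mule_ge0//; exact: causal_ge0.
- move=> x x0; rewrite /convol (_ : (fun r => _) = cst 0) ?integral0//.
  apply/funext => r /=; have [r0|r0] := leP r 0%R.
    by rewrite (causal_le0 cf) ?mul0e.
  by rewrite (causal_le0 cg) ?mule0//; lra.
Qed.

Lemma convolC f g : causal f -> causal g -> convol f g = convol g f.
Proof.
move=> cf cg; apply/funext => y; rewrite /convol.
rewrite -(integral_reflection y) /=.
- by apply: eq_integral => r _; rewrite muleC; congr (g _ * f _); lra.
- apply: emeasurable_funM; first exact: causal_measurable cf.
  apply: (measurableT_comp (causal_measurable cg)); exact: measurable_reflection.
- by move=> x; rewrite mule_ge0//; exact: causal_ge0.
Qed.

(** Tonelli in (r, s), once the inner variable is translated by r so that h is evaluated at y - s,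
    independently of r. *)
Lemma convolA f g h : causal f -> causal g -> causal h ->
  convol f (convol g h) = convol (convol f g) h.
Proof.
move=> cf cg ch; apply/funext => y.
have mf := causal_measurable cf; have mg := causal_measurable cg.
have mh := causal_measurable ch.
have f0 := causal_ge0 cf; have g0 := causal_ge0 cg; have h0 := causal_ge0 ch.
transitivity (\int[leb]_r \int[leb]_s (f r * g (s - r)%R * h (y - s)%R)).
  apply: eq_integral => r _; rewrite -ge0_integralZl//; last 2 first.
  - apply: emeasurable_funM => //; apply: (measurableT_comp mh).
    exact: measurable_reflection.
  - by move=> s _; rewrite mule_ge0.
  rewrite -[RHS](integral_translation r); last 2 first.
  - apply: emeasurable_funM; last exact: (measurableT_comp mh (measurable_reflection y)).
    by apply: measurable_funeM; apply: (measurableT_comp mg); exact: measurable_funB.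
  - by move=> s; rewrite !mule_ge0.
  apply: eq_integral => s _; rewrite muleA.
  by congr (_ * g _ * h _); lra.
rewrite (@fubini_tonelli _ _ _ _ _ leb leb
  (fun z : measurableTypeR R * measurableTypeR R => f z.1 * g (z.2 - z.1)%R * h (y - z.2)%R)) //=.
- apply: eq_integral => s _; rewrite /convol -ge0_integralZr//.
  + apply: emeasurable_funM => //; apply: (measurableT_comp mg).
    exact: measurable_reflection.
  + by move=> r _; rewrite mule_ge0.
- apply: emeasurable_funM; first apply: emeasurable_funM.
  + by apply: measurableT_comp => //; exact: measurable_fst.
  + apply: (measurableT_comp mg) => /=.
    by apply: measurable_funB; [exact: measurable_snd|exact: measurable_fst].
  + apply: (measurableT_comp mh) => /=.
    by apply: measurable_funB; [exact: measurable_cst|exact: measurable_snd].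
- by move=> z; rewrite !mule_ge0.
Qed.

Lemma causal_add f g : causal f -> causal g -> causal (f \+ g).
Proof.
move=> cf cg; split.
- apply: emeasurable_funD; exact: causal_measurable.
- by move=> x; rewrite adde_ge0//; exact: causal_ge0.
- by move=> x x0; rewrite (causal_le0 cf)// (causal_le0 cg)// adde0.
Qed.

Lemma causal_scale (k : R) f : (0 <= k)%R -> causal f -> causal (fun x => k%:E * f x).
Proof.
move=> k0 cf; split.
- by apply: measurable_funeM; exact: causal_measurable.
- by move=> x; rewrite mule_ge0//; exact: causal_ge0.
- by move=> x x0; rewrite (causal_le0 cf)// mule0.
Qed.

Lemma le_integral_causal f g : causal f -> causal g ->
  (forall x, (0 < x)%R -> f x <= g x) -> \int[leb]_x f x <= \int[leb]_x g x.
Proof.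
move=> cf cg fg; apply: ge0_le_integral => //.
- by move=> x _; exact: causal_ge0.
- exact: causal_measurable.
- exact: causal_measurable.
- move=> x _; have [x0|x0] := leP x 0%R; last exact: fg.
  by rewrite (causal_le0 cf x0) (causal_le0 cg x0).
Qed.

Lemma integral_causalD f g : causal f -> causal g ->
  \int[leb]_x (f x + g x) = \int[leb]_x f x + \int[leb]_x g x.
Proof.
by move=> cf cg; apply: ge0_integralD => // [x _||x _|];
  by [exact: causal_ge0|exact: causal_measurable].
Qed.

Lemma integral_causalZ (k : R) f : (0 <= k)%R -> causal f ->
  \int[leb]_x (k%:E * f x) = k%:E * \int[leb]_x f x.
Proof.
move=> k0 cf; apply: ge0_integralZl_EFin => // [x _|]; first exact: causal_ge0.
exact: causal_measurable.
Qed.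

Lemma causal_mul f g : causal f -> causal g -> causal (fun x => f x * g x).
Proof.
move=> cf cg; split=> [|x|x x0].
- by apply: emeasurable_funM; exact: causal_measurable.
- by apply: mule_ge0; exact: causal_ge0.
- by rewrite (causal_le0 cf x0) mul0e.
Qed.

Lemma measurable_convol_integrand f g y : causal f -> causal g ->
  measurable_fun setT (fun r => f r * g (y - r)%R).
Proof.
move=> cf cg; apply: emeasurable_funM; first exact: causal_measurable.
apply: (measurableT_comp (causal_measurable cg)); exact: measurable_reflection.
Qed.

Lemma convolDr f g h : causal f -> causal g -> causal h ->
  convol f (g \+ h) = convol f g \+ convol f h.
Proof.
move=> cf cg ch; apply/funext => y; rewrite /convol /=.
rewrite -ge0_integralD//; last 4 first.
- by move=> r _; rewrite mule_ge0//; exact: causal_ge0.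
- exact: measurable_convol_integrand.
- by move=> r _; rewrite mule_ge0//; exact: causal_ge0.
- exact: measurable_convol_integrand.
by apply: eq_integral => r _; rewrite ge0_muleDr//; exact: causal_ge0.
Qed.

Lemma convolZr (k : R) f g : (0 <= k)%R -> causal f -> causal g ->
  convol f (fun x => k%:E * g x) = fun y => k%:E * convol f g y.
Proof.
move=> k0 cf cg; apply/funext => y; rewrite /convol -ge0_integralZl//.
- by apply: eq_integral => r _; rewrite muleCA.
- exact: measurable_convol_integrand.
- by move=> r _; rewrite mule_ge0//; exact: causal_ge0.
Qed.

Lemma convolZl (k : R) f g : (0 <= k)%R -> causal f -> causal g ->
  convol (fun x => k%:E * f x) g = fun y => k%:E * convol f g y.
Proof.
move=> k0 cf cg.
by rewrite convolC ?convolZr// 1?convolC//; exact: causal_scale.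
Qed.

Lemma causal_convol_integrand f g y : causal f -> causal g ->
  causal (fun r => f r * g (y - r)%R).
Proof.
move=> cf cg; split=> [|r|r r0]; first exact: measurable_convol_integrand.
  by apply: mule_ge0; exact: causal_ge0.
by rewrite (causal_le0 cf r0) mul0e.
Qed.

Definition laplace u f := \int[leb]_x ((expR (- (u * x)))%:E * f x).

Lemma measurable_exp u : measurable_fun setT (fun x : measurableTypeR R => (expR (- (u * x)))%:E).
Proof.
apply/measurable_EFinP; apply: measurableT_comp => //.
apply: measurableT_comp => //; exact: measurable_funM.
Qed.

Lemma laplace_convol u f g : causal f -> causal g ->
  laplace u (convol f g) = laplace u f * laplace u g.
Proof.
move=> cf cg; rewrite /laplace.
have mf := causal_measurable cf; have mg := causal_measurable cg.
have f0 := causal_ge0 cf; have g0 := causal_ge0 cg.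
have e0 x : 0 <= (expR (- (u * x)))%:E by rewrite lee_fin expR_ge0.
have me := measurable_exp u.
transitivity (\int[leb]_y \int[leb]_r ((expR (- (u * y)))%:E * (f r * g (y - r)%R))).
  apply: eq_integral => y _; rewrite -ge0_integralZl//.
  - exact: measurable_convol_integrand.
  - by move=> r _; rewrite mule_ge0.
rewrite (@fubini_tonelli _ _ _ _ _ leb leb
  (fun z : measurableTypeR R * measurableTypeR R => (expR (- (u * z.1)))%:E * (f z.2 * g (z.1 - z.2)%R))) //=.
- rewrite -ge0_integralZr//; last 3 first.
  + exact: emeasurable_funM.
  + by move=> r _; rewrite mule_ge0.
  + by apply: integral_ge0 => r _; rewrite mule_ge0.
  apply: eq_integral => r _.
  rewrite -ge0_integralZl//; last 3 first.
  + exact: emeasurable_funM.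
  + by move=> s _; rewrite mule_ge0.
  + by rewrite mule_ge0.
  rewrite -[LHS](integral_translation r) /=; last 2 first.
  + apply: emeasurable_funM => //; apply: measurable_funeM.
    by apply: (measurableT_comp mg); exact: measurable_funB.
  + by move=> s; rewrite !mule_ge0.
  apply: eq_integral => s _.
  rewrite (_ : (r + s - r)%R = s); last by lra.
  rewrite mulrDr opprD expRD EFinM -!muleA; congr (_ * _).
  by rewrite muleCA.
- apply: emeasurable_funM; last exact: measurable_convol2.
  by apply: (measurableT_comp me); exact: measurable_fst.
- by move=> z; rewrite !mule_ge0.
Qed.

Lemma causal_laplace_integrand u f : causal f ->
  causal (fun x => (expR (- (u * x)))%:E * f x).
Proof.
move=> cf; split=> [|x|x x0]; last by rewrite (causal_le0 cf x0) mule0.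
  by apply: emeasurable_funM; [exact: measurable_exp|exact: causal_measurable].
by rewrite mule_ge0 ?lee_fin ?expR_ge0//; exact: causal_ge0.
Qed.

Lemma laplaceD u f g : causal f -> causal g ->
  laplace u (f \+ g) = laplace u f + laplace u g.
Proof.
move=> cf cg; rewrite /laplace -integral_causalD; try exact: causal_laplace_integrand.
by apply: eq_integral => r _; rewrite ge0_muleDr//; exact: causal_ge0.
Qed.

Lemma laplaceZ u (k : R) f : (0 <= k)%R -> causal f ->
  laplace u (fun x => k%:E * f x) = k%:E * laplace u f.
Proof.
move=> k0 cf; rewrite /laplace -(integral_causalZ k0 (causal_laplace_integrand u cf)).
by apply: eq_integral => r _; rewrite muleCA.
Qed.

Lemma laplace_ge0 u f : causal f -> 0 <= laplace u f.
Proof.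
move=> cf; apply: integral_ge0 => x _.
by rewrite mule_ge0 ?lee_fin ?expR_ge0//; exact: causal_ge0.
Qed.

(** Convolution with this step is integration from 0. The value 0 at the origin makes it causal. *)
Definition heaviside : measurableTypeR R -> \bar R := fun x => (if 0 < x then 1 else 0)%R%:E.

Definition restr (f : R -> R) : measurableTypeR R -> \bar R :=
  fun x => (if 0 < x then f x else 0)%R%:E.

Lemma restrE (f : R -> R) x : (0 < x)%R -> restr f x = (f x)%:E.
Proof. by rewrite /restr => ->. Qed.

Lemma restr_patch (f : R -> R) : restr f = EFin \o (f \_ `]0%R, +oo[)%R.
Proof.
apply/funext => x; rewrite /restr /= patchE; case: ifPn => x0.
  by rewrite mem_set//= in_itv/= x0.
by rewrite memNset//= in_itv/= andbT; exact/negP.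
Qed.

Lemma causal_restr (f : R -> R) : measurable_fun (`]0%R, +oo[%classic : set (measurableTypeR R)) f ->
  (forall x, (0 < x)%R -> (0 <= f x)%R) -> causal (restr f).
Proof.
move=> mf f0; split.
- rewrite restr_patch; apply/measurable_EFinP.
  by apply/(measurable_restrictT f).
- by move=> x; rewrite /restr lee_fin; case: ifPn => // /f0.
- by move=> x x0; rewrite /restr ltNge x0.
Qed.

Lemma restrD (f g : R -> R) : restr (fun x => f x + g x)%R = restr f \+ restr g.
Proof. by apply/funext => x /=; rewrite /restr; case: ifP => _; rewrite -?EFinD ?addr0. Qed.

Lemma restrZ (c : R) (f : R -> R) : restr (fun x => c * f x)%R = fun x => c%:E * restr f x.
Proof. by apply/funext => x; rewrite /restr; case: ifP => _; rewrite ?mule0. Qed.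

Lemma restr_cst (c : R) : restr (fun=> c) = fun x => c%:E * heaviside x.
Proof.
by apply/funext => x; rewrite /restr /heaviside; case: ifP => _; rewrite ?mule1 ?mule0.
Qed.

Lemma causal_heaviside : causal heaviside.
Proof. by apply: (@causal_restr (fun=> 1%R)). Qed.

Lemma convol_heavisideE f y : causal f ->
  convol heaviside f y = \int[leb]_(r in `]0%R, y[) f r.
Proof.
move=> cf; rewrite convolC//; last exact: causal_heaviside.
rewrite [RHS]integral_mkcond; apply: eq_integral => r _.
rewrite patchE /heaviside subr_gt0; case: ifPn => [ry|ry].
  rewrite mule1; have [r0|r0] := ltP 0%R r.
    by rewrite mem_set//= in_itv/= r0 ry.
  by rewrite (causal_le0 cf)//; case: ifP.
by rewrite mule0 memNset//= in_itv/= (negbTE ry) andbF.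
Qed.

End Convolution.

(** * Dominated convergence and Bernoulli-type bounds *)

Section Regular.
Context {R : realType}.
Local Notation leb := (@lebesgue_measure R).
Local Notation RM := (measurableTypeR R).

(** The integrands in use jump at a single place (the midpoint of a half-convolution, the level of a
    truncation), so pointwise convergence is required off one point only. *)
Lemma dominated_cvg_off_point (f_ : nat -> RM -> R) (f g : RM -> R) (p : R) :
  (forall n, measurable_fun setT (f_ n)) -> measurable_fun setT f ->
  measurable_fun setT g -> (\int[leb]_x (g x)%:E < +oo)%E ->
  (forall x, x != p -> f_ n x @[n --> \oo] --> f x) ->
  (forall n x, `|f_ n x| <= g x) ->
  (\int[leb]_x (f_ n x)%:E)%E @[n --> \oo] --> (\int[leb]_x (f x)%:E)%E.
Proof.
move=> mf_ mf mg ig fp fg.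
have g0 x : 0 <= g x by exact: le_trans (fg 0%N x).
have [] := @dominated_convergence _ _ _ leb setT measurableT
  (fun n x => (f_ n x)%:E) (EFin \o f) (EFin \o g) => //.
- by move=> n; apply/measurable_EFinP.
- exact/measurable_EFinP.
- exists [set p]; split => //; first exact: lebesgue_measure_set1.
  move=> x /=; apply: contra_notP => xp _; apply/cvg_EFin; first exact: nearW.
  by apply: fp; apply/eqP.
- apply/integrableP; split; first exact/measurable_EFinP.
  by under eq_integral do rewrite /= ger0_norm//.
- by apply: aeW => x n _; rewrite lee_fin.
Qed.

Definition zext (f : R -> R) : RM -> R := fun x => if 0 < x then f x else 0.

Lemma zextE f x : 0 < x -> zext f x = f x.
Proof. by rewrite /zext => ->. Qed.

Lemma zext0 f x : x <= 0 -> zext f x = 0.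
Proof. by rewrite /zext ltNge => ->. Qed.

Lemma zext_ge0 f x : (forall x, 0 < x -> 0 <= f x) -> 0 <= zext f x.
Proof. by rewrite /zext; case: ifPn => // x0; exact. Qed.

Lemma continuous_pos_measurable (f : R -> R) :
  (forall x, 0 < x -> {for x, continuous f}) ->
  measurable_fun (`]0, +oo[ : set RM) f.
Proof.
move=> cf; apply: open_continuous_measurable_fun; first exact: interval_open.
by move=> x; rewrite inE/= in_itv/= andbT => /cf.
Qed.

Lemma one_sub_exprn_ge (a : R) N : 0 <= a <= 1 -> 1 - N%:R * a <= (1 - a) ^+ N.
Proof.
move=> /andP[a0 a1]; elim: N => [|N IH]; first by rewrite expr0 mul0r subr0.
rewrite exprS; apply: (@le_trans _ _ ((1 - a) * (1 - N%:R * a))).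
  have := mulr_ge0 (ler0n R N) (mulr_ge0 a0 a0).
  by rewrite -natr1; nra.
by apply: ler_wpM2l => //; lra.
Qed.

(** From N a <= (1 + a)^N and (1 - a)(1 + a) <= 1. *)
Lemma one_sub_exprn_le (a : R) N : 0 <= a <= 1 -> (1 - a) ^+ N * (N%:R * a) <= 1.
Proof.
move=> /andP[a0 a1].
have H : N%:R * a <= (1 + a) ^+ N.
  elim: N => [|N IH]; first by rewrite expr0 mul0r.
  rewrite exprS -natr1.
  have : 1 <= (1 + a) ^+ N by apply: exprn_ege1; lra.
  by nra.
apply: (@le_trans _ _ ((1 - a) ^+ N * (1 + a) ^+ N)).
  by apply: ler_wpM2l => //; rewrite exprn_ge0; lra.
by rewrite -exprMn exprn_ile1//; nra.
Qed.

(** With exponent N = 2^n and a = t^n the product N a is (2 t)^n, so the threshold sits at t = 1/2;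
    the two Bernoulli-type bounds settle one side each. *)
Lemma cvg_two_powers_lt (t : R) : 0 <= t < 2^-1 ->
  (1 - t ^+ n) ^+ (2 ^ n) @[n --> \oo] --> (1 : R).
Proof.
move=> /andP[t0 t2].
have tn n : 0 <= t ^+ n <= 1 by rewrite exprn_ge0// exprn_ile1//; lra.
apply: (@squeeze_cvgr _ _ _ _ (fun n => 1 - (2 * t) ^+ n) (fun=> 1)); last exact: cvg_cst.
  apply: nearW => n; have /andP[? ?] := tn n; apply/andP; split; last first.
    by apply: exprn_ile1; lra.
  by apply: le_trans (one_sub_exprn_ge _ (tn n)); rewrite natrX exprMn.
rewrite -[X in _ --> X]subr0; apply: cvgB; first exact: cvg_cst.
by apply: cvg_expr; rewrite ger0_norm; lra.
Qed.

Lemma cvg_two_powers_gt (t : R) : 2^-1 < t <= 1 ->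
  (1 - t ^+ n) ^+ (2 ^ n) @[n --> \oo] --> (0 : R).
Proof.
move=> /andP[t2 t1].
have tn n : 0 <= t ^+ n <= 1 by rewrite exprn_ge0 ?exprn_ile1//; lra.
apply: (@squeeze_cvgr _ _ _ _ (fun=> 0) (fun n => (2 * t)^-1 ^+ n)); first last.
- by apply: cvg_expr; rewrite ger0_norm ?invr_ge0 ?invf_lt1; lra.
- exact: cvg_cst.
apply: nearW => n; have /andP[? ?] := tn n; apply/andP; split.
  by rewrite exprn_ge0//; lra.
have := one_sub_exprn_le (2 ^ n) (tn n).
by rewrite natrX -exprMn exprVn -ler_pdivlMr ?div1r// exprn_gt0//; lra.
Qed.

End Regular.

(** * Half-convolutions and regularity of convolutions *)

Section HalfConvolution.
Context {R : realType}.
Local Notation leb := (@lebesgue_measure R).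
Local Notation RM := (measurableTypeR R).

(** The working class: its members may blow up at 0, yet it is stable under sums, nonnegative
    multiples, primitives and convolution. *)
Record cl1 (f : R -> R) : Prop := {
  cl1_ge0 : forall x, 0 < x -> 0 <= f x;
  cl1_cont : forall x, 0 < x -> {for x, continuous f};
  cl1_int : forall a, (\int[leb]_(x in `]0%R, a[) (f x)%:E < +oo)%E }.

Lemma restr_zext (f : R -> R) x : restr f x = (zext f x)%:E.
Proof. by []. Qed.

Lemma pos_continuous_causal (f : R -> R) : (forall x, 0 < x -> 0 <= f x) ->
  (forall x, 0 < x -> {for x, continuous f}) -> causal (restr f).
Proof. by move=> f0 cf; apply: causal_restr => //; exact: continuous_pos_measurable. Qed.

Lemma cl1_causal f : cl1 f -> causal (restr f).
Proof. by case=> f0 cf _; exact: pos_continuous_causal. Qed.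

Lemma causal_measurable_zext (f : R -> R) : causal (restr f) -> measurable_fun setT (zext f : RM -> R).
Proof. by move=> /causal_measurable/measurable_EFinP. Qed.

Lemma integral_restr_itv (f : R -> R) a :
  (\int[leb]_(x in `]0%R, a[) (f x)%:E = \int[leb]_(x in `]0%R, a[) restr f x)%E.
Proof.
apply: eq_integral => x; rewrite inE/= in_itv/= => /andP[x0 _].
by rewrite restrE.
Qed.

Lemma continuous_segment_bounded (g : R -> R) (a b : R) : 0 < a ->
  (forall x, 0 < x -> {for x, continuous g}) ->
  exists M, 0 <= M /\ forall x, a <= x <= b -> g x <= M.
Proof.
move=> a0 cg; have [ab|ba] := leP a b; last first.
  by exists 0; split => // x /andP[ax xb]; lra.
have [|c _ cM] := @EVT_max R g a b ab.
  apply: continuous_in_subspaceT => x; rewrite inE/= in_itv/= => /andP[ax _].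
  by apply: cg; exact: lt_le_trans ax.
exists `|g c|; split => // x xab; apply: le_trans (ler_norm _); apply: cM.
by rewrite in_itv.
Qed.

(* The value 1/2 at 0 makes [theta z + theta (- z) = 1] hold for every z. *)
Definition theta (z : R) : R := if z < 0 then 0 else if z == 0 then 2^-1 else 1.

Lemma theta01 z : 0 <= theta z <= 1.
Proof. by rewrite /theta; case: ifP => _; [lra|case: ifP => _; lra]. Qed.

Lemma thetaDN z : theta z + theta (- z) = 1.
Proof. by rewrite /theta oppr_lt0 oppr_eq0; case: ltgtP => _; lra. Qed.

Lemma theta_gt0 z : 0 < z -> theta z = 1.
Proof. by move=> z0; rewrite /theta ltNge ltW//= gt_eqF. Qed.

Lemma theta_lt0 z : z < 0 -> theta z = 0.
Proof. by rewrite /theta => ->. Qed.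

Lemma measurable_theta : measurable_fun setT (theta : RM -> R).
Proof.
apply: nondecreasing_measurable => // x y; rewrite le_eqVlt => /orP[/eqP->//|xy].
have := theta01 x; have := theta01 y; rewrite /theta.
by case: (ltgtP x 0) => // ?; case: (ltgtP y 0) => // ? /andP[? ?] /andP[? ?]; lra.
Qed.

(** The part r < y / 2 of the convolution of f and g, where g is evaluated at y - r >= y / 2, away
    from 0: only f has to be integrable near 0. *)
Definition hc (f g : R -> R) (y : R) : \bar R :=
  (\int[leb]_r (zext f r * (zext g (y - r) * theta (y - 2 * r)))%:E)%E.

Lemma measurable_hc_integrand (f g : R -> R) y : causal (restr f) -> causal (restr g) ->
  measurable_fun setT (fun r : RM => zext f r * (zext g (y - r) * theta (y - 2 * r))).
Proof.
move=> /causal_measurable_zext mf /causal_measurable_zext mg.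
apply: measurable_funM => //; apply: measurable_funM.
  exact: (measurableT_comp mg (measurable_reflection y)).
apply: (measurableT_comp measurable_theta); by apply: measurable_funB => //; exact: measurable_funM.
Qed.

Lemma hc_integrand_ge0 (f g : R -> R) y r : (forall x, 0 < x -> 0 <= f x) ->
  (forall x, 0 < x -> 0 <= g x) ->
  0 <= zext f r * (zext g (y - r) * theta (y - 2 * r)).
Proof.
move=> f0 g0; have /andP[t0 _] := theta01 (y - 2 * r).
by rewrite !mulr_ge0// zext_ge0.
Qed.

(** The reflection r -> y - r turns the weight [theta (y - 2 * r)] into its complement given by
    [thetaDN]. *)
Lemma convol_half (f g : R -> R) y : causal (restr f) -> causal (restr g) ->
  (forall x, 0 < x -> 0 <= f x) -> (forall x, 0 < x -> 0 <= g x) ->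
  convol (restr f) (restr g) y = (hc f g y + hc g f y)%E.
Proof.
move=> cf cg f0 g0; rewrite [X in (_ + X)%E](_ : _ =
    (\int[leb]_r (zext f r * (zext g (y - r) * theta (- (y - 2 * r))))%:E)%E).
  rewrite -ge0_integralD//; first last.
  - apply/measurable_EFinP; have mf := causal_measurable_zext cf.
    have mg := causal_measurable_zext cg.
    apply: measurable_funM => //; apply: measurable_funM.
      exact: (measurableT_comp mg (measurable_reflection y)).
    apply: (measurableT_comp measurable_theta); apply: measurableT_comp => //.
    by apply: measurable_funB => //; exact: measurable_funM.
  - by move=> x _; rewrite lee_fin; have /andP[? _] := theta01 (- (y - 2 * x));
      rewrite !mulr_ge0// zext_ge0.
  - by apply/measurable_EFinP; exact: measurable_hc_integrand.
  - by move=> x _; rewrite lee_fin hc_integrand_ge0.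
  apply: eq_integral => r _; rewrite !restr_zext -EFinM -EFinD; congr EFin.
  by have := thetaDN (y - 2 * r); set p := theta _; set q := theta _ => pq; rewrite -mulrDr -mulrDr pq mulr1.
rewrite /hc -(integral_reflection y).
- apply: eq_integral => r _; congr EFin.
  rewrite [zext g _ * _]mulrCA; congr (_ * _); first by congr (zext f _); lra.
  by congr (_ * theta _); lra.
- by apply/measurable_EFinP; exact: measurable_hc_integrand.
- by move=> x; rewrite lee_fin hc_integrand_ge0.
Qed.

Section half.
Variables f g : R -> R.
Hypothesis cl1f : cl1 f.
Hypotheses (g0 : forall x, 0 < x -> 0 <= g x)
  (cg : forall x, 0 < x -> {for x, continuous g}).
Let f0 := cl1_ge0 cl1f.
Let Cf := cl1_causal cl1f.
Let Cg : causal (restr g) := pos_continuous_causal g0 cg.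

(** Where [theta] is nonzero, r <= y / 2, so y - r lies in [a, b] and g is at most M there. The
    majorant does not depend on y, as dominated convergence requires. *)
Let bound (a b : R) (M : R) (y r : R) : 0 < a -> 2 * a <= y <= b ->
  (forall x, a <= x <= b -> g x <= M) -> 0 <= M ->
  zext f r * (zext g (y - r) * theta (y - 2 * r)) <= M * (if r < b then zext f r else 0).
Proof.
move=> a0 /andP[ay yb] gM M0.
have [r0|r0] := leP r 0; first by rewrite zext0// mul0r; case: ifP; rewrite mulr0.
have f0r : 0 <= zext f r by exact: zext_ge0.
have /andP[t0 t1] := theta01 (y - 2 * r).
have [yr|yr] := ltP (y - 2 * r) 0.
  by rewrite (theta_lt0 yr) !mulr0 mulr_ge0//; case: ifP.
have -> : r < b by lra.
rewrite [leRHS]mulrC; apply: ler_wpM2l => //.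
have yr0 : 0 < y - r by lra.
rewrite zextE//; have : g (y - r) <= M by apply: gM; lra.
by have := g0 yr0; nra.
Qed.

Let int_bound M b : 0 <= M ->
  (\int[leb]_r (M * (if (r < b)%R then zext f r else 0))%:E < +oo)%E.
Proof.
move=> M0; under eq_integral do rewrite EFinM.
have mf : measurable_fun setT (fun r : RM => if r < b then zext f r else 0).
  apply: measurable_fun_if => //; first exact: measurable_fun_ltr.
  by apply: measurable_funTS; exact: causal_measurable_zext.
rewrite ge0_integralZl_EFin//; last 2 first.
- by move=> x _; rewrite lee_fin; case: ifP => // _; exact: zext_ge0.
- exact/measurable_EFinP.
apply: lte_mul_pinfty => //.
rewrite (_ : (fun r => _) = ((restr f) \_ `]0%R, b[)%E); last first.
  apply/funext => r; rewrite patchE; have [r0|r0] := leP r 0.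
    by rewrite zext0// memNset/= ?in_itv/= ?(leNgt,negbTE)//; [case: ifP|rewrite ltNge r0].
  have [rb|rb] := ltP r b; first by rewrite mem_set//= in_itv/= r0 rb.
  by rewrite memNset//= in_itv/= r0/=; apply/negP; rewrite -leNgt.
by rewrite -integral_mkcond -integral_restr_itv; exact: cl1_int.
Qed.

Lemma hc_lty y : 0 < y -> (hc f g y < +oo)%E.
Proof.
move=> y0; have y2 : 0 < y / 2 by rewrite divr_gt0.
have [M [M0 gM]] := continuous_segment_bounded y y2 cg.
apply: le_lt_trans (int_bound y M0); apply: ge0_le_integral => //.
- by move=> x _; rewrite lee_fin hc_integrand_ge0.
- by apply/measurable_EFinP; exact: measurable_hc_integrand.
- apply/measurable_EFinP; apply: measurable_funM => //.
  apply: measurable_fun_if => //; first exact: measurable_fun_ltr.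
  by apply: measurable_funTS; exact: causal_measurable_zext.
- by move=> x _; rewrite lee_fin; apply: (bound (a := y / 2)) => //; lra.
Qed.

Lemma hc_ge0 y : (0 <= hc f g y)%E.
Proof. by apply: integral_ge0 => x _; rewrite lee_fin hc_integrand_ge0. Qed.

Lemma hc_fin_num y : 0 < y -> hc f g y \is a fin_num.
Proof. by move=> y0; rewrite ge0_fin_numE ?hc_lty// hc_ge0. Qed.

Lemma hc_continuous y : 0 < y -> {for y, continuous (fun z => fine (hc f g z))}.
Proof.
move=> y0; apply/(@cvg_nbhsP _ R^o) => u uy.
(* Arguments near y stay above y / 2, so g is only evaluated above half of that. *)
have y4 : 0 < y / 4 by rewrite divr_gt0.
have [M [M0 gM]] := continuous_segment_bounded (2 * y) y4 cg.
have [N _ HN] : \forall n \near \oo, y / 2 <= u n <= 2 * y.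
  have y2 : 0 < y / 2 by rewrite divr_gt0.
  have /cvgrPdist_le/(_ _ y2) := uy.
  by apply: filterS => n; rewrite ler_distlC => /andP[? ?]; lra.
rewrite -(cvg_shiftn N).
apply: fine_cvg; rewrite fineK ?hc_fin_num//.
apply: (@dominated_cvg_off_point R _ _ (fun r => M * (if r < 2 * y then zext f r else 0)) (y / 2)).
- by move=> n; exact: measurable_hc_integrand.
- exact: measurable_hc_integrand.
- apply: measurable_funM => //.
  apply: measurable_fun_if => //; first exact: measurable_fun_ltr.
  by apply: measurable_funTS; exact: causal_measurable_zext.
- exact: int_bound.
- move=> r ry; have uNy : u (n + N)%N @[n --> \oo] --> y by rewrite (cvg_shiftn N).
  have [r0|r0] := leP r 0.
    by rewrite zext0// mul0r; under eq_cvg do rewrite mul0r; exact: cvg_cst.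
  apply: cvgM; first exact: cvg_cst.
  have uNr c : u (n + N)%N - c @[n --> \oo] --> y - c by apply: cvgB => //; exact: cvg_cst.
  move: ry; rewrite neq_lt => /orP[ry|ry].
    have yr : 0 < y - 2 * r by lra.
    have yr1 : 0 < y - r by lra.
    rewrite zextE// theta_gt0// mulr1.
    apply: (@cvg_trans _ (g (u (n + N)%N - r) @[n --> \oo])).
      apply: near_eq_cvg; near=> n.
      rewrite zextE ?theta_gt0 ?mulr1//.
        by near: n; exact: (cvgr_gt _ (uNr (2 * r))).
      by near: n; exact: (cvgr_gt _ (uNr r)).
    have := cg yr1; move/(@cvg_nbhsP _ R^o); apply; exact: uNr.
  have yr : y - 2 * r < 0 by lra.
  rewrite theta_lt0// mulr0.
  apply: (@cvg_trans _ ((0 : R) @[n --> \oo])); last exact: cvg_cst.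
  apply: near_eq_cvg; near=> n.
  rewrite theta_lt0 ?mulr0//.
  by near: n; exact: (cvgr_lt _ (uNr (2 * r))).
- move=> n r; rewrite ger0_norm ?hc_integrand_ge0//.
  by apply: (bound (a := y / 4)) => //; have := HN (n + N)%N (leq_addl _ _); lra.
Unshelve. all: by end_near. Qed.

End half.
End HalfConvolution.

(** * Real-valued convolutions, primitives and their derivatives *)

Section ConvolutionRegularity.
Context {R : realType}.
Local Notation leb := (@lebesgue_measure R).
Local Notation RM := (measurableTypeR R).
Implicit Types (f g h d p q k : R -> R) (x y z c a : R).

Definition cutoff (a : R) (F : RM -> \bar R) : RM -> \bar R :=
  fun x => if x < a then F x else 0%E.

Lemma causal_cutoff a F : causal F -> causal (cutoff a F).
Proof.
move=> cF; split.
- apply: measurable_fun_if => //; first exact: measurable_fun_ltr.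
  by apply: measurable_funTS; exact: causal_measurable.
- by move=> x; rewrite /cutoff; case: ifP => // _; exact: causal_ge0.
- by move=> x x0; rewrite /cutoff (causal_le0 cF)//; case: ifP.
Qed.

Lemma integral_cutoff a F : causal F ->
  (\int[leb]_x cutoff a F x = \int[leb]_(x in `]0%R, a[) F x)%E.
Proof.
move=> cF; rewrite [RHS]integral_mkcond; apply: eq_integral => x _.
rewrite patchE /cutoff; have [x0|x0] := leP x 0.
  by rewrite (causal_le0 cF)//; case: ifP => //; case: ifP.
have [xa|ax] := ltP x a; first by rewrite mem_set//= in_itv/= x0 xa.
by rewrite memNset//= in_itv/= x0/=; apply/negP; rewrite -leNgt.
Qed.

(** Below [a] the convolution only involves the factors cut at [a]; the Laplace transform at 0 is
    the total mass and is multiplicative. *)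
Lemma integral_convol_itv (F G : RM -> \bar R) a : causal F -> causal G ->
  (\int[leb]_(y in `]0%R, a[) convol F G y <=
   \int[leb]_(y in `]0%R, a[) F y * \int[leb]_(y in `]0%R, a[) G y)%E.
Proof.
move=> cF cG; have cFa := causal_cutoff a cF; have cGa := causal_cutoff a cG.
have L H : causal H -> laplace 0 H = (\int[leb]_y H y)%E.
  by move=> cH; apply: eq_integral => y _; rewrite mul0r oppr0 expR0 mul1e.
rewrite -!integral_cutoff//; last exact: causal_convol.
rewrite -(L _ cFa) -(L _ cGa) -laplace_convol// L; last exact: causal_convol.
apply: ge0_le_integral => //.
- by move=> y _; apply: causal_ge0; apply: causal_cutoff; exact: causal_convol.
- by apply: causal_measurable; apply: causal_cutoff; exact: causal_convol.
- by apply: causal_measurable; exact: causal_convol.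
- move=> y _; rewrite {1}/cutoff; case: ifPn => ya; last first.
    by apply: causal_ge0; exact: causal_convol.
  apply: ge0_le_integral => //.
  + by move=> r _; apply: mule_ge0; exact: causal_ge0.
  + exact: measurable_convol_integrand.
  + exact: measurable_convol_integrand.
  + move=> r _; have [r0|r0] := leP r 0; first by rewrite (causal_le0 cF)// mul0e mule_ge0//; exact: causal_ge0.
    have [yr|ry] := leP (y - r) 0.
      by rewrite (causal_le0 cG yr) mule0 mule_ge0//; exact: causal_ge0.
    by rewrite /cutoff !ifT//; lra.
Qed.

(* The two alternatives keep the singularities at 0 of both factors apart. *)
Lemma convol_le_split (F G : RM -> \bar R) (M c t y : R) : causal F -> causal G ->
  0 <= M -> 0 <= c ->
  (forall r s, 0 < r -> 0 < s -> r + s = y -> (G s <= M%:E)%E \/ s < t /\ (F r <= c%:E)%E) ->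
  (convol F G y <=
   M%:E * \int[leb]_x cutoff y F x + c%:E * \int[leb]_x cutoff t G x)%E.
Proof.
move=> cF cG M0 c0 H; have cFy := causal_cutoff y cF; have cGt := causal_cutoff t cG.
have mr : measurable_fun setT (fun r : RM => cutoff t G (y - r)).
  exact: (measurableT_comp (causal_measurable cGt) (measurable_reflection y)).
rewrite -(integral_reflection y (causal_measurable cGt) (causal_ge0 cGt)).
rewrite -(integral_causalZ M0 cFy) -ge0_integralZl_EFin//; last first.
  by move=> r _; exact: (causal_ge0 cGt).
have cMF := causal_scale M0 cFy; rewrite -ge0_integralD//; first last.
- exact: measurable_funeM.
- by move=> r _; apply: mule_ge0 => //; exact: (causal_ge0 cGt).
- exact: (causal_measurable cMF).
- by move=> r _; exact: (causal_ge0 cMF).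
apply: ge0_le_integral => //.
- by move=> r _; exact: (causal_ge0 (causal_convol_integrand y cF cG)).
- exact: measurable_convol_integrand.
- apply: emeasurable_funD; [exact: (causal_measurable cMF)|exact: measurable_funeM].
move=> r _; have F0 := causal_ge0 cFy r; have G0 := causal_ge0 cGt (y - r).
have [r0|r0] := leP r 0.
  by rewrite (causal_le0 cF r0) mul0e adde_ge0 ?mule_ge0.
have [yr|yr] := leP (y - r) 0.
  by rewrite (causal_le0 cG yr) mule0 adde_ge0 ?mule_ge0.
have [GM|[st Fc]] := H r (y - r) r0 yr (subrKC _ _).
  apply: (@le_trans _ _ (M%:E * cutoff y F r)%E); last by rewrite leeDl// mule_ge0.
  rewrite /cutoff -subr_gt0 yr muleC; apply: lee_wpmul2r => //; exact: causal_ge0.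
apply: (@le_trans _ _ (c%:E * cutoff t G (y - r)%R)%E); last by rewrite leeDr// mule_ge0.
by rewrite /cutoff st; apply: lee_wpmul2r => //; exact: causal_ge0.
Qed.

Lemma convol_le_cst h f c y : causal (restr h) -> causal (restr f) -> 0 <= c ->
  (forall x, 0 < x -> x < y -> f x <= c) ->
  (convol (restr h) (restr f) y <= c%:E * \int[leb]_x cutoff y (restr h) x)%E.
Proof.
move=> Ch Cf c0 H; have := @convol_le_split _ _ c 0 0 y Ch Cf c0 (lexx 0).
rewrite mul0e adde0; apply => r s r0 s0 rs; left.
by rewrite restrE// lee_fin; apply: H; lra.
Qed.

Lemma convol_ge_cst h f c y z : causal (restr h) -> causal (restr f) -> 0 <= c -> y <= z ->
  (forall x, z - y < x -> x < z -> c <= f x) ->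
  (c%:E * \int[leb]_x cutoff y (restr h) x <= convol (restr h) (restr f) z)%E.
Proof.
move=> Ch Cf c0 yz H; have CC := causal_cutoff y Ch.
rewrite -(integral_causalZ c0 CC); apply: le_integral_causal; first exact: causal_scale.
  exact: causal_convol_integrand.
move=> s s0; rewrite /cutoff; case: ifPn => sy.
  rewrite muleC; apply: lee_wpmul2l; first exact: (causal_ge0 Ch).
  by rewrite restrE ?lee_fin; [apply: H|]; lra.
by rewrite mule0; exact: (causal_ge0 (causal_convol_integrand z Ch Cf)).
Qed.

Definition rconv f g : R -> R := fun y => fine (convol (restr f) (restr g) y).

Definition prim f : R -> R := fun y => \int[leb]_(x in `]0, y[) f x.

Lemma cl1_int_restr f a : cl1 f -> (\int[leb]_(x in `]0%R, a[) restr f x < +oo)%E.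
Proof. by move=> cf; rewrite -integral_restr_itv; exact: cl1_int. Qed.

Lemma cl1_dom f : (forall x, 0 < x -> 0 <= f x) ->
  (forall x, 0 < x -> {for x, continuous f}) ->
  (forall a, exists2 g, cl1 g & forall x, 0 < x -> x < a -> f x <= g x) -> cl1 f.
Proof.
move=> f0 cf H; split => // a; have [g cg fg] := H a.
have Cf := pos_continuous_causal f0 cf; have Cg := cl1_causal cg.
apply: le_lt_trans (cl1_int cg a).
rewrite (integral_restr_itv f) (integral_restr_itv g) -(integral_cutoff a Cf) -(integral_cutoff a Cg).
apply: le_integral_causal; [exact: causal_cutoff|exact: causal_cutoff|move=> x x0].
by rewrite /cutoff; case: ifPn => // xa; rewrite !restrE// lee_fin fg.
Qed.

Lemma convol_cl1_lty f g y : cl1 f -> cl1 g -> 0 < y ->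
  (convol (restr f) (restr g) y < +oo)%E.
Proof.
move=> cf cg y0.
rewrite convol_half; [|exact: cl1_causal|exact: cl1_causal|exact: cl1_ge0|exact: cl1_ge0].
rewrite lte_add_pinfty// hc_lty//; by [exact: cl1_ge0|exact: cl1_cont].
Qed.

Lemma convol_cl1_fin_num f g y : cl1 f -> cl1 g -> 0 < y ->
  convol (restr f) (restr g) y \is a fin_num.
Proof.
move=> cf cg y0; rewrite ge0_fin_numE ?convol_cl1_lty//.
by apply: causal_ge0; apply: causal_convol; exact: cl1_causal.
Qed.

Lemma restr_rconv f g : cl1 f -> cl1 g ->
  restr (rconv f g) = convol (restr f) (restr g).
Proof.
move=> cf cg; apply/funext => y; have [y0|y0] := leP y 0.
  rewrite [RHS](causal_le0 _ y0); first by rewrite /restr ltNge y0.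
  by apply: causal_convol; exact: cl1_causal.
by rewrite restrE// fineK// convol_cl1_fin_num.
Qed.

(** Continuity holds for each half separately, since one factor then stays away from its singularity
    at 0; local integrability is [integral_convol_itv]. *)
Lemma cl1_rconv f g : cl1 f -> cl1 g -> cl1 (rconv f g).
Proof.
move=> cf cg; split.
- move=> x x0; apply: fine_ge0; apply: causal_ge0.
  by apply: causal_convol; exact: cl1_causal.
- move=> x x0; have [f0 cof _] := cf; have [g0 cog _] := cg.
  have E : \forall z \near x, fine (hc f g z) + fine (hc g f z) = rconv f g z.
    near=> z; have z0 : 0 < z by near: z; exact: lt_nbhsr.
    rewrite /rconv convol_half//; [|exact: cl1_causal|exact: cl1_causal].
    by rewrite [RHS]fineD; [by []|exact: hc_fin_num|exact: hc_fin_num].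
  rewrite /prop_for /continuous_at -(nbhs_singleton E).
  apply: cvg_trans; first exact: near_eq_cvg E.
  by apply: cvgD; exact: hc_continuous.
- move=> a; rewrite integral_restr_itv restr_rconv//.
  apply: le_lt_trans (integral_convol_itv _ _ _) _; [exact: cl1_causal|exact: cl1_causal|].
  by rewrite lte_mul_pinfty//; [apply: integral_ge0 => x _; apply: causal_ge0; exact: cl1_causal|
    rewrite ge0_fin_numE ?cl1_int_restr//; apply: integral_ge0 => x _; apply: causal_ge0; exact: cl1_causal|exact: cl1_int_restr].
Unshelve. all: by end_near. Qed.

Lemma rconvC f g : cl1 f -> cl1 g -> rconv f g = rconv g f.
Proof. by move=> cf cg; rewrite /rconv convolC//; exact: cl1_causal. Qed.

Lemma cl1_cst (c : R) : 0 <= c -> cl1 (fun=> c).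
Proof.
move=> c0; split => //; first by move=> x _; exact: cvg_cst.
by move=> a; rewrite integral_cst//= lebesgue_measure_itv/=; case: ifP => _; rewrite ?mule0// -EFinD -EFinM ltry.
Qed.

Lemma cl1D f g : cl1 f -> cl1 g -> cl1 (fun x => f x + g x).
Proof.
move=> cf cg; split.
- by move=> x x0; rewrite addr_ge0//; exact: cl1_ge0.
- by move=> x x0; apply: cvgD; exact: cl1_cont.
- move=> a; under eq_integral do rewrite EFinD.
  have m h : cl1 h -> measurable_fun (`]0%R, a[%classic : set RM) (EFin \o h).
    move=> ch; apply/measurable_EFinP.
    apply: measurable_funS (continuous_pos_measurable (cl1_cont ch)) => //.
    by move=> x /=; rewrite !in_itv/= => /andP[->].
  have p h : cl1 h -> forall x, (`]0%R, a[%classic : set RM) x -> (0 <= (h x)%:E)%E.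
    by move=> ch x /=; rewrite in_itv/= => /andP[x0 _]; rewrite lee_fin; exact: cl1_ge0.
  rewrite ge0_integralD//; [|exact: p|exact: m|exact: p|exact: m].
  by rewrite lte_add_pinfty// cl1_int.
Qed.

Lemma cl1Z (c : R) f : 0 <= c -> cl1 f -> cl1 (fun x => c * f x).
Proof.
move=> c0 cf; split.
- by move=> x x0; rewrite mulr_ge0//; exact: cl1_ge0.
- by move=> x x0; apply: cvgM; [exact: cvg_cst|exact: cl1_cont].
- move=> a; under eq_integral do rewrite EFinM.
  rewrite ge0_integralZl_EFin//.
  + by rewrite lte_mul_pinfty// cl1_int.
  + by move=> x /=; rewrite in_itv/= => /andP[x0 _]; rewrite lee_fin; exact: cl1_ge0.
  + apply/measurable_EFinP.
    apply: measurable_funS (continuous_pos_measurable (cl1_cont cf)) => //.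
    by move=> x /=; rewrite !in_itv/= => /andP[->].
Qed.

Lemma primE f y : cl1 f -> (prim f y)%:E = convol heaviside (restr f) y.
Proof.
move=> cf; rewrite convol_heavisideE; last exact: cl1_causal.
rewrite -integral_restr_itv fineK// ge0_fin_numE ?cl1_int//.
by apply: integral_ge0 => x /=; rewrite in_itv/= => /andP[x0 _]; rewrite lee_fin; exact: cl1_ge0.
Qed.

Lemma prim_is_derive f y : cl1 f -> 0 < y -> is_derive y 1 (prim f) (f y).
Proof.
move=> cf y0.
have m (i : interval R) : [set` i] `<=` `]0, +oo[ -> measurable_fun [set` i] f.
  by move=> iS; apply: measurable_funS (continuous_pos_measurable (cl1_cont cf)).
have E : prim f = (fun y => \int[leb]_(x in `]0, y]) f x).
  apply/funext => z; rewrite /prim Rintegral_itv_bndo_bndc//.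
  apply/integrableP; split.
    by apply/measurable_EFinP; apply: m => x /=; rewrite !in_itv/= => /andP[->].
  apply: le_lt_trans (cl1_int cf z).
  rewrite le_eqVlt; apply/orP; left; apply/eqP; apply: eq_integral => x.
  by rewrite inE/= in_itv/= => /andP[x0 _]; rewrite ger0_norm//; exact: cl1_ge0.
have [] := @continuous_FTC1 R f (BRight 0) y (y + 1) _ _ _ (cl1_cont cf y0).
- by rewrite ltrDl.
- apply/integrableP; split.
    by apply/measurable_EFinP; apply: m => x /=; rewrite !in_itv/= => /andP[->].
  apply: le_lt_trans (cl1_int cf (y + 2)).
  apply: (@le_trans _ _ (\int[leb]_(x in `]0%R, (y + 1)%R]) (f x)%:E)%E).
    rewrite le_eqVlt; apply/orP; left; apply/eqP; apply: eq_integral => x.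
    by rewrite inE/= in_itv/= => /andP[x0 _]; rewrite ger0_norm//; exact: cl1_ge0.
  apply: ge0_subset_integral => //.
  + by apply/measurable_EFinP; apply: m => x /=; rewrite !in_itv/= => /andP[->].
  + by move=> x /=; rewrite in_itv/= => /andP[x0 _]; rewrite lee_fin; exact: cl1_ge0.
  + by apply: subset_itvl; rewrite bnd_simp; lra.
- by [].
- by rewrite -E derive1E => dp <-; exact: DeriveDef.
Qed.

Lemma prim_ge0 f y : cl1 f -> 0 <= prim f y.
Proof.
move=> cf; apply: Rintegral_ge0 => x /=; rewrite in_itv/= => /andP[x0 _].
exact: cl1_ge0.
Qed.

Lemma cl1_prim f : cl1 f -> cl1 (prim f).
Proof.
move=> cf; have c1 := cl1_cst ler01.
rewrite (_ : prim f = rconv (fun=> 1) f); first exact: cl1_rconv.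
by apply/funext => y; rewrite /rconv -[convol _ _ _]primE.
Qed.

Lemma prim_le0 f y : y <= 0 -> prim f y = 0.
Proof.
move=> y0; rewrite /prim set_itv_ge; first exact: Rintegral_set0.
by rewrite bnd_simp -leNgt.
Qed.

Lemma rconv_le0 f g y : causal (restr f) -> causal (restr g) -> y <= 0 ->
  rconv f g y = 0.
Proof. by move=> cf cg y0; rewrite /rconv (causal_le0 (causal_convol cf cg) y0). Qed.

(* If h = c + prim d1 - prim d2 then f * h = prim (c f + f * d1 - f * d2);
   the subtraction is moved to the other side because convolutions are taken
   in the extended half-line. *)
Lemma rconv_prim f h d1 d2 c y : cl1 f -> cl1 h -> cl1 d1 -> cl1 d2 -> 0 <= c ->
  (forall x, 0 < x -> h x + prim d2 x = c + prim d1 x) ->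
  rconv f h y + prim (rconv f d2) y = c * prim f y + prim (rconv f d1) y.
Proof.
move=> cf ch c1 c2 c0 H.
have Cf := cl1_causal cf; have C1 := cl1_causal c1; have C2 := cl1_causal c2.
have Ch := cl1_causal ch; have CH := @causal_heaviside R.
have [y0|y0] := leP y 0.
  rewrite !prim_le0// rconv_le0; [|exact: Cf|exact: Ch|exact: y0].
  by rewrite mulr0.
have CA d : cl1 d -> convol (restr f) (convol heaviside (restr d)) y =
    (prim (rconv f d) y)%:E.
  move=> cd; have Cd := cl1_causal cd.
  rewrite (primE y (cl1_rconv cf cd)) (restr_rconv cf cd) (convolA Cf CH Cd).
  by rewrite (convolC Cf CH) -(convolA CH Cf Cd).
have E : (restr h \+ convol heaviside (restr d2) =
   (fun x => c%:E * heaviside x) \+ convol heaviside (restr d1))%E.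
  apply/funext => x /=; rewrite -!primE//; have [x0|x0] := leP x 0.
    by rewrite !prim_le0// /restr /heaviside ltNge x0/= mule0.
  rewrite restrE// (_ : heaviside x = 1%:E); last by rewrite /heaviside x0.
  by rewrite mule1 -!EFinD H.
have := congr1 (fun F => convol (restr f) F y) E.
have Ch0 : causal (fun x => c%:E * heaviside x)%E by exact: causal_scale.
have CP d : cl1 d -> causal (convol heaviside (restr d)).
  by move=> cd; apply: causal_convol => //; exact: cl1_causal.
rewrite (convolDr Cf Ch (CP _ c2)) (convolDr Cf Ch0 (CP _ c1)) (convolZr c0 Cf CH).
rewrite (convolC Cf CH) [LHS]/= [RHS]/= (CA _ c1) (CA _ c2) -(primE y cf).
have -> : convol (restr f) (restr h) y = (rconv f h y)%:E.
  by rewrite fineK// convol_cl1_fin_num.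
by rewrite -EFinM -!EFinD; exact: EFin_inj.
Qed.

(** Here c is h(0+) and d1 - d2 is h', so this is the rule that the derivative of f * h is h(0+) f +
    f * h'. No differentiability of f is involved. *)
Lemma rconv_is_derive f h d1 d2 c y : cl1 f -> cl1 h -> cl1 d1 -> cl1 d2 -> 0 <= c ->
  (forall x, 0 < x -> h x + prim d2 x = c + prim d1 x) -> 0 < y ->
  is_derive y 1 (rconv f h) (c * f y + rconv f d1 y - rconv f d2 y).
Proof.
move=> cf ch c1 c2 c0 H y0.
have -> : rconv f h = (c \*: prim f + prim (rconv f d1)) - prim (rconv f d2).
  apply/funext => z; have E := rconv_prim z cf ch c1 c2 c0 H.
  by rewrite -[LHS](addrK (prim (rconv f d2) z)) E.
have c3 := cl1_rconv cf c1; have c4 := cl1_rconv cf c2.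
have i1 := prim_is_derive cf y0; have i2 := prim_is_derive c3 y0; have i3 := prim_is_derive c4 y0.
exact: is_deriveB.
Qed.

Lemma Ck1P k p : (forall y, 0 < y -> is_derive y 1 k (p y)) ->
  (forall y, 0 < y -> {for y, continuous p}) -> Ck 1 k.
Proof.
move=> dk cp; split.
  by case => // _ y y0; rewrite /=; have [] := dk _ y0.
move=> y y0; have E : \forall z \near y, p z = derive1n 1 k z.
  near=> z; have z0 : 0 < z by near: z; exact: lt_nbhsr.
  by rewrite /= derive1E; have [_ ->] := dk _ z0.
rewrite /prop_for /continuous_at -(nbhs_singleton E).
by apply: cvg_trans (cp _ y0); exact: near_eq_cvg E.
Unshelve. all: by end_near. Qed.

Lemma Ck1_L1locP k p q : (forall y, 0 < y -> is_derive y 1 k (p y)) ->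
  (forall y, 0 < y -> {for y, continuous p}) -> cl1 q ->
  (forall y, 0 < y -> `|p y| <= q y) -> Ck 1 k /\ L1loc (derive1 k).
Proof.
move=> dk cp cq pq; split; first exact: Ck1P dk cp.
have mp := continuous_pos_measurable cp.
have E y : 0 < y -> derive1 k y = p y.
  by move=> y0; rewrite derive1E; have [_ ->] := dk _ y0.
split.
  by apply: eq_measurable_fun mp => y; rewrite inE/= in_itv/= andbT => /E ->.
move=> a a0; apply: le_lt_trans (cl1_int cq a); apply: ge0_le_integral => //.
- apply/measurable_EFinP; apply: measurableT_comp => //.
  apply: (eq_measurable_fun p).
    by move=> y; rewrite inE/= in_itv/= => /andP[/E ->].
  by apply: measurable_funS mp => // x /=; rewrite !in_itv/= => /andP[->].
- apply/measurable_EFinP; apply: measurable_funS (continuous_pos_measurable (cl1_cont cq)) => //.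
  by move=> x /=; rewrite !in_itv/= => /andP[->].
- by move=> x /=; rewrite in_itv/= => /andP[x0 _]; rewrite lee_fin E// pq.
Qed.

End ConvolutionRegularity.

(** * Tails of Levy measures and primitives *)

Section Tails.
Context {R : realType}.
Local Notation leb := (@lebesgue_measure R).
Local Notation RM := (measurableTypeR R).

Lemma lebesgue_tonelli (nu : {measure set RM -> \bar R}) (F : RM * RM -> \bar R) :
  sigma_finite setT nu -> measurable_fun setT F -> (forall z, 0 <= F z)%E ->
  (\int[leb]_x \int[nu]_y F (x, y) = \int[nu]_y \int[leb]_x F (x, y))%E.
Proof.
move=> sf mF F0.
(* The sigma-finiteness proof is packed into a structure on [nu], the form in which [fubini_tonelli]
   takes its measures. *)
pose sfm := isSigmaFinite.Build _ _ _ nu sf.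
pose sff := isSFinite.Build _ _ _ nu (sfinite_measure_sigma_finite sf).
pose nu' : {sigma_finite_measure set RM -> \bar R} :=
  HB.pack_for (SigmaFiniteMeasure.type RM R) (Measure.sort nu) sff sfm.
exact: (@fubini_tonelli _ _ _ _ _ leb nu').
Qed.

(** On ]a, +oo[ the function agrees with x -> f (max x a), which is monotone on the whole line; the
    values a = 1 / (n + 1) exhaust the half-line. *)
Lemma nonincreasing_pos_measurable (f : R -> R) :
  (forall x y, 0 < x -> x <= y -> f y <= f x) ->
  measurable_fun (`]0, +oo[ : set RM) f.
Proof.
move=> nif; have -> : `]0, +oo[%classic = \bigcup_n (`]n.+1%:R^-1, +oo[%classic : set RM).
  apply/seteqP; split => x; rewrite /= in_itv/= andbT.
    move=> x0; have [n] := ltr_add_invr x0; rewrite add0r => nx.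
    by exists n => //=; rewrite in_itv/= andbT.
  by move=> [n _]; rewrite /= in_itv/= andbT; apply: lt_trans; rewrite invr_gt0 ltr0n.
apply/measurable_fun_bigcup => // n.
pose a : R := n.+1%:R^-1; have a0 : 0 < a by rewrite invr_gt0 ltr0n.
apply: (eq_measurable_fun (fun x : R => f (Num.max x a))).
  by move=> x; rewrite inE/= in_itv/= andbT => ax; rewrite max_l// ltW.
apply: nonincreasing_measurable => // x y xy; apply: nif.
  by rewrite lt_max a0 orbT.
by rewrite ge_max !le_max xy lexx !orbT.
Qed.

Record levy (nu : {measure set RM -> \bar R}) : Prop := {
  levy_le0 : nu `]-oo, 0]%classic = 0%E;
  levy_tail : forall y, 0 < y -> (nu `]y, +oo[%classic < +oo)%E }.

Variable nu : {measure set RM -> \bar R}.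
Hypothesis nuL : levy nu.

Lemma levy_sigma_finite : sigma_finite setT nu.
Proof.
exists (fun n => if n is n'.+1 then `]n'.+1%:R^-1, +oo[%classic else `]-oo, 0]%classic).
  apply/seteqP; split => // x _; have [x0|x0] := leP x 0.
    by exists 0%N => //=; rewrite in_itv.
  have [n] := ltr_add_invr x0; rewrite add0r => nx.
  by exists n.+1 => //=; rewrite in_itv/= andbT.
case=> [|n]; split => //=; first by rewrite levy_le0.
by apply: levy_tail => //; rewrite invr_gt0 ltr0n.
Qed.

Lemma tailE y : 0 < y -> (tail nu y)%:E = nu `]y, +oo[%classic.
Proof. by move=> y0; rewrite fineK// ge0_fin_numE// levy_tail. Qed.

Lemma tail_ge0 y : 0 <= tail nu y.
Proof. exact: fine_ge0. Qed.

Lemma tail_nonincreasing x y : 0 < x -> x <= y -> tail nu y <= tail nu x.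
Proof.
move=> x0 xy; rewrite -lee_fin !tailE//; last exact: lt_le_trans xy.
by apply: le_measure; rewrite ?inE//; apply: subset_itvr; rewrite bnd_simp.
Qed.

Lemma measurable_tail : measurable_fun (`]0, +oo[ : set RM) (tail nu).
Proof. by apply: nonincreasing_pos_measurable => x y; exact: tail_nonincreasing. Qed.

Lemma causal_tail : causal (restr (tail nu)).
Proof. by apply: causal_restr => [|x _]; [exact: measurable_tail|exact: tail_ge0]. Qed.

(** Integration by parts in Tonelli form: [tail nu s] is the nu-integral of w ->
    [heaviside (w - s)]. *)
Lemma integral_tail (G : RM -> \bar R) : causal G ->
  (\int[leb]_s (restr (tail nu) s * G s) = \int[nu]_w convol heaviside G w)%E.
Proof.
move=> cG.
transitivity (\int[leb]_s \int[nu]_w (G s * heaviside (w - s)%R))%E; last first.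
  have := @lebesgue_tonelli nu (fun z => G z.1 * heaviside (z.2 - z.1)%R)%E levy_sigma_finite.
  rewrite /= => ->.
  - by apply: eq_integral => w _; rewrite (convolC (@causal_heaviside R) cG).
  - apply: emeasurable_funM.
      apply: measurableT_comp; [exact: causal_measurable|exact: measurable_fst].
    apply: (measurableT_comp (causal_measurable (@causal_heaviside R))) => /=.
    by apply: measurable_funB; [exact: measurable_snd|exact: measurable_fst].
  - by move=> z; apply: mule_ge0; apply: causal_ge0 => //; exact: causal_heaviside.
apply: eq_integral => s _; have [s0|s0] := leP s 0.
  rewrite (causal_le0 cG)// mule0; apply/esym; apply: integral0_eq => w _.
  by rewrite mul0e.
rewrite ge0_integralZl//; last 3 first.
- apply: (measurableT_comp (causal_measurable (@causal_heaviside R))).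
  exact: measurable_funB.
- by move=> w _; apply: causal_ge0; exact: causal_heaviside.
- exact: causal_ge0.
rewrite muleC restrE// tailE//; congr (_ * _)%E.
rewrite -[X in nu X]setIT -integral_indic//.
apply: eq_integral => w _; rewrite indicE /heaviside subr_gt0.
have [sw|ws] := ltP s w; first by rewrite mem_set//= in_itv/= sw.
by rewrite memNset//= in_itv/= andbT; apply/negP; rewrite -leNgt.
Qed.

End Tails.

(** * Fundamental theorem of calculus near 0 and injectivity of the Laplace transform *)

Section Calculus.
Context {R : realType}.
Local Notation leb := (@lebesgue_measure R).
Local Notation RM := (measurableTypeR R).
Implicit Types (f g h F : R -> R) (x y z a b l : R).

Lemma is_derive_continuous F (df x : R) : is_derive x 1 F df -> {for x, continuous F}.
Proof. by move=> [dF _]; apply: differentiable_continuous; apply/derivable1_diffP. Qed.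

Lemma integral_derive f F a b : 0 < a -> a <= b ->
  (forall x, 0 < x -> {for x, continuous f}) ->
  (forall x, 0 < x -> is_derive x 1 F (f x)) ->
  (\int[leb]_(x in `[a, b]) (f x)%:E = (F b - F a)%:E)%E.
Proof.
move=> a0; rewrite le_eqVlt => /orP[/eqP <-|ab] cf dF.
  by rewrite set_itv1 integral_set1 subrr.
rewrite (@continuous_FTC2 R f F)//.
- apply: continuous_in_subspaceT => x; rewrite inE/= in_itv/= => /andP[ax _].
  by apply: cf; exact: lt_le_trans ax.
- split.
  + move=> x; rewrite in_itv/= => /andP[ax _].
    by have [] := dF _ (lt_trans a0 ax).
  + by apply: cvg_at_right_filter; exact: (is_derive_continuous (dF _ a0)).
  + by apply: cvg_at_left_filter; exact: (is_derive_continuous (dF _ (lt_trans a0 ab))).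
- move=> x; rewrite in_itv/= => /andP[ax _].
  by rewrite derive1E; have [_ ->] := dF _ (lt_trans a0 ax).
Qed.

(** Integrability at 0 from a primitive bounded below: over [1 / (n + 1), a[ the integral is F a - F
    (1 / (n + 1)) <= F a - m, and monotone convergence concludes. *)
Lemma cl1_of_derive f F m : (forall x, 0 < x -> 0 <= f x) ->
  (forall x, 0 < x -> {for x, continuous f}) ->
  (forall x, 0 < x -> is_derive x 1 F (f x)) ->
  (forall x, 0 < x -> m <= F x) -> cl1 f.
Proof.
move=> f0 cf dF Fm; split => // a.
have [a0|a0] := leP a 0.
  by rewrite set_itv_ge ?integral_set0// bnd_simp -leNgt.
pose D n := `[(n.+1%:R^-1 : R), a[%classic.
have mf (A : set RM) : A `<=` `]0, +oo[ -> measurable_fun A f.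
  by move=> AS; apply: measurable_funS (continuous_pos_measurable cf).
have n0 n : 0 < (n.+1%:R^-1 : R) by rewrite invr_gt0 ltr0n.
have DS n : D n `<=` `]0, a[.
  by move=> x; rewrite /D /= !in_itv/= => /andP[/(lt_le_trans (n0 n)) -> ->].
have bD : \bigcup_n D n = `]0, a[%classic.
  apply/seteqP; split => x; first by move=> [n _]; exact: DS.
  rewrite /= in_itv/= => /andP[x0 xa]; have [n] := ltr_add_invr x0; rewrite add0r => nx.
  by exists n => //; rewrite /D /= in_itv/= (ltW nx).
have C := @ge0_nondecreasing_set_cvg_integral _ RM R D (EFin \o f) leb.
rewrite -bD; apply: (@le_lt_trans _ _ (F a - m)%:E); last by rewrite ltry.
rewrite -(cvg_lim (@ereal_hausdorff R) (C _ _ _ _)).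
- apply: lime_le.
    apply/cvg_ex; eexists; apply: C.
    + move=> i j ij; apply/subsetPset => x; rewrite /D /= !in_itv/= => /andP[xi ->].
      by rewrite andbT; apply: le_trans xi; rewrite lef_pV2 ?posrE ?ltr0n// ler_nat ltnS.
    + by move=> i; exact: measurable_itv.
    + move=> i; apply/measurable_EFinP; apply: mf => x /DS /=; rewrite !in_itv/= => /andP[->//].
    + by move=> i x /DS /=; rewrite in_itv/= => /andP[x0 _]; rewrite lee_fin f0.
  apply: nearW => n; have [an|an] := leP (n.+1%:R^-1 : R) a; last first.
    rewrite /D set_itv_ge; last by rewrite bnd_simp -leNgt ltW.
    by rewrite integral_set0 lee_fin subr_ge0 Fm.
  rewrite /D integral_itv_bndo_bndc; last first.
    apply/measurable_EFinP; apply: mf => x /DS /=; rewrite !in_itv/= => /andP[->//].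
  by rewrite (integral_derive (n0 n) an cf dF) lee_fin lerB// Fm.
- move=> i j ij; apply/subsetPset => x; rewrite /D /= !in_itv/= => /andP[xi ->].
  by rewrite andbT; apply: le_trans xi; rewrite lef_pV2 ?posrE ?ltr0n// ler_nat ltnS.
- by move=> i; exact: measurable_itv.
- move=> i; apply/measurable_EFinP; apply: mf => x /DS /=; rewrite !in_itv/= => /andP[->//].
- by move=> i x /DS /=; rewrite in_itv/= => /andP[x0 _]; rewrite lee_fin f0.
Qed.

(** No continuity of f is assumed, so that this also covers [tail mu], which may jump. Cutoffs at
    levels below 1 are dominated by the one at 2. *)
Lemma integral_cutoff_cvg0 f : causal (restr f) ->
  (\int[leb]_x cutoff 2 (restr f) x < +oo)%E ->
  (\int[leb]_x cutoff y (restr f) x)%E @[y --> 0^'+] --> (0 : \bar R).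
Proof.
move=> Cf If.
have z0 : (\int[leb]_r (0%R)%:E = 0 :> \bar R)%E by rewrite integral0.
have mz := causal_measurable_zext Cf.
have E z : (\int[leb]_x cutoff z (restr f) x = \int[leb]_r (if (r < z)%R then zext f r else 0%R)%:E)%E.
  by apply: eq_integral => r _; rewrite /cutoff; case: ifP.
have f0 r : 0 <= zext f r by have := causal_ge0 Cf r; rewrite lee_fin.
have C0 y : (0 <= \int[leb]_x cutoff y (restr f) x)%E.
  by apply: integral_ge0 => x _; exact: (causal_ge0 (causal_cutoff y Cf)).
have fin y : y <= 2 -> (\int[leb]_x cutoff y (restr f) x)%E \is a fin_num.
  move=> y2; rewrite ge0_fin_numE//; apply: le_lt_trans If.
  apply: le_integral_causal; [exact: causal_cutoff|exact: causal_cutoff|].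
  move=> x _; rewrite /cutoff; case: ifPn => xy; first by rewrite (lt_le_trans xy y2).
  by case: ifP => // _; exact: (causal_ge0 Cf).
have H : fine (\int[leb]_x cutoff y (restr f) x) @[y --> 0^'+] --> (0 : R).
  apply/cvg_at_rightP => u [u0 uc].
  have [N _ HN] : \forall n \near \oo, u n <= 1 by apply: (cvgr_le _ uc).
  rewrite -(cvg_shiftn N).
  suff : (fun n => \int[leb]_x cutoff (u (n + N)%N) (restr f) x)%E @ \oo --> (\int[leb]_r (0%R)%:E)%E.
    by rewrite z0 => /fine_cvg.
  under eq_cvg do rewrite E.
  apply: (@dominated_cvg_off_point R _ _ (fun r => if r < 2 then zext f r else 0) 0).
  - move=> n; apply: measurable_fun_if => //; first exact: measurable_fun_ltr.
    exact: measurable_funTS.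
  - exact: measurable_cst.
  - apply: measurable_fun_if => //; first exact: measurable_fun_ltr.
    exact: measurable_funTS.
  - by rewrite -E.
  - move=> r r0; have [r0'|r0'] := leP r 0.
      by rewrite (_ : (fun n => _) = fun=> 0) ?zext0//; [exact: cvg_cst|
         apply/funext => n; case: ifP => //; rewrite zext0].
    apply: (@cvg_trans _ ((0 : R) @[n --> \oo])); last exact: cvg_cst.
    have uNr : u (n + N)%N @[n --> \oo] --> (0 : R) by rewrite (cvg_shiftn N).
    apply: near_eq_cvg; near=> n; rewrite ltNge ltW//.
    by near: n; exact: (cvgr_lt _ uNr).
  - move=> n r; have := HN (n + N)%N (leq_addl _ _) => /= un.
    have [ru|ru] := ltP r (u (n + N)%N); last by rewrite normr0; case: ifP.
    by rewrite ger0_norm// ifT//; lra.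
have : (fine (\int[leb]_x cutoff y (restr f) x))%:E @[y --> 0^'+] --> (0 : \bar R).
  by apply: cvg_EFin => //; exact: nearW.
apply: cvg_trans; apply: near_eq_cvg; near=> y; rewrite /= fineK// fin//.
by near: y; exact: nbhs_right_le.
Unshelve. all: by end_near. Qed.

Lemma prim_cutoff f y : cl1 f -> (prim f y)%:E = (\int[leb]_s cutoff y (restr f) s)%E.
Proof.
move=> cf; have Cf := cl1_causal cf.
by rewrite (integral_cutoff y Cf) (primE y cf) (convol_heavisideE y Cf).
Qed.

Lemma prim_le_dom f g y : cl1 f -> cl1 g -> (forall x, 0 < x -> x < y -> f x <= g x) ->
  prim f y <= prim g y.
Proof.
move=> cf cg fg; rewrite -lee_fin !prim_cutoff//.
apply: le_integral_causal; [exact: causal_cutoff (cl1_causal cf)|exact: causal_cutoff (cl1_causal cg)|].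
by move=> s s0; rewrite /cutoff; case: ifPn => // sy; rewrite !restrE// lee_fin fg.
Qed.

Lemma prim_nondecreasing f y z : cl1 f -> y <= z -> prim f y <= prim f z.
Proof.
move=> cf yz; have Cf := cl1_causal cf; rewrite -lee_fin !(prim_cutoff _ cf).
apply: le_integral_causal; [exact: causal_cutoff|exact: causal_cutoff|].
move=> s s0; rewrite /cutoff; case: ifPn => [sy|_]; first by rewrite (lt_le_trans sy yz).
by case: ifP => // _; exact: (causal_ge0 Cf).
Qed.

Lemma prim_cst (c : R) y : 0 < y -> prim (fun=> c) y = c * y.
Proof.
by move=> y0; rewrite /prim Rintegral_cst//= lebesgue_measure_itv/= lte_fin y0/= subr0.
Qed.

Lemma prim_ge_nonincreasing f y : cl1 f -> (forall x y, 0 < x -> x <= y -> f y <= f x) ->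
  0 < y -> y * f y <= prim f y.
Proof.
move=> cf nif y0; rewrite mulrC -prim_cst//; apply: prim_le_dom => //.
  by apply: cl1_cst; exact: cl1_ge0 cf _ y0.
by move=> x x0 xy; apply: nif => //; exact: ltW.
Qed.

Lemma prim_cvg0 f : cl1 f -> prim f x @[x --> 0^'+] --> (0 : R).
Proof.
move=> cf; have := @integral_cutoff_cvg0 f (cl1_causal cf).
rewrite -(prim_cutoff _ cf) => /(_ (ltry _)).
by under eq_cvg do rewrite -(prim_cutoff _ cf); move=> /fine_cvg.
Qed.

Lemma prim_increment f x y : cl1 f -> 0 < x -> x <= y ->
  (\int[leb]_(z in `[x, y]) (f z)%:E = (prim f y - prim f x)%:E)%E.
Proof.
by move=> cf x0 xy; apply: integral_derive => // z z0; [exact: cl1_cont|exact: prim_is_derive].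
Qed.

(** F - prim f is constant on ]0, +oo[, and its limit at 0 is l. *)
Lemma prim_eq f F l : cl1 f -> (forall x, 0 < x -> is_derive x 1 F (f x)) ->
  F x @[x --> 0^'+] --> l -> forall x, 0 < x -> F x = l + prim f x.
Proof.
move=> cf dF Fl x x0.
have H : forall z, 0 < z -> z <= x -> F z - prim f z = F x - prim f x.
  move=> z z0 zx; have := integral_derive z0 zx (cl1_cont cf) dF.
  by rewrite (prim_increment cf z0 zx) => -[E]; lra.
have C1 : (F z - prim f z) @[z --> 0^'+] --> l - 0.
  by apply: cvgB => //; exact: prim_cvg0.
have C2 : (F z - prim f z) @[z --> 0^'+] --> F x - prim f x.
  apply: (@cvg_trans _ ((F x - prim f x) @[z --> (0:R)^'+])); last exact: cvg_cst.
  apply: near_eq_cvg; near=> z; rewrite [RHS]H//; near: z.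
  exact: nbhs_right_le.
have E := cvg_unique (@Rhausdorff R) C1 C2.
by rewrite -[LHS](subrK (prim f x)) -E subr0.
Unshelve. all: by end_near. Qed.

Lemma is_derive_expN (u x : R) : is_derive x 1 (fun x => expR (- (u * x))) (- u * expR (- (u * x))).
Proof.
have -> : (fun x => expR (- (u * x))) = expR \o (fun x => - u * x).
  by apply/funext => z /=; rewrite mulNr.
have H : is_derive x 1 (fun x => - u * x) (- u).
  have := @is_deriveZ R R^o R^o id (- u) x 1 1 (is_derive_id _ _).
  by rewrite /GRing.scale/= mulr1.
have := @is_derive1_comp R expR (fun x => - u * x) x _ _ (is_derive_expR (- u * x)) H.
by rewrite mulNr mulrC.
Qed.

Lemma continuous_expN (u : R) : continuous (fun x => expR (- (u * x))).
Proof. by move=> x; exact: is_derive_continuous (is_derive_expN u x). Qed.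

Definition expw l f := fun x => expR (l * x) * f x.

Lemma continuous_expM l x : {for x, continuous (fun x => expR (l * x))}.
Proof.
have -> : (fun x => expR (l * x)) = (fun x => expR (- (- l * x))).
  by apply/funext => z; rewrite mulNr opprK.
exact: continuous_expN.
Qed.

Lemma cl1_expw l f : cl1 f -> cl1 (expw l f).
Proof.
move=> cf; apply: cl1_dom => [x x0|x x0|a].
- by rewrite mulr_ge0 ?expR_ge0//; exact: cl1_ge0.
- by apply: cvgM; [exact: continuous_expM|exact: cl1_cont].
exists (fun x => expR (`|l| * a) * f x); first exact: cl1Z (expR_ge0 _) cf.
move=> x x0 xa; apply: ler_wpM2r; first exact: cl1_ge0.
rewrite ler_expR; apply: (@le_trans _ _ (`|l| * x)); first by rewrite ler_wpM2r ?ler_norm// ltW.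
by rewrite ler_wpM2l// ltW.
Qed.

Section laplace_injective.
Variables f g : R -> R.
Hypotheses (clf : cl1 f) (clg : cl1 g).
Hypothesis Lf : forall u, 0 < u -> (laplace u (restr f) < +oo)%E.
Hypothesis Lfg : forall u, 0 < u -> laplace u (restr f) = laplace u (restr g).

Let Cf := cl1_causal clf.
Let Cg := cl1_causal clg.

Let w (b : R) (N : nat) (x : R) : R := (1 - expR (- (b * x))) ^+ N.

Let mw b N : measurable_fun setT (w b N : RM -> R).
Proof.
apply: measurable_funX; apply: measurable_funB => //.
apply: measurableT_comp => //; apply: measurableT_comp => //; exact: measurable_funM.
Qed.

Let w01 b N x : 0 <= b -> 0 < x -> 0 <= w b N x <= 1.
Proof.
move=> b0 x0.
have e1 : expR (- (b * x)) <= 1 by rewrite -expR0 ler_expR oppr_le0 mulr_ge0// ltW.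
have e0 := expR_ge0 (- (b * x)).
by rewrite exprn_ge0/= ?exprn_ile1//; lra.
Qed.

Let I (h : R -> R) a b N : \bar R :=
  (\int[leb]_x ((expR (- (a * x)) * w b N x)%:E * restr h x))%E.

Let mI (h : R -> R) a b N : causal (restr h) -> measurable_fun setT
  (fun x : RM => ((expR (- (a * x)) * w b N x)%:E * restr h x)%E).
Proof.
move=> ch; apply: emeasurable_funM; last exact: causal_measurable.
apply/measurable_EFinP; apply: measurable_funM => //.
by have /measurable_EFinP := @measurable_exp R a.
Qed.

Let I0 (h : R -> R) a b N x : causal (restr h) -> 0 <= b ->
  (0 <= (expR (- (a * x)) * w b N x)%:E * restr h x)%E.
Proof.
move=> ch b0; have [x0|x0] := leP x 0; first by rewrite (causal_le0 ch)// mule0.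
rewrite mule_ge0//; last exact: causal_ge0.
by have /andP[? _] := w01 N b0 x0; rewrite lee_fin mulr_ge0// expR_ge0.
Qed.

(** Since e^(-ax) = e^(-(a+b)x) + e^(-ax) (1 - e^(-bx)). By this recursion equality of the
    transforms of f and g passes from N = 0 to every N without expanding an alternating binomial
    sum; finiteness permits the cancellation. *)
Let IS (h : R -> R) a b N : causal (restr h) -> 0 <= b ->
  (I h a b N = I h (a + b)%R b N + I h a b N.+1)%E.
Proof.
move=> ch b0; rewrite /I -ge0_integralD//; first last.
- exact: mI.
- by move=> x _; exact: I0.
- exact: mI.
- by move=> x _; exact: I0.
apply: eq_integral => x _.
have [x0|x0] := leP x 0; first by rewrite (causal_le0 ch)// !mule0 adde0.
rewrite restrE// -!EFinM -EFinD; congr EFin.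
by rewrite /w exprS mulrDl opprD expRD; ring.
Qed.

Let Ifin a b N : 0 < a -> 0 <= b -> (I f a b N < +oo)%E.
Proof.
move=> a0 b0; apply: le_lt_trans (Lf a0); apply: ge0_le_integral => //.
- by move=> x _; exact: I0.
- exact: mI.
- by apply: emeasurable_funM; [exact: measurable_exp|exact: causal_measurable Cf].
- move=> x _; have [x0|x0] := leP x 0; first by rewrite !(causal_le0 Cf)// !mule0.
  apply: lee_wpmul2r; first exact: causal_ge0.
  by have /andP[_ ?] := w01 N b0 x0; rewrite lee_fin ler_piMr// expR_ge0.
Qed.

Let Ifg a b N : 0 < a -> 0 <= b -> I f a b N = I g a b N.
Proof.
move=> + b0; elim: N a => [|N IH] a a0.
  have E h : I h a b 0 = laplace a (restr h).
    by apply: eq_integral => x _; rewrite /w expr0 mulr1.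
  by rewrite !E Lfg.
have ab0 : 0 < a + b by rewrite ltr_wpDr.
have := IH _ a0; rewrite (IS _ _ Cf)// (IS _ _ Cg)// (IH _ ab0).
have : I g (a + b) b N \is a fin_num.
  by rewrite -(IH _ ab0) ge0_fin_numE ?Ifin//; apply: integral_ge0 => x _; exact: I0.
move=> Ifinn; rewrite addeC [RHS]addeC => /(congr1 (fun r : \bar R => r - I g (a + b)%R b N)%E).
by rewrite !addeK.
Qed.

Let upper (h : R -> R) x : RM -> \bar R :=
  fun y => (if y < x then 0 else expR (- (1 * y)) * zext h y)%:E.

Let mexp : measurable_fun setT (fun y : RM => expR (- (1 * y))).
Proof. by have /measurable_EFinP := @measurable_exp R 1. Qed.

Let causal_upper h x : 0 < x -> cl1 h -> causal (upper h x).
Proof.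
move=> x0 ch; have h0 := cl1_ge0 ch; split => [|y|y y0].
- apply/measurable_EFinP; apply: measurable_fun_if => //; first exact: measurable_fun_ltr.
  apply: measurable_funTS; apply: measurable_funM => //.
  exact: (causal_measurable_zext (cl1_causal ch)).
- by rewrite /upper lee_fin; case: ifP => // _; rewrite mulr_ge0 ?expR_ge0 ?zext_ge0.
- by rewrite /upper (le_lt_trans y0 x0).
Qed.

(* The weights [(1 - t ^ n) ^ (2 ^ n)] with [t = 2 ^ (- y / x)] converge to the
   indicator of [y > x]. *)
Let Ilim (h : R -> R) x : 0 < x -> cl1 h -> (laplace 1 (restr h) < +oo)%E ->
  I h 1 (n%:R * (ln 2 / x)) (2 ^ n) @[n --> \oo] --> (\int[leb]_y upper h x y)%E.
Proof.
move=> x0 clh Lh; have h0 := cl1_ge0 clh; have ch := cl1_causal clh.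
have l2 : 0 < ln 2 :> R by rewrite ln_gt0// ltr1n.
have v0 : 0 < ln 2 / x by rewrite divr_gt0.
pose t y := expR (- (ln 2 / x * y)).
have mzh := causal_measurable_zext ch.
pose F n (y : RM) := expR (- (1 * y)) * w (n%:R * (ln 2 / x)) (2 ^ n) y * zext h y.
have -> : (fun n => I h 1 (n%:R * (ln 2 / x)) (2 ^ n)) =
    (fun n => \int[leb]_y (F n y)%:E)%E.
  by apply/funext => n; apply: eq_integral => y _; rewrite -EFinM.
have tn n y : w (n%:R * (ln 2 / x)) (2 ^ n) y = (1 - t y ^+ n) ^+ (2 ^ n).
  by rewrite /w /t -expRM_natl; congr ((1 - expR _) ^+ _); ring.
have t1 y : 0 < y -> t y <= 1.
  by move=> y0; rewrite /t -[leRHS]expR0 ler_expR oppr_le0; apply: mulr_ge0; exact: ltW.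
have tx : t x = 2^-1.
  by rewrite /t divfK ?gt_eqF// expRN lnK ?posrE//.
apply: (@dominated_cvg_off_point R F _ (fun y => expR (- (1 * y)) * zext h y) x).
- by move=> n; apply: measurable_funM => //; exact: measurable_funM.
- by apply/measurable_EFinP; exact: causal_measurable (causal_upper x0 clh).
- exact: measurable_funM.
- exact: Lh.
- move=> y yx; rewrite /F; have [y0|y0] := leP y 0.
    by rewrite zext0// mulr0 if_same; under eq_cvg do rewrite mulr0; exact: cvg_cst.
  rewrite (_ : (fun n => _) = (fun n => expR (- (1 * y)) * zext h y * (1 - t y ^+ n) ^+ (2 ^ n))); last first.
    by apply/funext => n; rewrite tn; ring.
  move: yx; rewrite neq_lt => /orP[yx|xy].
    rewrite yx -[X in _ --> X](mulr0 (expR (- (1 * y)) * zext h y)).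
    apply: cvgM; first exact: cvg_cst.
    apply: cvg_two_powers_gt; rewrite t1// andbT -tx ltr_expR ltrN2.
    by rewrite ltr_pM2l.
  rewrite ltNge (ltW xy) -[X in _ --> X]mulr1; apply: cvgM; first exact: cvg_cst.
  apply: cvg_two_powers_lt; rewrite expR_ge0 /= -tx ltr_expR ltrN2.
  by rewrite ltr_pM2l.
- move=> n y; rewrite /F; have [y0|y0] := leP y 0; first by rewrite zext0// !mulr0 normr0.
  have n0 : 0 <= n%:R * (ln 2 / x) by rewrite mulr_ge0// ltW.
  have /andP[? ?] := w01 (2 ^ n) n0 y0.
  rewrite ger0_norm; last by rewrite mulr_ge0 ?zext_ge0// mulr_ge0 ?expR_ge0.
  by apply: ler_wpM2r; [exact: zext_ge0|rewrite ler_piMr// expR_ge0].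
Qed.

Let Lg : (laplace 1 (restr g) < +oo)%E.
Proof. by rewrite -Lfg//; exact: Lf. Qed.

Let upperE x : 0 < x -> (\int[leb]_y upper f x y = \int[leb]_y upper g x y)%E.
Proof.
move=> x0; apply: (@cvg_unique _ (@ereal_hausdorff R) _ _ _ _ (Ilim x0 clf (Lf ltr01))).
rewrite (_ : (fun n => _) = (fun n => I g 1 (n%:R * (ln 2 / x)) (2 ^ n))); first exact: Ilim.
apply/funext => n; apply: Ifg => //; rewrite mulr_ge0// divr_ge0 ?ln_ge0 ?ler1n// ltW//.
Qed.

Let cl1_expM h : cl1 h -> cl1 (fun y => expR (- (1 * y)) * h y).
Proof.
move=> /(cl1_expw (- 1)); congr cl1; apply/funext => y.
by rewrite /expw mulNr.
Qed.

Let splitE h x : 0 < x -> cl1 h -> laplace 1 (restr h) =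
  ((prim (fun y => expR (- (1 * y)) * h y) x)%:E + \int[leb]_y upper h x y)%E.
Proof.
move=> x0 ch; have ck := cl1_expM ch.
rewrite (prim_cutoff _ ck) -integral_causalD; [|exact: causal_cutoff (cl1_causal ck)|exact: causal_upper].
apply: eq_integral => y _; rewrite /cutoff /upper /restr /zext.
by case: ifP => _; case: ifP => _; rewrite ?adde0 ?add0e -?EFinM ?mulr0.
Qed.

(** The weighted integrals over ]x, +oo[ agree by the limit of the weights, hence so do those over
    ]0, x[; continuity allows differentiating them in x. *)
Lemma laplace_inj x : 0 < x -> f x = g x.
Proof.
move=> x0; have E z : 0 < z -> prim (fun y => expR (- (1 * y)) * f y) z =
    prim (fun y => expR (- (1 * y)) * g y) z.
  move=> z0; have := Lfg ltr01; rewrite (splitE z0 clf) (splitE z0 clg) (upperE z0).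
  have ug : (\int[leb]_y upper g z y)%E \is a fin_num.
    rewrite ge0_fin_numE; last by apply: integral_ge0 => y _; exact: causal_ge0 (causal_upper z0 clg) _.
    by apply: le_lt_trans Lg; rewrite (splitE z0 clg) leeDr// lee_fin prim_ge0//; exact: cl1_expM.
  by move=> /(congr1 (fun r : \bar R => r - \int[leb]_y upper g z y)%E); rewrite !addeK// => -[].
have df := prim_is_derive (cl1_expM clf) x0.
have dg : is_derive x 1 (prim (fun y => expR (- (1 * y)) * f y)) (expR (- (1 * x)) * g x).
  apply: near_eq_is_derive (prim_is_derive (cl1_expM clg) x0).
  by near=> z; rewrite E//; near: z; exact: lt_nbhsr.
have [_ Ef] := df; have [_] := dg; rewrite Ef => /mulfI; apply.
by rewrite gt_eqF// expR_gt0.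
Unshelve. all: by end_near. Qed.

End laplace_injective.

End Calculus.

(** * The integrated tail of a Levy measure *)

Section Kernel.
Context {R : realType}.
Local Notation leb := (@lebesgue_measure R).
Local Notation RM := (measurableTypeR R).

Lemma convol_heaviside_prim (f F : R -> R) : cl1 f ->
  (forall x : R, 0 < x -> is_derive x 1 F (f x)) -> F x @[x --> 0^'+] --> (0 : R) ->
  convol heaviside (restr f) = restr F.
Proof.
move=> cf dF F0; apply/funext => x; rewrite -primE//; have [x0|x0] := leP x 0.
  by rewrite prim_le0// /restr ltNge x0.
by rewrite restrE// (prim_eq cf dF F0 x0) add0r.
Qed.

Lemma continuous_cl1 (f : R -> R) : (forall x, 0 < x -> 0 <= f x) -> continuous f -> cl1 f.
Proof.
move=> f0 cf; split => //; first by move=> x _; exact: cf.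
move=> a; have [a0|a0] := leP a 0.
  by rewrite set_itv_ge ?integral_set0// bnd_simp -leNgt.
have := @continuous_compact_integrable R f `[0, a] (@segment_compact R 0 a)
  (continuous_subspaceT cf).
move=> /integrableP[mf]; apply: le_lt_trans.
apply: (@le_trans _ _ (\int[leb]_(x in `]0%R, a[) `|(f x)%:E|)%E).
  rewrite le_eqVlt; apply/orP; left; apply/eqP; apply: eq_integral => x.
  by rewrite inE/= in_itv/= => /andP[x0 _]; rewrite ger0_norm ?f0.
apply: ge0_subset_integral => //.
  by apply: measurableT_comp => //; exact: mf.
by apply: subset_itv; rewrite bnd_simp.
Qed.

Lemma cvg0_right_continuous (f : R -> R) : continuous f -> f 0 = 0 ->
  f x @[x --> 0^'+] --> (0 : R).
Proof. by move=> cf f0; rewrite -{2}f0; apply: cvg_at_right_filter; exact: cf. Qed.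

Lemma laplace_heaviside (u : R) : 0 < u -> laplace u heaviside = (u^-1)%:E.
Proof.
move=> u0.
have -> : laplace u heaviside = (\int[leb]_(x in `]0%R, +oo[) (expR (- (u * x)))%:E)%E.
  rewrite [RHS]integral_mkcond; apply: eq_integral => x _; rewrite patchE /heaviside.
  have [x0|x0] := ltP 0 x; first by rewrite mem_set/= ?in_itv/= ?x0// mule1.
  by rewrite memNset/= ?mule0// in_itv/= andbT; apply/negP; rewrite -leNgt.
rewrite integral_itv_obnd_cbnd; last first.
  apply/measurable_EFinP; apply: measurable_funTS.
  by apply: continuous_measurable_fun; exact: continuous_expN.
have D (x : R) : is_derive x 1 (fun x => - u^-1 * expR (- (u * x))) (expR (- (u * x))).
  have := @is_deriveZ R R^o R^o _ (- u^-1) x 1 _ (is_derive_expN u x).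
  by rewrite /GRing.scale/= mulrA mulrNN mulVf ?mul1r// gt_eqF.
rewrite (@ge0_continuous_FTC2y R (fun x => expR (- (u * x))) (fun x => - u^-1 * expR (- (u * x))) 0 0).
- by rewrite mulr0 oppr0 expR0 mulr1 -EFinB sub0r opprK.
- by move=> x _; exact: expR_ge0.
- apply: continuous_subspaceT; exact: continuous_expN.
- rewrite -(mulr0 (- u^-1)); apply: cvgM; first exact: cvg_cst.
  have E : (fun x => expR (- (u * x))) = (fun x => expR (- x)) \o (fun x => u * x) by [].
  rewrite E; apply: cvg_comp; last exact: cvgr_expR.
  exact: gt0_cvgMry.
- by move=> x _; have [] := D x.
- by apply: cvg_at_right_filter; exact: is_derive_continuous (D 0).
- by move=> x _; rewrite derive1E; have [_ ->] := D x.
Qed.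

Section levy2.
Variable nu : {measure set RM -> \bar R}.
Hypothesis nuL : levy nu.
Hypothesis nu2 : forall s, 0 < s -> (\int[leb]_(r in `]s, +oo[) (tail nu r)%:E < +oo)%E.

Lemma tail2E s : 0 < s -> (tail2 nu s)%:E = (\int[leb]_(r in `]s, +oo[) (tail nu r)%:E)%E.
Proof.
move=> s0; rewrite fineK// ge0_fin_numE ?nu2//.
by apply: integral_ge0 => r _; rewrite lee_fin tail_ge0.
Qed.

Lemma tail2_ge0 s : 0 <= tail2 nu s.
Proof. by apply: Rintegral_ge0 => r _; exact: tail_ge0. Qed.

Lemma measurable_tail_itv (D : set RM) : D `<=` `]0, +oo[ ->
  measurable_fun D (EFin \o tail nu).
Proof. by move=> DS; apply/measurable_EFinP; apply: measurable_funS (measurable_tail nuL). Qed.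

Lemma tail2_split x y : 0 < x -> x <= y ->
  (tail2 nu x)%:E = (\int[leb]_(r in `]x, y]) (tail nu r)%:E + (tail2 nu y)%:E)%E.
Proof.
move=> x0 xy; have y0 := lt_le_trans x0 xy.
rewrite !tail2E// -ge0_integral_setU//.
- by rewrite -itv_bndbnd_setU// bnd_simp.
- apply: measurable_tail_itv => r /=; rewrite !in_itv/= !andbT.
  by move=> [/andP[/(lt_trans x0)]|/(lt_trans y0)].
- by move=> r _; rewrite lee_fin tail_ge0.
- by apply: lt_disjoint => p q; rewrite !in_itv/= andbT => /andP[_] /le_lt_trans; apply.
Qed.

Lemma tail2_nonincreasing x y : 0 < x -> x <= y -> tail2 nu y <= tail2 nu x.
Proof.
move=> x0 xy; rewrite -lee_fin (tail2_split x0 xy) leeDr//.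
by apply: integral_ge0 => r _; rewrite lee_fin tail_ge0.
Qed.

Lemma tail2_lipschitz x y : 0 < x -> x <= y ->
  tail2 nu x - tail2 nu y <= (y - x) * tail nu x.
Proof.
move=> x0 xy; have : (\int[leb]_(r in `]x, y]) (tail nu r)%:E <=
    \int[leb]_(r in `]x, y]) (tail nu x)%:E)%E.
  apply: ge0_le_integral => //.
  - by move=> r _; rewrite lee_fin tail_ge0.
  - by apply: measurable_tail_itv => r /=; rewrite !in_itv/= andbT => /andP[/(lt_trans x0)].
  - move=> r /=; rewrite in_itv/= => /andP[xr _].
    by rewrite lee_fin tail_nonincreasing// ltW.
rewrite integral_cst//= lebesgue_measure_itv/= lte_fin.
have := tail2_split x0 xy; case: ltgtP xy => // [xy _|-> _ _ _]; last by rewrite !subrr mul0r.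
move=> E; rewrite -EFinD -EFinM => H.
rewrite -lee_fin EFinB E mulrC; apply: le_trans H.
by rewrite addeK.
Qed.

(** The tail may jump, but it is bounded by its value at x / 2 beyond that point, so its integral is
    Lipschitz there. The added 1 only makes the constant positive. *)
Lemma tail2_continuous x : 0 < x -> {for x, continuous (tail2 nu)}.
Proof.
move=> x0; apply/cvgrPdist_le => e e0.
pose a := x / 2; have a0 : 0 < a by rewrite divr_gt0.
pose C := tail nu a + 1; have C0 : 0 < C by rewrite ltr_wpDl// tail_ge0.
near=> y.
have ay : a <= y by apply: ltW; near: y; apply: lt_nbhsr; rewrite /a; lra.
have ax : a <= x by rewrite /a; lra.
have L p q : a <= p -> p <= q -> `|tail2 nu p - tail2 nu q| <= `|q - p| * C.
  move=> ap pq; have p0 := lt_le_trans a0 ap.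
  rewrite !ger0_norm ?subr_ge0//; last exact: tail2_nonincreasing.
  apply: le_trans (tail2_lipschitz p0 pq) _; apply: ler_wpM2l; first by rewrite subr_ge0.
  by have := tail_nonincreasing nuL a0 ap; rewrite /C; lra.
apply: (@le_trans _ _ (`|x - y| * C)).
  have [xy|yx] := leP x y; first by rewrite (distrC x y); exact: L.
  by rewrite distrC; apply: L => //; exact: ltW.
rewrite -ler_pdivlMr//; near: y.
by apply: cvgr_dist_le; [exact: cvg_id|rewrite divr_gt0].
Unshelve. all: by end_near. Qed.

Lemma causal_tail2 : causal (restr (tail2 nu)).
Proof.
by apply: pos_continuous_causal => [x _|x x0]; [exact: tail2_ge0|exact: tail2_continuous].
Qed.

(** A second integration by parts: Tonelli turns the integrated tail of nu against G into the tail
    of nu against the primitive of G. *)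
Lemma integral_tail2 (G : RM -> \bar R) : causal G ->
  (\int[leb]_s (restr (tail2 nu) s * G s) =
   \int[nu]_w convol heaviside (convol heaviside G) w)%E.
Proof.
move=> cG; have CH := @causal_heaviside R.
rewrite -integral_tail//; last exact: causal_convol.
have ct := causal_tail nuL.
transitivity (\int[leb]_s \int[leb]_r (G s * (restr (tail nu) r * heaviside (r - s)%R)))%E.
  apply: eq_integral => s _; have [s0|s0] := leP s 0.
    rewrite (causal_le0 cG)// mule0; apply/esym; apply: integral0_eq => r _.
    by rewrite mul0e.
  rewrite ge0_integralZl//; last 3 first.
  - apply: emeasurable_funM; first exact: causal_measurable ct.
    apply: (measurableT_comp (causal_measurable CH)); exact: measurable_funB.
  - by move=> r _; apply: mule_ge0; exact: causal_ge0.
  - exact: causal_ge0.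
  rewrite muleC restrE// tail2E//; congr (_ * _)%E.
  rewrite [LHS]integral_mkcond; apply: eq_integral => r _; rewrite patchE /heaviside subr_gt0.
  have [sr|rs] := ltP s r.
    by rewrite mem_set/= ?in_itv/= ?sr// mule1 restrE// (lt_trans s0).
  by rewrite memNset/= ?mule0// in_itv/= andbT; apply/negP; rewrite -leNgt.
rewrite (@fubini_tonelli _ _ _ _ _ leb leb
  (fun z : RM * RM => G z.1 * (restr (tail nu) z.2 * heaviside (z.2 - z.1)%R))%E)/=.
- apply: eq_integral => r _; rewrite (convolC CH cG) /convol -ge0_integralZl//.
  + by apply: eq_integral => s _; rewrite muleCA.
  + exact: measurable_convol_integrand.
  + by move=> s _; apply: mule_ge0; exact: causal_ge0.
  + exact: causal_ge0.
- apply: emeasurable_funM.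
    apply: measurableT_comp; [exact: causal_measurable|exact: measurable_fst].
  apply: emeasurable_funM.
    apply: measurableT_comp; [exact: causal_measurable ct|exact: measurable_snd].
  apply: (measurableT_comp (causal_measurable CH)) => /=.
  by apply: measurable_funB; [exact: measurable_snd|exact: measurable_fst].
- by move=> z; apply: mule_ge0; [|apply: mule_ge0]; exact: causal_ge0.
Qed.

End levy2.
End Kernel.

(** * The kernel K attached to psi *)

Section PsiKernel.
Context {R : realType}.
Local Notation leb := (@lebesgue_measure R).
Local Notation RM := (measurableTypeR R).

(** The compensated exponential in the integral formula for psi. Its second derivative in w is u^2
    e^(-uw), the function that gets paired with the integrated tail. *)
Definition expc (u w : R) : R := expR (- (u * w)) - 1 + u * w.

Lemma is_derive_expc (u w : R) : is_derive w 1 (expc u) (u * (1 - expR (- (u * w)))).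
Proof.
have H : is_derive w 1 (fun x => u * x) u.
  have := @is_deriveZ R R^o R^o id u w 1 1 (is_derive_id _ _).
  by rewrite /GRing.scale/= mulr1.
have H1 : is_derive w 1 (fun x : R => expR (- (u * x)) - 1) (- u * expR (- (u * w))).
  have := @is_deriveB R R^o R^o _ (cst 1) w 1 _ _ (is_derive_expN u w) (is_derive_cst _ _ _).
  by rewrite subr0.
have := @is_deriveD R R^o R^o _ _ w 1 _ _ H1 H.
by congr is_derive; ring.
Qed.

Lemma is_derive_1exp (u w : R) :
  is_derive w 1 (fun x => u * (1 - expR (- (u * x)))) (u ^+ 2 * expR (- (u * w))).
Proof.
have H1 : is_derive w 1 (fun x : R => 1 - expR (- (u * x))) (0 - (- u * expR (- (u * w)))).
  exact: (@is_deriveB R R^o R^o (cst 1) _ w 1 _ _ (is_derive_cst _ _ _) (is_derive_expN u w)).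
have := @is_deriveZ R R^o R^o _ u w 1 _ H1.
by congr is_derive; rewrite /GRing.scale/=; ring.
Qed.

Lemma expc0 u : expc u 0 = 0.
Proof. by rewrite /expc mulr0 oppr0 expR0; ring. Qed.

Lemma expc_ge0 u w : 0 <= expc u w.
Proof. by have := expR_ge1Dx (- (u * w)); rewrite /expc; lra. Qed.

Lemma continuous_1exp (u : R) : continuous (fun x => u * (1 - expR (- (u * x)))).
Proof. by move=> x; exact: is_derive_continuous (is_derive_1exp u x). Qed.

Lemma continuous_expc (u : R) : continuous (expc u).
Proof. by move=> x; exact: is_derive_continuous (is_derive_expc u x). Qed.

Lemma cl1_1exp (u : R) : 0 < u -> cl1 (fun x => u * (1 - expR (- (u * x)))).
Proof.
move=> u0; apply: continuous_cl1 (@continuous_1exp u) => x x0.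
have : expR (- (u * x)) <= expR 0 by rewrite ler_expR oppr_le0 mulr_ge0// ltW.
by rewrite expR0 => ?; rewrite mulr_ge0 ?subr_ge0// ltW.
Qed.

Lemma cl1_2exp (u : R) : cl1 (fun x => u ^+ 2 * expR (- (u * x))).
Proof.
apply: continuous_cl1 => [x x0|x]; first by rewrite mulr_ge0 ?sqr_ge0 ?expR_ge0.
by apply: cvgM; [exact: cvg_cst|exact: continuous_expN].
Qed.

Lemma convol_1exp (u : R) : 0 < u ->
  convol heaviside (restr (fun x => u * (1 - expR (- (u * x))))) = restr (expc u).
Proof.
move=> u0; apply: convol_heaviside_prim (cl1_1exp u0) _ _.
  by move=> x _; exact: is_derive_expc.
by apply: cvg0_right_continuous; [exact: continuous_expc|exact: expc0].
Qed.

Lemma convol_2exp (u : R) : 0 < u ->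
  convol heaviside (convol heaviside (restr (fun x => u ^+ 2 * expR (- (u * x))))) =
  restr (expc u).
Proof.
move=> u0; rewrite -convol_1exp//; congr convol.
apply: convol_heaviside_prim (cl1_2exp u) _ _.
  by move=> x _; exact: is_derive_1exp.
by apply: cvg0_right_continuous; [exact: continuous_1exp|rewrite mulr0 oppr0 expR0 subrr mulr0].
Qed.

Lemma integral_restr_pos (nu : {measure set RM -> \bar R}) (f : R -> R) :
  (\int[nu]_w restr f w = \int[nu]_(w in `]0%R, +oo[) (f w)%:E)%E.
Proof.
rewrite [RHS]integral_mkcond; apply: eq_integral => w _; rewrite patchE /restr.
have [w0|w0] := ltP 0 w; first by rewrite mem_set/= ?in_itv/= ?w0.
by rewrite memNset//= in_itv/= andbT; apply/negP; rewrite -leNgt.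
Qed.

Section in_N.
Variables (sigma m : R) (Pi : {measure set RM -> \bar R}) (psi : R -> R).
Hypothesis psiN : in_N sigma m Pi psi.

Lemma N_integral_expc u : 0 <= u ->
  (\int[Pi]_(w in `]0%R, +oo[) (expc u w)%:E)%E = (psi u - (sigma ^+ 2 * u ^+ 2 + m * u))%:E.
Proof.
move=> u0; have := N_psi psiN u0.
set J := (X in (_ + X)%E) => E; rewrite -[LHS]/J; move: J E => J.
(* The equation has a finite left-hand side, which excludes an infinite integral. *)
case: J => [j||] //=.
by rewrite -EFinD => -[->]; congr EFin; ring.
Qed.

(** Markov's inequality for w -> [expc 1 w], which is Pi-integrable, increasing and positive at
    y. *)
Lemma N_levy : levy Pi.
Proof.
split; first exact: N_Pi psiN.
move=> y y0; have c0 : 0 < expc 1 y.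
  have := @expR_gt1Dx R (- (1 * y)); rewrite /expc => /(_ _); rewrite mul1r oppr_eq0 gt_eqF//.
  by move=> /(_ isT); lra.
have F := N_integral_expc ler01.
have me : measurable_fun setT (EFin \o expc 1 : RM -> \bar R).
  by apply/measurable_EFinP; apply: continuous_measurable_fun; exact: continuous_expc.
have : ((expc 1 y)%:E * Pi `]y, +oo[%classic <= \int[Pi]_(w in `]0%R, +oo[) (expc 1 w)%:E)%E.
  rewrite -integral_cst//.
  apply: (@le_trans _ _ (\int[Pi]_(w in `]y, +oo[) (expc 1 w)%:E)%E).
    apply: ge0_le_integral => //.
    - by move=> x _; rewrite lee_fin ltW.
    - exact: measurable_funTS.
    - move=> x /=; rewrite in_itv/= andbT => yx; rewrite lee_fin /expc !mul1r.
      (* Monotonicity by hand: e^(-x) >= e^(-y) (1 - (x - y)) >= e^(-y) - (x - y). *)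
      have E : expR (- x) = expR (- y) * expR (- (x - y)).
        by rewrite -expRD; congr expR; ring.
      have H1 := expR_ge1Dx (- (x - y)); have H2 := expR_gt0 (- y).
      have H3 : expR (- y) <= 1 by rewrite -[leRHS]expR0 ler_expR oppr_le0 ltW.
      by rewrite E; nra.
  apply: ge0_subset_integral => //.
  - exact: measurable_funTS.
  - by move=> x _; rewrite lee_fin expc_ge0.
  - by apply: subset_itvr; rewrite bnd_simp ltW.
rewrite F => H; rewrite -(@lte_pmul2l _ (expc 1 y)%:E)//.
by apply: le_lt_trans H _; rewrite gt0_muley ?lte_fin// ltry.
Qed.

(** The integral of (1 - e^(-r)) tail Pi r is the Pi-integral of [expc 1], hence finite, and the
    weight is at least 1 - e^(-s) beyond s. *)
Lemma N_tail_integrable s : 0 < s -> (\int[leb]_(r in `]s, +oo[) (tail Pi r)%:E < +oo)%E.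
Proof.
move=> s0; have H := integral_tail N_levy (cl1_causal (cl1_1exp ltr01)).
rewrite convol_1exp// integral_restr_pos (N_integral_expc ler01) in H.
have c0 : 0 < 1 - expR (- (1 * s)).
  by rewrite subr_gt0 -[ltRHS]expR0 ltr_expR mul1r oppr_lt0.
rewrite -(@lte_pmul2l _ (1 - expR (- (1 * s)))%:E)//.
rewrite [ltRHS]gt0_muley ?lte_fin//.
have mt := measurable_tail N_levy.
have tS : `]s, +oo[ `<=` (`]0, +oo[ : set RM).
  by apply: subset_itvr; rewrite bnd_simp ltW.
rewrite -ge0_integralZl//; last 3 first.
- by apply/measurable_EFinP; apply: measurable_funS mt.
- by move=> x _; rewrite lee_fin tail_ge0.
- by rewrite lee_fin ltW.
apply: (@le_lt_trans _ _ (psi 1 - (sigma ^+ 2 * 1 ^+ 2 + m * 1))%:E); last exact: ltry.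
rewrite -H [leLHS]integral_mkcond; apply: ge0_le_integral => //.
- move=> x _; rewrite patchE; case: ifP => // _.
  by rewrite -EFinM lee_fin mulr_ge0 ?tail_ge0// ltW.
- apply/(measurable_restrictT (fun x => (1 - expR (- (1 * s)))%:E * (tail Pi x)%:E)%E) => //.
  by apply: measurable_funeM; apply/measurable_EFinP; apply: measurable_funS mt.
- apply: emeasurable_funM; first exact: causal_measurable (causal_tail N_levy).
  exact: causal_measurable (cl1_causal (cl1_1exp ltr01)).
- move=> x _; rewrite patchE; case: ifP => [|_].
    rewrite inE/= in_itv/= andbT => sx; have x0 := lt_trans s0 sx.
    rewrite !restrE// -!EFinM lee_fin mulrC; apply: ler_wpM2l; first exact: tail_ge0.
    by rewrite !mul1r lerD2l lerN2 ler_expR lerN2 ltW.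
  apply: mule_ge0; first exact: causal_ge0 (causal_tail N_levy) _.
  exact: causal_ge0 (cl1_causal (cl1_1exp ltr01)) _.
Qed.

Definition levyK : R -> R := fun y => m + tail2 Pi y.

(** [integral_tail2] for G s = u^2 e^(-us), whose second primitive is [expc u]. *)
Lemma laplace_tail2 u : 0 < u ->
  ((u ^+ 2)%:E * laplace u (restr (tail2 Pi)) = (psi u - (sigma ^+ 2 * u ^+ 2 + m * u))%:E)%E.
Proof.
move=> u0; have ct := causal_tail2 N_levy N_tail_integrable.
rewrite -N_integral_expc ?ltW// -integral_restr_pos -convol_2exp//.
rewrite -(integral_tail2 N_levy N_tail_integrable (cl1_causal (cl1_2exp u))).
rewrite -laplaceZ ?sqr_ge0//; apply: eq_integral => s _.
have [s0|s0] := leP s 0; first by rewrite (causal_le0 ct)// !mule0 mul0e.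
by rewrite !restrE// -!EFinM; congr EFin; ring.
Qed.

Lemma levyK_ge0 x : 0 <= levyK x.
Proof. by rewrite addr_ge0 ?tail2_ge0//; exact/ltW/(N_m psiN). Qed.

Lemma levyK_continuous x : 0 < x -> {for x, continuous levyK}.
Proof.
move=> x0; apply: cvgD; first exact: cvg_cst.
exact: (tail2_continuous N_levy N_tail_integrable x0).
Qed.

Lemma levyK_nonincreasing x y : 0 < x -> x <= y -> levyK y <= levyK x.
Proof.
by move=> x0 xy; rewrite lerD2l; exact: (tail2_nonincreasing N_levy N_tail_integrable).
Qed.

Lemma causal_levyK : causal (restr levyK).
Proof.
by apply: pos_continuous_causal => [x _|x x0]; [exact: levyK_ge0|exact: levyK_continuous].
Qed.

Lemma restr_levyK : restr levyK = ((fun x => m%:E * heaviside x) \+ restr (tail2 Pi))%E.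
Proof.
apply/funext => x /=; rewrite /restr /heaviside; case: ifP => _; last by rewrite mule0 adde0.
by rewrite mule1 -EFinD.
Qed.

Lemma laplace_levyK u : 0 < u ->
  ((u ^+ 2)%:E * laplace u (restr levyK) = (psi u - sigma ^+ 2 * u ^+ 2)%:E)%E.
Proof.
move=> u0; have ct := causal_tail2 N_levy N_tail_integrable.
have m0 := ltW (N_m psiN); have CH := @causal_heaviside R.
rewrite restr_levyK laplaceD//; last exact: causal_scale.
rewrite laplaceZ// laplace_heaviside// -EFinM ge0_muleDr//; last 2 first.
- by rewrite lee_fin mulr_ge0// invr_ge0 ltW.
- exact: laplace_ge0.
rewrite laplace_tail2// -EFinM -EFinD; congr EFin.
by field; rewrite gt_eqF.
Qed.

Lemma laplace_levyK_lty u : 0 < u -> (laplace u (restr levyK) < +oo)%E.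
Proof.
move=> u0; have u20 : 0 < u ^+ 2 by rewrite exprn_gt0.
rewrite -(@lte_pmul2l _ (u ^+ 2)%:E)//.
by rewrite laplace_levyK// gt0_muley ?lte_fin// ltry.
Qed.

Lemma cl1_of_laplace (f : R -> R) : (forall x, 0 < x -> 0 <= f x) ->
  (forall x, 0 < x -> {for x, continuous f}) -> (laplace 1 (restr f) < +oo)%E -> cl1 f.
Proof.
move=> f0 cf Lf; split => // a; have Cf := pos_continuous_causal f0 cf.
rewrite integral_restr_itv.
have e0 : 0 < expR (- (1 * a)) by exact: expR_gt0.
rewrite -(@lte_pmul2l _ (expR (- (1 * a)))%:E)// [ltRHS]gt0_muley ?lte_fin//.
have Ca := causal_cutoff a Cf.
apply: le_lt_trans Lf; rewrite -integral_cutoff// -(integral_causalZ (ltW e0) Ca).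
apply: le_integral_causal; [exact: causal_scale (ltW e0) Ca|exact: causal_laplace_integrand|].
move=> x x0; rewrite /cutoff; case: ifP => xa; last first.
  by rewrite mule0; exact: (causal_ge0 (causal_laplace_integrand 1 Cf)).
apply: lee_wpmul2r; first exact: causal_ge0.
by rewrite lee_fin ler_expR lerN2 !mul1r ltW.
Qed.

Lemma cl1_levyK : cl1 levyK.
Proof.
apply: cl1_of_laplace (laplace_levyK_lty ltr01); first by move=> x _; exact: levyK_ge0.
exact: levyK_continuous.
Qed.

End in_N.
End PsiKernel.

(** * The renewal equation *)

Section Renewal.
Context {R : realType}.
Local Notation leb := (@lebesgue_measure R).
Local Notation RM := (measurableTypeR R).
Implicit Types x y z u e : R.
Variables (sigma m : R) (Pi : {measure set RM -> \bar R}) (psi W : R -> R).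
Hypotheses (psiN : in_N sigma m Pi psi) (WS : scale_function psi W).
Local Notation K := (levyK m Pi).
Local Notation W1 := (derive1 W).

Lemma scale_is_derive x : 0 < x -> is_derive x 1 W (W1 x).
Proof.
by move=> x0; rewrite derive1E; apply: DeriveDef => //; exact: ((scale_C1 WS).1 0%N _ _ x0).
Qed.

Lemma scale_derive_continuous x : 0 < x -> {for x, continuous W1}.
Proof. by move=> x0; exact: ((scale_C1 WS).2 _ x0). Qed.

Lemma scale_function_continuous x : 0 < x -> {for x, continuous W}.
Proof. by move=> x0; exact: is_derive_continuous (scale_is_derive x0). Qed.

Lemma cl1_scale_derive : cl1 W1.
Proof.
apply: (@cl1_of_derive R W1 W 0) => x x0.
- exact/ltW/(scale_derive_gt0 WS).
- exact: scale_derive_continuous.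
- exact: scale_is_derive.
- by apply: (scale_ge0 WS); exact: ltW.
Qed.

Lemma scale_increment x y : 0 < x -> x <= y -> W x + (prim W1 y - prim W1 x) = W y.
Proof.
move=> x0 xy; have := prim_increment cl1_scale_derive x0 xy.
rewrite (integral_derive x0 xy scale_derive_continuous scale_is_derive) => -[<-].
by rewrite addrC subrK.
Qed.

Lemma scale_nondecreasing x y : 0 < x -> x <= y -> W x <= W y.
Proof.
move=> x0 xy; rewrite -(scale_increment x0 xy) lerDl -lee_fin.
rewrite -(prim_increment cl1_scale_derive)//; apply: integral_ge0 => z /=.
rewrite in_itv/= => /andP[xz _]; rewrite lee_fin ltW// (scale_derive_gt0 WS)//.
exact: lt_le_trans xz.
Qed.

Lemma psi_gt0 u : 0 < u -> 0 < psi u.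
Proof.
move=> u0; have := N_integral_expc psiN (ltW u0).
have : (0 <= \int[Pi]_(w in `]0%R, +oo[) (expc u w)%:E)%E.
  by apply: integral_ge0 => w _; rewrite lee_fin expc_ge0.
move=> + E; rewrite E lee_fin => H.
have := mulr_gt0 (N_m psiN) u0; have := mulr_ge0 (sqr_ge0 sigma) (sqr_ge0 u); lra.
Qed.

Lemma causal_scale_function : causal (restr W).
Proof.
apply: pos_continuous_causal => x x0; last exact: scale_function_continuous.
by apply: (scale_ge0 WS); exact: ltW.
Qed.

Lemma laplace_scale u : 0 < u -> laplace u (restr W) = ((psi u)^-1)%:E.
Proof.
move=> u0; have := scale_laplace WS u0; have p0 := psi_gt0 u0.
rewrite [X in (_ * X)%E](_ : _ = laplace u (restr W)).
  move=> H; rewrite -[LHS]mul1e -(mulVf (lt0r_neq0 p0)) EFinM -muleA.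
  by rewrite H mule1.
rewrite integral_mkcond; apply: eq_integral => y _; rewrite patchE.
have [y0|y0] := leP 0 y; last first.
  rewrite (causal_le0 causal_scale_function (ltW y0)) mule0 memNset//= in_itv/= andbT.
  by apply/negP; rewrite -ltNge.
rewrite mem_set/= ?in_itv/= ?y0//; move: y0; rewrite le_eqVlt => /orP[/eqP <-|y0].
  by rewrite (scale0 WS) mulr0 (causal_le0 causal_scale_function (lexx _)) mule0.
by rewrite restrE// EFinM.
Qed.

(** As the Laplace transform of W >= 0, 1/psi is nonincreasing, which suffices for measurability. *)
Lemma measurable_psiV : measurable_fun (`]0, +oo[ : set RM) (fun u => (psi u)^-1).
Proof.
apply: nonincreasing_pos_measurable => x y x0 xy; have y0 := lt_le_trans x0 xy.
rewrite -lee_fin -(laplace_scale x0) -(laplace_scale y0).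
have C u := causal_laplace_integrand u causal_scale_function.
apply: le_integral_causal => // z z0.
apply: lee_wpmul2r; first exact: (causal_ge0 causal_scale_function).
by rewrite lee_fin ler_expR lerN2 ler_wpM2r// ltW.
Qed.

(** If W >= e throughout ]0, +oo[, comparing Laplace transforms gives 1/psi u >= e/u, whose integral
    at infinity diverges. *)
Lemma scale_small e : 0 < e -> exists2 y, 0 < y & W y < e.
Proof.
move=> e0; apply: contrapT => H.
have {}H y : 0 < y -> e <= W y.
  by move=> y0; rewrite leNgt; apply/negP => We; apply: H; exists y.
have He u : 0 < u -> e * u^-1 <= (psi u)^-1.
  move=> u0; rewrite -lee_fin -laplace_scale// EFinM -laplace_heaviside//.
  have CH := @causal_heaviside R.
  have Ce := causal_scale (ltW e0) CH.
  rewrite -laplaceZ//; last exact: ltW.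
  apply: le_integral_causal; try exact: causal_laplace_integrand.
    exact: causal_laplace_integrand causal_scale_function.
  move=> z z0; apply: lee_wpmul2l; first by rewrite lee_fin expR_ge0.
  by rewrite restrE// /heaviside z0 mule1 lee_fin H.
have [A A0 HA] := N_integrable_oo psiN.
have : (\int[leb]_(u in `[A, +oo[) ((psi u)^-1)%:E \is a fin_num)%E.
  rewrite ge0_fin_numE//; apply: integral_ge0 => u /=; rewrite in_itv/= andbT => Au.
  by rewrite lee_fin invr_ge0 ltW// psi_gt0// (lt_le_trans A0).
move=> /fineK; set C := fine _ => EC.
have mV (D : set RM) : D `<=` `]0, +oo[ -> measurable_fun D (fun u : R => u^-1).
  move=> DS; have mV : measurable_fun (`]0, +oo[ : set RM) (fun u : R => u^-1).
    apply: nonincreasing_pos_measurable => x y x0 xy.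
    by rewrite lef_pV2// posrE// (lt_le_trans x0).
  exact: measurable_funS mV.
have HB B : A <= B -> e * (ln B - ln A) <= C.
  move=> AB; rewrite -lee_fin EFinM EC.
  have cV x : 0 < x -> {for x, continuous (fun u : R => u^-1)}.
    by move=> x0; apply: inv_continuous; rewrite gt_eqF.
  have dV x : 0 < x -> is_derive x 1 (@ln R) x^-1 by exact: is_derive1_ln.
  rewrite -(integral_derive A0 AB cV dV).
  rewrite -ge0_integralZl_EFin ?(ltW e0)//; last 2 first.
  - by move=> x /=; rewrite in_itv/= => /andP[Ax _]; rewrite lee_fin invr_ge0 (le_trans (ltW A0)).
  - apply/measurable_EFinP; apply: mV => x /=; rewrite !in_itv/= andbT => /andP[+ _].
    exact: lt_le_trans.
  apply: (@le_trans _ _ (\int[leb]_(u in `[A, B]) ((psi u)^-1)%:E)%E).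
    apply: ge0_le_integral => //.
    - move=> x /=; rewrite in_itv/= => /andP[Ax _].
      by rewrite -EFinM lee_fin mulr_ge0// ?invr_ge0 ?(ltW e0)// (le_trans (ltW A0)).
    - apply: measurable_funeM; apply/measurable_EFinP; apply: mV => x /=; rewrite !in_itv/= andbT => /andP[+ _].
      exact: lt_le_trans.
    - apply/measurable_EFinP; apply: measurable_funS measurable_psiV => //.
      by move=> x /=; rewrite !in_itv/= andbT => /andP[+ _]; exact: lt_le_trans.
    - move=> x /=; rewrite in_itv/= => /andP[Ax _].
      by rewrite -EFinM lee_fin He// (lt_le_trans A0).
  apply: ge0_subset_integral => //.
  - apply/measurable_EFinP; apply: measurable_funS measurable_psiV => //.
    by move=> x /=; rewrite !in_itv/= !andbT; exact: lt_le_trans.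
  - move=> x /=; rewrite in_itv/= andbT => Ax.
    by rewrite lee_fin invr_ge0 ltW// psi_gt0// (lt_le_trans A0).
  - exact: subset_itvl.
have C0 : 0 <= C.
  by have := HB A (lexx _); rewrite subrr mulr0.
(* This B makes e (ln B - ln A) equal to C + e, which exceeds the bound C. *)
have := HB (A * expR (C / e + 1)).
rewrite lnM ?posrE ?expR_gt0// expRK [X in X - _]addrC addrK mulrDr mulrCA mulfV ?gt_eqF//.
rewrite !mulr1 ler_peMr ?(ltW A0)//; last by rewrite -expR0 ler_expR addr_ge0 ?divr_ge0// ltW.
by move=> /(_ isT); lra.
Qed.

Lemma scale_cvg0 : W x @[x --> 0^'+] --> (0 : R).
Proof.
apply/cvgrPdist_le => e e0; have [y y0 We] := scale_small e0.
near=> x; have x0 : 0 < x by near: x; exact: nbhs_right_gt.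
have xy : x <= y by near: x; exact: nbhs_right_le.
rewrite sub0r normrN ger0_norm; last by apply: (scale_ge0 WS); exact: ltW.
exact: le_trans (scale_nondecreasing x0 xy) (ltW We).
Unshelve. all: by end_near. Qed.

Lemma scale_prim x : 0 < x -> W x = prim W1 x.
Proof.
by move=> x0; rewrite (prim_eq cl1_scale_derive scale_is_derive scale_cvg0 x0) add0r.
Qed.

Lemma restr_scale : restr W = convol heaviside (restr W1).
Proof.
apply/esym/convol_heaviside_prim; [exact: cl1_scale_derive|exact: scale_is_derive|].
exact: scale_cvg0.
Qed.

Lemma laplace_scale_derive u : 0 < u -> laplace u (restr W1) = (u / psi u)%:E.
Proof.
move=> u0; have := laplace_scale u0.
rewrite restr_scale laplace_convol; [|exact: causal_heaviside|exact: cl1_causal cl1_scale_derive].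
rewrite laplace_heaviside// EFinM => <-.
by rewrite muleA -EFinM mulfV ?mul1e// gt_eqF.
Qed.

(** The transform of the left-hand side is sigma^2 u / psi u + (u / psi u) (psi u - sigma^2 u^2) /
    u^2 = 1 / u, that of the constant 1. Membership in [cl1] upgrades this to a pointwise
    identity. *)
Lemma renewal x : 0 < x -> sigma ^+ 2 * W1 x + rconv W1 K x = 1.
Proof.
have cW := cl1_scale_derive; have cK := cl1_levyK psiN.
have cWK := cl1_rconv cW cK; have cs := cl1Z (sqr_ge0 sigma) cW.
have cF := cl1D cs cWK.
have L u : 0 < u ->
    laplace u (restr (fun x => sigma ^+ 2 * W1 x + rconv W1 K x)) = laplace u (restr (fun=> 1)).
  move=> u0; rewrite (_ : restr _ = (fun x => (sigma ^+ 2)%:E * restr W1 x)%E \+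
      convol (restr W1) (restr K)); last first.
    apply/funext => y /=; rewrite -restr_rconv// /restr; case: ifP => _.
      by rewrite EFinD EFinM.
    by rewrite mule0 adde0.
  have CW := cl1_causal cW; have CK := cl1_causal cK.
  rewrite laplaceD; [|exact: causal_scale (sqr_ge0 _) CW|exact: causal_convol].
  rewrite laplaceZ ?sqr_ge0// laplace_convol// laplace_scale_derive//.
  rewrite [RHS](_ : _ = laplace u heaviside)// laplace_heaviside//.
  have -> : laplace u (restr K) = (u ^- 2 * (psi u - sigma ^+ 2 * u ^+ 2))%:E.
    have u20 : u ^+ 2 != 0 by rewrite expf_neq0// gt_eqF.
    rewrite EFinM -(laplace_levyK psiN u0) muleA -EFinM mulVf// mul1e//.
  rewrite -!EFinM -EFinD; congr EFin; have p0 := psi_gt0 u0.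
  by field; rewrite !gt_eqF.
move=> x0.
have c1 := @cl1_cst R 1 ler01.
apply: (laplace_inj cF c1 _ L x0).
move=> u u0; rewrite L// [ltLHS](_ : _ = laplace u heaviside)// laplace_heaviside//.
exact: ltry.
Qed.

End Renewal.

(** * Log-concavity of the scale function without Gaussian part *)

Section MaximumPrinciple.
Context {R : realType}.
Local Notation leb := (@lebesgue_measure R).
Local Notation RM := (measurableTypeR R).
Implicit Types (x y z s t : R).

(** The test functions of the maximum principle are differentiated on the whole line. For x <= 0 the
    integral is started at x - 1 instead of 0, which changes nothing because f vanishes on ]-oo,
    0]. *)
Lemma prim_is_derive_everywhere (f : R -> R) x : continuous f ->
  (forall y, 0 <= f y) -> (forall y, y <= 0 -> f y = 0) -> is_derive x 1 (prim f) (f x).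
Proof.
move=> cf f0 fn; have clf : cl1 f by apply: continuous_cl1.
have [x0|x0] := ltP 0 x; first exact: prim_is_derive.
have mf (D : set RM) : measurable_fun D f.
  by apply: measurable_funTS; exact: continuous_measurable_fun.
pose a := x - 1.
have [] := @continuous_FTC1 R f (BRight a) x (x + 1) _ _ _ (cf x).
- by rewrite ltrDl.
- have := @continuous_compact_integrable R f `[a, x + 1] (@segment_compact R a (x + 1))
    (continuous_subspaceT cf).
  by apply: integrableS => //; apply: subset_itv; rewrite bnd_simp.
- by rewrite /= lte_fin /a ltrBlDr ltrDl.
move=> dF EF.
have E : \forall z \near x, (fun z => \int[leb]_(t in `]a, z]) f t) z = prim f z.
  near=> z; have az : a < z by near: z; apply: lt_nbhsr; rewrite /a ltrBlDr ltrDl.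
  rewrite /prim /Rintegral; congr fine.
  rewrite [LHS]integral_mkcond [RHS]integral_mkcond.
  apply: ae_eq_integral => //.
  - apply/(measurable_restrictT (fun x => (f x)%:E)) => //. apply/measurable_EFinP. exact: mf.
  - apply/(measurable_restrictT (fun x => (f x)%:E)) => //. apply/measurable_EFinP. exact: mf.
  - exists [set z]; split => //; first exact: lebesgue_measure_set1.
    move=> t /=; apply: contra_notP => /eqP tz _; rewrite !patchE.
    have [t0|t0] := leP t 0.
      by rewrite fn//; case: ifP => _; case: ifP.
    have at_ : a < t by rewrite /a; lra.
    congr (if _ then _ else _); apply/idP/idP; rewrite !inE/= !in_itv/= => /andP[_ tz'].
      by rewrite t0 lt_neqAle tz.
    by rewrite at_ ltW.
have : is_derive x 1 (fun z => \int[leb]_(t in `]a, z]) f t) (f x).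
  by apply: (DeriveDef dF); rewrite -derive1E; exact: EF.
exact: near_eq_is_derive E.
Unshelve. all: by end_near. Qed.

Lemma is_derive_refl (h h1 : R -> R) (x0 s : R) : is_derive (x0 - s) 1 h (h1 (x0 - s)) ->
  is_derive s 1 (fun s => h (x0 - s)) (- h1 (x0 - s)).
Proof.
move=> dh.
have H : is_derive s 1 (fun s => x0 - s) (0 - 1).
  exact: (@is_deriveB R R^o R^o (cst x0) id s 1 _ _ (is_derive_cst _ _ _) (is_derive_id _ _)).
have := @is_derive1_comp R h (fun s => x0 - s) s _ _ dh H.
by rewrite sub0r mulrN mulr1.
Qed.

(* The exponential makes the integrand nonnegative, as convol requires; its own
   contribution is computed exactly and cancels out. *)
Lemma exp_compensation (h : R -> R) (S x0 : R) : continuous h -> 0 <= S + x0 ->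
  (forall x, x <= - S -> h x = 0) ->
  exists2 C, 0 <= C & forall s, 0 <= s -> 0 <= h (x0 - s) + C * expR (- (1 * s)).
Proof.
move=> ch S0 hS; have SX : - S <= x0 by lra.
have [c _ fc] := @EVT_min R h (- S) x0 SX (continuous_subspaceT ch).
exists (`|h c| * expR (S + x0)); first by rewrite mulr_ge0// expR_ge0.
move=> s s0; rewrite -mulrA -expRD.
have [sS|Ss] := leP (x0 - s) (- S).
  by rewrite hS// add0r mulr_ge0 ?expR_ge0.
have /fc : x0 - s \in `[- S, x0] by rewrite in_itv/=; lra.
have H1 : 1 <= expR (S + x0 - 1 * s) by rewrite -[leLHS]expR0 ler_expR; lra.
have := ler_norm (- h c); rewrite normrN => H2 H3.
have := ler_wpM2l (normr_ge0 (h c)) H1; lra.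
Qed.

(** Two integrations by parts turn the pairing of K with s -> f''(x0 - s) into m f'(x0) plus the
    Pi-integral of f(x0 - w) - f(x0) + w f'(x0). At a critical point that minimises f on ]-oo, x0]
    this is nonnegative. The left-hand side of the inequality is the pairing of K with C e^(-s). *)
Lemma kernel_second_derivative_ge0 (sigma m : R) (Pi : {measure set RM -> \bar R})
    (psi : R -> R) (psiN : in_N sigma m Pi psi) (f f1 f2 : R -> R) (S x0 : R) :
  (forall x, is_derive x 1 f (f1 x)) -> (forall x, is_derive x 1 f1 (f2 x)) ->
  continuous f2 -> 0 <= S + x0 -> (forall x, x <= - S -> f1 x = 0) ->
  (forall x, x <= - S -> f2 x = 0) -> f1 x0 = 0 -> (forall x, x <= x0 -> f x0 <= f x) ->
  let K := levyK m Pi in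
  exists2 C, 0 <= C &
  (forall s, 0 <= s -> 0 <= f2 (x0 - s) + C * expR (- (1 * s))) /\
  (C%:E * laplace 1 (restr K) <=
   \int[leb]_s (restr K s * restr (fun s => f2 (x0 - s) + C * expR (- (1 * s)))%R s))%E.
Proof.
move=> df df1 cf2 S0 fS1 fS2 crit fmin K.
have [C C0 HC] := exp_compensation cf2 S0 fS2; exists C => //; split => //.
pose g s := f2 (x0 - s) + C * expR (- (1 * s)).
have cg : continuous g.
  move=> s; apply: cvgD.
    apply: continuous_comp; last exact: cf2.
    by apply: continuousB; [exact: cvg_cst|exact: cvg_id].
  by apply: cvgM; [exact: cvg_cst|exact: continuous_expN].
have clg : cl1 g by apply: continuous_cl1 => // x x_0; apply: HC; exact: ltW.
pose e1 s := - f1 (x0 - s) + C * (1 * (1 - expR (- (1 * s)))).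
pose e s := f (x0 - s) - f x0 + C * expc 1 s.
have de1 s : is_derive s 1 e1 (g s).
  have H1 := is_derive_refl (df1 (x0 - s)).
  have H2 := @is_deriveN R R^o R^o _ s 1 _ H1.
  have H3 := @is_deriveZ R R^o R^o _ C s 1 _ (is_derive_1exp 1 s).
  have := @is_deriveD R R^o R^o _ _ s 1 _ _ H2 H3.
  by congr is_derive; rewrite /g /GRing.scale/=; ring.
have de s : is_derive s 1 e (e1 s).
  have H1 := is_derive_refl (df (x0 - s)).
  have H2 := @is_deriveB R R^o R^o _ (cst (f x0)) s 1 _ _ H1 (is_derive_cst _ _ _).
  have H3 := @is_deriveZ R R^o R^o _ C s 1 _ (is_derive_expc 1 s).
  have := @is_deriveD R R^o R^o _ _ s 1 _ _ H2 H3.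
  by congr is_derive; rewrite /e1 /GRing.scale/=; ring.
have e10 : e1 0 = 0 by rewrite /e1 subr0 crit mulr0 oppr0 expR0; ring.
have e0 : e 0 = 0 by rewrite /e subr0 subrr expc0; ring.
have e1c : e1 x @[x --> 0^'+] --> (0 : R).
  by apply: cvg0_right_continuous => // x; exact: is_derive_continuous (de1 x).
have ec : e x @[x --> 0^'+] --> (0 : R).
  by apply: cvg0_right_continuous => // x; exact: is_derive_continuous (de x).
have E1 s : 0 < s -> e1 s = prim g s.
  by move=> s0; rewrite (prim_eq clg (fun x _ => de1 x) e1c s0) add0r.
have HH : convol heaviside (convol heaviside (restr g)) = restr e.
  have -> : convol heaviside (restr g) = restr (prim g).
    apply: convol_heaviside_prim => //; last exact: prim_cvg0.
    by move=> x; exact: prim_is_derive.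
  apply: convol_heaviside_prim; [exact: cl1_prim| |exact: ec].
  by move=> x x_0; rewrite -E1.
have Cg := cl1_causal clg.
have nL := N_levy psiN; have n2 := N_tail_integrable psiN.
have CT := causal_tail2 nL n2; have CH := @causal_heaviside R.
have m0 := ltW (N_m psiN).
have CmH := causal_scale m0 CH.
rewrite /K restr_levyK laplaceD// ge0_muleDr//; [|exact: laplace_ge0|exact: laplace_ge0].
have -> : (\int[leb]_s (((fun x => m%:E * heaviside x) \+ restr (tail2 Pi)) s * restr g s) =
   m%:E * \int[leb]_s (restr g s) + \int[leb]_s (restr (tail2 Pi) s * restr g s))%E.
  rewrite -(integral_causalZ m0 Cg) -(integral_causalD (causal_scale m0 Cg) (causal_mul CT Cg)).
  apply: eq_integral => s _ /=.
  rewrite ge0_muleDl; [|exact: causal_ge0 CmH _|exact: causal_ge0 CT _].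
  congr (_ + _)%E; have [s0|s0] := leP s 0.
    by rewrite (causal_le0 Cg s0) !mule0.
  by rewrite /heaviside s0 mule1.
apply: leeD.
  rewrite laplaceZ// laplace_heaviside// invr1 mule1 muleC.
  apply: lee_wpmul2l => //.
  apply/lee_addgt0Pr => d d0.
  have Cd0 : 0 <= C / d by rewrite divr_ge0// ltW.
  (* Beyond S + x0 the term f1(x0 - B) vanishes, and B >= C / d makes C e^(-B) at most d. *)
  pose B := S + x0 + (C / d + 1).
  have B0 : 0 < B by rewrite /B ltr_wpDl// ltr_wpDl.
  apply: (@le_trans _ _ ((prim g B)%:E + d%:E)%E); last first.
    apply: leeD => //; rewrite primE// convol_heavisideE// -integral_cutoff//.
    apply: le_integral_causal => //; first exact: causal_cutoff.
    by move=> s s0; rewrite /cutoff; case: ifP => // _; exact: (causal_ge0 Cg).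
  rewrite -EFinD lee_fin -E1// /e1 fS1; last first.
    by rewrite /B; lra.
  have HB : C * expR (- (1 * B)) <= d.
    rewrite mul1r expRN ler_pdivrMr ?expR_gt0//.
    rewrite -ler_pdivrMl// mulrC; apply: le_trans (expR_ge1Dx B).
    by rewrite /B; lra.
  lra.
have Ce := cl1_causal (cl1_2exp (1 : R)).
have -> : (C%:E * laplace 1 (restr (tail2 Pi)) = \int[Pi]_w (C%:E * restr (expc 1) w))%E.
  rewrite ge0_integralZl//.
  - rewrite -convol_2exp// -(integral_tail2 nL n2 Ce); congr (_ * _)%E.
    apply: eq_integral => s _; have [s0|s0] := leP s 0.
      by rewrite (causal_le0 CT s0) mule0 mul0e.
    by rewrite !restrE// -!EFinM; congr EFin; ring.
  - rewrite -convol_2exp//; apply: causal_measurable; apply: causal_convol => //.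
    exact: causal_convol.
  - by move=> x _; rewrite /restr lee_fin; case: ifP => // _; exact: expc_ge0.
rewrite (integral_tail2 nL n2 Cg) HH; apply: ge0_le_integral => //.
- by move=> x _; rewrite -EFinM lee_fin mulr_ge0//; case: ifP => // _; exact: expc_ge0.
- apply: measurable_funeM; rewrite -convol_2exp//; apply: causal_measurable.
  by apply: causal_convol => //; exact: causal_convol.
- by rewrite -HH; apply: causal_measurable; apply: causal_convol => //; exact: causal_convol.
- move=> w _; have [w0|w0] := leP w 0.
    by rewrite /restr ltNge w0/= mule0.
  by rewrite !restrE// -EFinM lee_fin /e lerDr subr_ge0 fmin// lerBlDr lerDl ltW.
Qed.

End MaximumPrinciple.

(** * Test functions built on W and log-concavity *)

Section LogConcavity.
Context {R : realType}.
Local Notation leb := (@lebesgue_measure R).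
Local Notation RM := (measurableTypeR R).
Implicit Types (x y z s t d : R).

Section scale.
Variables (m : R) (Pi : {measure set RM -> \bar R}) (psi W : R -> R).
Hypotheses (psiN : in_N 0 m Pi psi) (WS : scale_function psi W).
Local Notation K := (levyK m Pi).
Local Notation W1 := (derive1 W).

(** Second differences and reflected arguments reach the left of 0, where W carries no information;
    extending by 0 is continuous because W(0+) = 0. *)
Definition zscale : R -> R := fun x => if 0 < x then W x else 0.
Local Notation w := zscale.

Lemma zscaleE x : 0 < x -> w x = W x.
Proof. by rewrite /zscale => ->. Qed.

Lemma zscale0 x : x <= 0 -> w x = 0.
Proof. by rewrite /zscale ltNge => ->. Qed.

Lemma zscale_ge0 x : 0 <= w x.
Proof. by rewrite /zscale; case: ifPn => // x0; apply: (scale_ge0 WS); exact: ltW. Qed.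

Lemma zscale_nondecreasing x y : x <= y -> w x <= w y.
Proof.
move=> xy; have [x0|x0] := leP x 0; first by rewrite (zscale0 x0) zscale_ge0.
rewrite !zscaleE//; last exact: lt_le_trans xy.
exact: (scale_nondecreasing WS x0 xy).
Qed.

Lemma zscale_continuous : continuous w.
Proof.
move=> x; case: (ltgtP x 0) => x0.
- rewrite /continuous_at (zscale0 (ltW x0)).
  apply: cvg_near_cst; near=> z; rewrite zscale0// ltW//; near: z; exact: lt_nbhsl.
- rewrite /continuous_at zscaleE//.
  apply: (@cvg_trans _ (W z @[z --> x])); last exact: (scale_function_continuous WS x0).
  by apply: near_eq_cvg; near=> z; rewrite zscaleE//; near: z; exact: lt_nbhsr.
- rewrite x0; apply/left_right_continuousP; rewrite (zscale0 (lexx _)); split.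
    by apply: cvg_near_cst; near=> z; rewrite zscale0//; near: z; exact: nbhs_left_le.
  apply: (@cvg_trans _ (W z @[z --> (0 : R)^'+])); last exact: scale_cvg0 psiN WS.
  by apply: near_eq_cvg; near=> z; rewrite zscaleE//; near: z; exact: nbhs_right_gt.
Unshelve. all: by end_near. Qed.

(** The renewal equation integrated once: K * W = 1 * (K * W') = 1 * 1. *)
Lemma convol_scale_kernel y : 0 < y -> convol (restr K) (restr W) y = y%:E.
Proof.
move=> y0; have cW := cl1_scale_derive WS; have cK := cl1_levyK psiN.
have CW := cl1_causal cW; have CK := cl1_causal cK; have CH := @causal_heaviside R.
rewrite (restr_scale psiN WS) (convolA CK CH CW) (convolC CK CH) -(convolA CH CK CW).
rewrite (convolC CK CW) -restr_rconv//.
have -> : restr (rconv W1 K) = restr (fun=> 1).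
  apply/funext => x; rewrite /restr; case: ifPn => // x0; congr EFin.
  by rewrite -(renewal psiN WS x0) expr0n/= mul0r add0r.
rewrite -primE; last exact: cl1_cst.
rewrite /prim Rintegral_cst//= lebesgue_measure_itv/= lte_fin y0/= subr0.
by rewrite mul1r.
Qed.

Lemma integral_shifted_scale x d : 0 <= d -> 0 < x ->
  (\int[leb]_s (restr K s * (w (x + d - s))%:E) = (x + d)%:E)%E.
Proof.
by move=> d0 x0; rewrite -convol_scale_kernel ?ltr_wpDr//.
Qed.

(** [v2] is of class C^2 on the line with second derivative [w], so the maximum principle applies to
    combinations of its shifts although it could not be applied to [w] itself. *)
Let v1 := prim w.
Let v2 := prim v1.

Let w_le0 x : x <= 0 -> w x = 0. Proof. exact: zscale0. Qed.

Let dv1 x : is_derive x 1 v1 (w x).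
Proof.
apply: prim_is_derive_everywhere; [exact: zscale_continuous|exact: zscale_ge0|exact: w_le0].
Qed.

Let cw : cl1 w.
Proof. by apply: continuous_cl1 => [x _|]; [exact: zscale_ge0|exact: zscale_continuous]. Qed.

Let v1_ge0 x : 0 <= v1 x. Proof. exact: prim_ge0. Qed.
Let v1_le0 x : x <= 0 -> v1 x = 0. Proof. exact: prim_le0. Qed.
Let cv1 : continuous v1.
Proof. by move=> x; exact: is_derive_continuous (dv1 x). Qed.

Let dv2 x : is_derive x 1 v2 (v1 x).
Proof. by apply: prim_is_derive_everywhere. Qed.

Let v2_ge0 x : 0 <= v2 x. Proof. exact: prim_ge0 (cl1_prim cw). Qed.
Let v2_le0 x : x <= 0 -> v2 x = 0. Proof. exact: prim_le0. Qed.

Definition second_difference (h : R -> R) (d x : R) : R :=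
  h (x + (d + d)) - (h (x + d) + h (x + d)) + h x.

Let D2 := second_difference v2.

(** Two mean value theorems give D2 d x = d^2 w(c') for some c' between x and x + 2 d, and w is
    nondecreasing. *)
Let D2_bounds d x : 0 < d ->
  d ^+ 2 * w x <= D2 d x /\ D2 d x <= d ^+ 2 * w (x + (d + d)).
Proof.
move=> d0.
have is_derive_shift (h : R -> R) (h1 : R) y : is_derive (y + d) 1 h h1 ->
    is_derive y 1 (fun z => h (z + d)) h1.
  move=> dh; have H : is_derive y 1 (fun z : R => z + d) (1 + 0).
    exact: (@is_deriveD R R^o R^o id (cst d) y 1 _ _ (is_derive_id _ _) (is_derive_cst _ _ _)).
  by have := @is_derive1_comp R h _ y _ _ dh H; rewrite addr0 mulr1.
have dG y : is_derive y 1 (fun z => v2 (z + d) - v2 z) (v1 (y + d) - v1 y).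
  by apply: (@is_deriveB R R^o R^o); [exact: is_derive_shift|exact: dv2].
have xd : x < x + d by rewrite ltrDl.
have [c] := MVT xd (fun y _ => dG y)
  (continuous_subspaceT (fun y => is_derive_continuous (dG y))).
rewrite in_itv/= => /andP[xc cd] E.
have cd' : c < c + d by rewrite ltrDl.
have [c'] := MVT cd' (fun y _ => dv1 y)
  (continuous_subspaceT (fun y => is_derive_continuous (dv1 y))).
rewrite in_itv/= => /andP[cc' cd''] E'.
have -> : D2 d x = d ^+ 2 * w c'.
  transitivity ((v2 (x + d + d) - v2 (x + d)) - (v2 (x + d) - v2 x)).
    by rewrite /D2 /second_difference addrA; ring.
  by rewrite E E'; ring.
by split; apply: ler_wpM2l; rewrite ?sqr_ge0//; apply: zscale_nondecreasing; lra.
Qed.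

(** A relation carrying nonnegativity and a finite value, so that pairings with K can be added up
    term by term; negative terms are moved to the other side in [kernel_integral_le]. *)
Definition kernel_integral (h : R -> R) (v : R) : Prop :=
  causal (restr h) /\ (\int[leb]_s (restr K s * restr h s) = v%:E)%E.

Let CK : causal (restr K) := causal_levyK psiN.

Let kernel_integral_muleDr f g s : causal (restr f) -> causal (restr g) ->
  (restr K s * restr (fun s => f s + g s)%R s = restr K s * restr f s + restr K s * restr g s)%E.
Proof. by move=> cf cg; rewrite restrD ge0_muleDr//; exact: causal_ge0. Qed.

Lemma kernel_integralD h1 h2 q1 q2 : kernel_integral h1 q1 -> kernel_integral h2 q2 ->
  kernel_integral (fun s => h1 s + h2 s) (q1 + q2).
Proof.
move=> [C1 i1] [C2 i2]; split; first by rewrite restrD; exact: causal_add.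
rewrite EFinD -i1 -i2 -(integral_causalD (causal_mul CK C1) (causal_mul CK C2)).
by apply: eq_integral => s _; exact: kernel_integral_muleDr.
Qed.

Lemma kernel_integral_le g fm fp q p r : kernel_integral fm q -> kernel_integral fp p ->
  causal (restr g) -> (forall s, 0 < s -> g s + fm s = fp s) ->
  (r%:E <= \int[leb]_s (restr K s * restr g s))%E -> r + q <= p.
Proof.
move=> [Cm im] [Cp ip] Cg E Hr.
rewrite -lee_fin EFinD; apply: le_trans (leeD2r _ Hr) _.
rewrite -im -ip -(integral_causalD (causal_mul CK Cg) (causal_mul CK Cm)).
rewrite le_eqVlt; apply/orP; left; apply/eqP; apply: eq_integral => s _.
rewrite -kernel_integral_muleDr//; have [s0|s0] := leP s 0; first by rewrite (causal_le0 CK s0) !mul0e.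
by rewrite !(restrE _ s0) E.
Qed.

Lemma kernel_integralZ a h v : 0 <= a -> kernel_integral h v ->
  kernel_integral (fun s => a * h s) (a * v).
Proof.
move=> a0 [C i]; split; first by rewrite restrZ; exact: causal_scale.
rewrite EFinM -i -(integral_causalZ a0 (causal_mul CK C)).
by apply: eq_integral => s _; rewrite restrZ muleCA.
Qed.

Lemma kernel_integral_shift x d : 0 <= d -> 0 < x ->
  kernel_integral (fun s => w (x + d - s)) (x + d).
Proof.
move=> d0 x0; split.
- apply: causal_restr => [|s _]; last exact: zscale_ge0.
  apply: measurable_funTS; apply: measurableT_comp.
    by apply: continuous_measurable_fun; exact: zscale_continuous.
  exact: measurable_reflection.
- rewrite -(integral_shifted_scale d0 x0); apply: eq_integral => s _.
  by rewrite /restr; case: ifP => _ //; rewrite !mul0e.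
Qed.

Lemma kernel_integral_exp C : 0 <= C ->
  kernel_integral (fun s => C * expR (- (1 * s))) (C * fine (laplace 1 (restr K))).
Proof.
move=> C0; apply: kernel_integralZ => //; split.
  apply: causal_restr => [|s _]; last exact: expR_ge0.
  by apply: measurable_funTS; have /measurable_EFinP := @measurable_exp R 1.
rewrite fineK; last first.
  by rewrite ge0_fin_numE; [exact: (laplace_levyK_lty psiN ltr01)|exact: (laplace_ge0 1 CK)].
apply: eq_integral => s _; rewrite muleC.
have [s0|s0] := leP s 0; first by rewrite (causal_le0 CK s0) !mule0.
by rewrite (restrE _ s0).
Qed.

Section contradiction.
Variables (a b e c d : R).
Hypotheses (a0 : 0 <= a) (b0 : 0 <= b) (e0 : 0 < e) (c0 : 0 <= c) (d0 : 0 < d).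

(** Pairing K with s -> w(x0 + p - s) gives x0 + p, so both second differences contribute 0 and only
    the last term survives: the factor e > 0 is there to make the total - e x0, strictly
    negative. *)
Definition difference_gap (h : R -> R) y :=
  a * second_difference h d (y + c) - b * second_difference h d y - e * h y.

Local Notation Op := difference_gap.

Lemma difference_gap_is_derive (h h1 : R -> R) : (forall y, is_derive y 1 h (h1 y)) ->
  forall y, is_derive y 1 (Op h) (Op h1 y).
Proof.
move=> dh y.
have sh p z : is_derive z 1 (fun z => h (z + p)) (h1 (z + p)).
  have H : is_derive z 1 (fun z : R => z + p) (1 + 0).
    exact: (@is_deriveD R R^o R^o id (cst p) z 1 _ _ (is_derive_id _ _) (is_derive_cst _ _ _)).
  by have := @is_derive1_comp R h _ z _ _ (dh _) H; rewrite addr0 mulr1.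
have sd p z : is_derive z 1 (fun z => second_difference h d (z + p))
    (second_difference h1 d (z + p)).
  have H1 := sh (p + (d + d)) z; have H2 := sh (p + d) z; have H3 := sh p z.
  have H22 := @is_deriveD R R^o R^o _ _ z 1 _ _ H2 H2.
  have H12 := @is_deriveB R R^o R^o _ _ z 1 _ _ H1 H22.
  have H := @is_deriveD R R^o R^o _ _ z 1 _ _ H12 H3.
  rewrite (_ : (fun _ => _) = (fun z => h (z + (p + (d + d)))) - ((fun z => h (z + (p + d))) + (fun z => h (z + (p + d)))) + (fun z => h (z + p))).
    by move: H; congr is_derive; rewrite /second_difference !addrA.
  by apply/funext => t; rewrite /second_difference !fctE !addrA.
have sd0 : is_derive y 1 (second_difference h d) (second_difference h1 d y).
  have := sd 0 y; rewrite addr0 (_ : (fun z => _) = second_difference h d)//.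
  by apply/funext => z; rewrite addr0.
have S1 := @is_deriveZ R R^o R^o _ a y 1 _ (sd c y).
have S2 := @is_deriveZ R R^o R^o _ b y 1 _ sd0.
have S3 := @is_deriveZ R R^o R^o _ e y 1 _ (dh y).
have S12 := @is_deriveB R R^o R^o _ _ y 1 _ _ S1 S2.
exact: (@is_deriveB R R^o R^o _ _ y 1 _ _ S12 S3).
Qed.

(** The maximum principle makes the pairing of K with the second derivative of [Op v2] nonnegative,
    whereas the renewal equation makes it - e x0. *)
Lemma no_interior_minimum x0 : 0 < x0 -> (forall y, y <= x0 -> Op v2 x0 <= Op v2 y) ->
  is_derive x0 1 (Op v2) 0 -> False.
Proof.
move=> x00 fmin crit.
have df := difference_gap_is_derive dv2; have df1 := difference_gap_is_derive dv1.
have f1x0 : Op v1 x0 = 0.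
  by have [_ <-] := df x0; have [_ ->] := crit.
have zz (h : R -> R) : (forall x, x <= 0 -> h x = 0) ->
    forall x, x <= - (c + (d + d)) -> Op h x = 0.
  move=> hn x xS; have T : [/\ x + c + (d + d) <= 0, x + c + d <= 0, x + c <= 0,
      x + (d + d) <= 0 & x + d <= 0 /\ x <= 0].
    by move: (d0) (c0) xS => d0' c0' xS; do ?split; lra.
  by case: T => ? ? ? ? [? ?]; rewrite /difference_gap /second_difference !hn//; ring.
have S0 : 0 <= c + (d + d) + x0.
  by rewrite !addr_ge0// ltW.
have cOp : continuous (Op w).
  have cs p z : (fun z => w (z + p)) @ z --> w (z + p).
    apply: (@continuous_comp _ _ _ (fun z => z + p) w); last exact: zscale_continuous.
    by apply: cvgD; [exact: cvg_id|exact: cvg_cst].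
  have csd p z : (fun z => second_difference w d (z + p)) @ z --> second_difference w d (z + p).
    apply: cvgD; last exact: cs.
    apply: cvgB; last apply: cvgD.
    - have := cs (p + (d + d)) z; under eq_fun do rewrite addrA.
      by rewrite addrA.
    - by have := cs (p + d) z; under eq_fun do rewrite addrA; rewrite addrA.
    - by have := cs (p + d) z; under eq_fun do rewrite addrA; rewrite addrA.
  move=> z; apply: cvgB.
    apply: cvgB; first by apply: cvgM; [exact: cvg_cst|exact: csd].
    apply: cvgM; first exact: cvg_cst.
    by have := csd 0 z; under eq_fun do rewrite addr0; rewrite addr0.
  by apply: cvgM; [exact: cvg_cst|exact: zscale_continuous].
have [C C0 [g0 HC]] := kernel_second_derivative_ge0 psiN df df1 cOp S0
  (zz _ v1_le0) (zz _ w_le0) f1x0 fmin.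
have kexp := kernel_integral_exp C0.
(* [k2] collects the positive terms of [Op w] and [k3] the negative ones; their values differ by e
   x0 exactly. *)
have k2 := kernel_integralD (kernel_integralZ a0 (kernel_integralD
  (kernel_integral_shift (addr_ge0 c0 (addr_ge0 (ltW d0) (ltW d0))) x00)
  (kernel_integral_shift c0 x00))) (kernel_integralZ b0 (kernel_integralD
  (kernel_integral_shift (ltW d0) x00) (kernel_integral_shift (ltW d0) x00))).
have k3 := kernel_integralD (kernel_integralZ a0 (kernel_integralD
  (kernel_integral_shift (addr_ge0 c0 (ltW d0)) x00)
  (kernel_integral_shift (addr_ge0 c0 (ltW d0)) x00))) (kernel_integralD (kernel_integralZ b0 (kernel_integralD
  (kernel_integral_shift (addr_ge0 (ltW d0) (ltW d0)) x00) (kernel_integral_shift (lexx 0) x00)))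
  (kernel_integralZ (ltW e0) (kernel_integral_shift (lexx 0) x00))).
have mg : measurable_fun setT ((fun s => Op w (x0 - s) + C * expR (- (1 * s))) : RM -> R).
  apply: measurable_funD.
    apply: measurableT_comp; first exact: continuous_measurable_fun.
    exact: measurable_reflection.
  by apply: measurable_funM => //; have /measurable_EFinP := @measurable_exp R 1.
have Lf : laplace 1 (restr K) = (fine (laplace 1 (restr K)))%:E.
  rewrite fineK// ge0_fin_numE; last exact: (laplace_ge0 1 (causal_levyK psiN)).
  exact: (laplace_levyK_lty psiN ltr01).
rewrite Lf -EFinM in HC.
have Cg : causal (restr (fun s => Op w (x0 - s) + C * expR (- (1 * s)))).
  by apply: causal_restr => [|s s0]; [exact: measurable_funTS|apply: g0; exact: ltW].
have := kernel_integral_le k3 (kernel_integralD k2 kexp) Cg _ HC.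
have ex0 : 0 < e * x0 by rewrite mulr_gt0.
move=> H; refine ((_ : _ -> False) (H _)); first by rewrite !addr0 => {}H; lra.
move=> s s0; rewrite /difference_gap /second_difference.
have -> : x0 - s + c + (d + d) = x0 + (c + (d + d)) - s by ring.
have -> : x0 - s + c + d = x0 + (c + d) - s by ring.
have -> : x0 - s + c = x0 + c - s by ring.
have -> : x0 - s + (d + d) = x0 + (d + d) - s by ring.
have -> : x0 - s + d = x0 + d - s by ring.
by rewrite !addr0; ring.
Qed.
End contradiction.

Lemma scale_log_concave x c T : 0 < x -> x < T -> 0 < c ->
  W (T + c) * W x <= W T * W (x + c).
Proof.
move=> x0 xT c0; have T0 := lt_trans x0 xT.
rewrite leNgt; apply/negP => H.
rewrite -!zscaleE ?addr_gt0// in H.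
(* With these weights a w(. + c) - b w vanishes at T and equals - y < 0 at x, so the scaled second
   differences dip between 0 and T. *)
pose a := w T; pose b := w (T + c); pose y := b * w x - a * w (x + c).
have y0 : 0 < y by rewrite subr_gt0.
have a0 : 0 <= a by exact: zscale_ge0.
have b0 : 0 <= b by exact: zscale_ge0.
(* Tolerance for w: errors a e + b e use up at most a quarter of the violation y. *)
pose e := y / (4 * (a + b + 1)).
have ab0 : 0 < a + b + 1 by rewrite ltr_wpDl// addr_ge0.
have e0 : 0 < e by rewrite divr_gt0// mulr_gt0.
have abe : a * e + b * e <= y / 4.
  have -> : y / 4 = e * (a + b + 1) by rewrite /e; field; rewrite !gt_eqF// mulr_gt0.
  by have := ltW e0; nra.
(* Size of the tilt, in units of d^2: at T it costs at most another quarter of y. *)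
pose n := y / (4 * (v2 T + 1)).
have vT0 := v2_ge0 T.
have v0 : 0 < v2 T + 1 by rewrite ltr_wpDl.
have n0 : 0 < n by rewrite divr_gt0// mulr_gt0.
have nv : n * v2 T <= y / 4.
  have -> : y / 4 = n * (v2 T + 1) by rewrite /n; field; rewrite !gt_eqF// mulr_gt0.
  by have := ltW n0; nra.
have nearw p : \forall d \near (0 : R)^'+, w (p + (d + d)) < w p + e.
  have C : w (p + (d + d)) @[d --> (0 : R)^'+] --> w p.
    apply: cvg_at_right_filter; rewrite -{2}(addr0 p) -{2}(addr0 0).
    apply: (@continuous_comp _ _ _ (fun d => p + (d + d)) w); last exact: zscale_continuous.
    by apply: cvgD; [exact: cvg_cst|apply: cvgD; exact: cvg_id].
  by apply: (cvgr_lt _ C); rewrite ltrDl.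
(* Upper bounds for [D2] evaluate w at distance 2 d to the right. They are needed at x + c, at T and
   on ]-oo, 0], where 0 is the worst case by monotonicity. *)
have [d [d0 [dx d00 dT]]] : exists d, 0 < d /\
    [/\ w (x + c + (d + d)) < w (x + c) + e, w (0 + (d + d)) < w 0 + e &
       w (T + (d + d)) < w T + e].
  near (0 : R)^'+ => d; exists d; split; first by near: d; exact: nbhs_right_gt.
  by split; near: d; exact: nearw.
rewrite add0r (zscale0 (lexx 0)) add0r in d00.
have dd0 : 0 < d ^+ 2 by rewrite exprn_gt0.
have dn0 : 0 < d ^+ 2 * n by rewrite mulr_gt0.
pose f := difference_gap a b (d ^+ 2 * n) c d v2.
have fx : f x <= d ^+ 2 * (a * e - y).
  have [_ U] := D2_bounds (x + c) d0; have [L _] := D2_bounds x d0.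
  have := v2_ge0 x; rewrite /f /difference_gap /=.
  have := ler_wpM2l a0 U; have := ler_wpM2l b0 L; have := ler_wpM2l a0 (ltW dx).
  rewrite -/D2 /y; set p1 := D2 _ _; set p2 := D2 _ _ => H1 H2 H3 H4.
  have := mulr_ge0 (ltW dn0) H4.
  have := ler_wpM2l (ltW dd0) H1.
  nra.
have fneg z : z <= 0 -> - (d ^+ 2 * (b * e)) <= f z.
  move=> z0; have [L _] := D2_bounds (z + c) d0; have [_ U] := D2_bounds z d0.
  rewrite /f /difference_gap (v2_le0 z0) mulr0 subr0.
  have wz : w (z + (d + d)) <= e.
    by apply: le_trans (ltW d00); apply: zscale_nondecreasing; lra.
  have := mulr_ge0 a0 (mulr_ge0 (ltW dd0) (zscale_ge0 (z + c))).
  have := ler_wpM2l a0 L; have := ler_wpM2l b0 U.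
  have := ler_wpM2l b0 (ler_wpM2l (ltW dd0) wz).
  rewrite -/D2; nra.
have fT : - (d ^+ 2 * (b * e + n * v2 T)) <= f T.
  have [L _] := D2_bounds (T + c) d0; have [_ U] := D2_bounds T d0.
  rewrite /f /difference_gap.
  have := ler_wpM2l a0 L; have := ler_wpM2l b0 U.
  have := ler_wpM2l b0 (ler_wpM2l (ltW dd0) (ltW dT)).
  rewrite -/D2 -/a -/b; nra.
(* The errors total at most y / 2 < y, so f is smaller at x than at T and on ]-oo, 0]. *)
have gap : d ^+ 2 * (a * e - y) < - (d ^+ 2 * (b * e + n * v2 T)).
  by rewrite -mulrN ltr_pM2l//; lra.
have fxT : f x < f T by apply: le_lt_trans fx (lt_le_trans gap fT).
have fxn z : z <= 0 -> f x < f z.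
  move=> z0; apply: le_lt_trans fx (lt_le_trans (lt_le_trans gap _) (fneg _ z0)).
  by rewrite lerN2 ler_wpM2l ?(ltW dd0)// lerDl mulr_ge0 ?(ltW n0).
have cv2 : continuous v2 by move=> z; exact: is_derive_continuous (dv2 z).
have df z : derivable f z 1.
  by have [] := difference_gap_is_derive a b (d ^+ 2 * n) c d dv2 z.
have cf : continuous f by move=> z; apply: differentiable_continuous; apply/derivable1_diffP.
have T0' : (0 : R) <= T by exact: ltW.
have [z] := @EVT_min R f 0 T T0' (continuous_subspaceT cf).
rewrite in_itv/= => /andP[z0 zT] fz.
have fzx : f z <= f x by apply: fz; rewrite in_itv/= !ltW.
have {}z0 : 0 < z.
  rewrite lt_neqAle z0 andbT; apply/eqP => z00.
  by have := fxn _ (lexx 0); rewrite z00 ltNge fzx.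
have {}zT : z < T.
  rewrite lt_neqAle zT andbT; apply/eqP => zT'.
  by move: fxT; rewrite -zT' ltNge fzx.
apply: (@no_interior_minimum a b (d ^+ 2 * n) c d a0 b0 dn0 (ltW c0) d0 z z0).
  (* Since K looks at the whole past of z, minimality over [0, T] has to be extended to ]-oo, z]. *)
  move=> t tz; have [t0|t0] := leP t 0; first by apply: le_trans fzx _; exact/ltW/fxn.
  by apply: fz; rewrite in_itv/= (ltW t0)/= (le_trans tz)// ltW.
apply: (derive1_at_min (ltW T0)) => [t _||t]; first exact: df.
  by rewrite in_itv/= z0.
by rewrite in_itv/= => /andP[t0 tT]; apply: fz; rewrite in_itv/= !ltW.
Unshelve. all: by end_near. Qed.

(** The right derivative at c = 0 of the inequality in [scale_log_concave], which is an equality at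
    c = 0. *)
Lemma scale_derive_ratio x T : 0 < x -> x < T -> W1 T * W x <= W1 x * W T.
Proof.
move=> x0 xT; have T0 := lt_trans x0 xT.
pose p h := W T * W (x + h) - W x * W (T + h).
have shW y : 0 < y -> is_derive (0 : R) 1 (fun h => W (y + h)) (W1 y).
  move=> y0; have H : is_derive (0 : R) 1 (fun h : R => y + h) (0 + 1).
    exact: (@is_deriveD R R^o R^o (cst y) id 0 1 _ _ (is_derive_cst _ _ _) (is_derive_id _ _)).
  have dW : is_derive (y + 0) 1 W (W1 y) by rewrite addr0; exact: (scale_is_derive WS y0).
  by have := @is_derive1_comp R W (fun h => y + h) 0 _ _ dW H; rewrite add0r mulr1.
have P1 := @is_deriveZ R R^o R^o _ (W T) 0 1 _ (shW _ x0).
have P2 := @is_deriveZ R R^o R^o _ (W x) 0 1 _ (shW _ T0).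
have [dp Ep] : is_derive (0 : R) 1 p (W T * W1 x - W x * W1 T).
  exact: (@is_deriveB R R^o R^o _ _ 0 1 _ _ P1 P2).
have C : h^-1 *: (p (h *: 1 + 0) - p 0) @[h --> (0 : R)^'] --> W T * W1 x - W x * W1 T.
  by rewrite -Ep; exact: dp.
have {}C := cvg_dnbhs_at_right C.
rewrite leNgt; apply/negP => H.
have N : W T * W1 x - W x * W1 T < 0.
  by rewrite subr_lt0 mulrC [ltRHS]mulrC.
have : \forall h \near (0 : R)^'+, False.
  near=> h; have h0 : 0 < h by near: h; exact: nbhs_right_gt.
  have : h^-1 *: (p (h *: 1 + 0) - p 0) < 0 by near: h; exact: (cvgr_lt _ C).
  rewrite addr0 /GRing.scale/= mulr1 /p !addr0 (mulrC (W x) (W T)) subrr subr0.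
  rewrite pmulr_rlt0 ?invr_gt0// ltNge subr_ge0 => /negP; apply.
  by rewrite mulrC; exact: scale_log_concave.
by move=> /filter_ex[].
Unshelve. all: by end_near. Qed.
End scale.
End LogConcavity.

(** * Size of W and divergence of W' at 0 when sigma = 0 *)

Section Blowup.
Context {R : realType}.
Local Notation leb := (@lebesgue_measure R).
Local Notation RM := (measurableTypeR R).
Implicit Types (x y z s t d M : R) (f : R -> R).

Section scale.
Variables (m : R) (Pi : {measure set RM -> \bar R}) (psi W : R -> R).
Hypotheses (psiN : in_N 0 m Pi psi) (WS : scale_function psi W).
Local Notation K := (levyK m Pi).
Local Notation W1 := (derive1 W).

(** K * W takes the value y at y, and W <= W y on ]0, y[. *)
Lemma scale_lower y : 0 < y -> y <= W y * prim K y.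
Proof.
move=> y0; have cK := cl1_levyK psiN; have CK := cl1_causal cK.
have CW := causal_scale_function WS.
have W0 : 0 <= W y by apply: (scale_ge0 WS); exact: ltW.
rewrite -lee_fin EFinM (prim_cutoff _ cK) -(convol_scale_kernel psiN WS y0).
apply: convol_le_cst => // x x0 xy; apply: (scale_nondecreasing WS) => //; exact: ltW.
Qed.

(** K * W takes the value 2 y at 2 y, and W >= W y on ]y, 2 y[. *)
Lemma scale_upper y : 0 < y -> W y * prim K y <= 2 * y.
Proof.
move=> y0; have cK := cl1_levyK psiN; have CK := cl1_causal cK.
have CW := causal_scale_function WS.
have W0 : 0 <= W y by apply: (scale_ge0 WS); exact: ltW.
have y20 : 0 < 2 * y by rewrite mulr_gt0.
rewrite -lee_fin EFinM (prim_cutoff _ cK) -(convol_scale_kernel psiN WS y20).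
apply: convol_ge_cst => //; first lra.
by move=> x yx _; apply: (scale_nondecreasing WS) => //; lra.
Qed.

Lemma scale_gt0 y : 0 < y -> 0 < W y.
Proof.
move=> y0; have := scale_lower y0; have := prim_ge0 y (cl1_levyK psiN).
have : 0 <= W y by apply: (scale_ge0 WS); exact: ltW.
by rewrite le_eqVlt => /orP[/eqP <- _|//]; rewrite mul0r => /(lt_le_trans y0); rewrite ltxx.
Qed.

(** The hypothesis 4 M t < W t says 2 t < r for r = W t / (2 M). The renewal equation is evaluated
    at r, where W' <= 2 M on [t, r]. *)
Lemma scale_derive_small_contra M t : 0 < M -> 0 < t -> W1 t <= M ->
  4 * M * t < W t -> 1 <= 6 * M * prim K (W t / (2 * M)).
Proof.
move=> M0 t0 Wt tW; have cK := cl1_levyK psiN; have CK := cl1_causal cK.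
have cW := cl1_scale_derive WS; have CW := cl1_causal cW.
have Wt0 := scale_gt0 t0.
pose r := W t / (2 * M); have M20 : 0 < 2 * M by rewrite mulr_gt0.
have r0 : 0 < r by rewrite divr_gt0.
have rW : W t = 2 * M * r by rewrite /r; field; rewrite gt_eqF.
have tr : 2 * t < r by rewrite rW in tW; nra.
have ratio z : t <= z -> W1 z * W t <= M * W z.
  move=> tz; have z0 := lt_le_trans t0 tz; have Wz := ltW (scale_gt0 z0).
  apply: (@le_trans _ _ (W1 t * W z)); last exact: ler_wpM2r.
  move: tz; rewrite le_eqVlt => /orP[/eqP <-//|tz].
  exact: (scale_derive_ratio psiN WS).
(* The slope on [t, z] is at most M W z / W t and the length at most r, so W z - W t <= W z / 2. *)
have W2 z : t <= z -> z <= r -> W z <= 2 * W t.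
  rewrite le_eqVlt => /orP[/eqP <- _|tz zr]; first lra.
  have z0 := lt_trans t0 tz.
  have [||c] := @MVT R W W1 t z tz.
  - by move=> x; rewrite in_itv/= => /andP[tx _]; exact: scale_is_derive WS _ (lt_trans t0 tx).
  - apply: continuous_in_subspaceT => x; rewrite inE/= in_itv/= => /andP[tx _].
    exact: (scale_function_continuous WS (lt_le_trans t0 tx)).
  rewrite in_itv/= => /andP[tc cz] E.
  have := ratio _ (ltW tc); have Wcz := scale_nondecreasing WS (lt_trans t0 tc) (ltW cz).
  have Wz0 := scale_gt0 z0; have W1c := scale_derive_gt0 WS (lt_trans t0 tc).
  move=> H1.
  have H2 : W1 c * W t <= M * W z by apply: le_trans H1 _; rewrite ler_pM2l.
  have H3 : (W z - W t) * W t <= M * W z * (z - t).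
    by rewrite E mulrAC; apply: ler_wpM2r => //; rewrite subr_ge0 ltW.
  have H4 : M * W z * (z - t) <= M * W z * r.
    by apply: ler_wpM2l; [rewrite mulr_ge0// ltW|lra].
  have H5 : (W z - W t) * (2 * M * r) <= M * W z * r by rewrite -rW; exact: le_trans H3 H4.
  have H6 : (2 * (W z - W t)) * (M * r) <= W z * (M * r) by move: H5; lra.
  have H7 : 2 * (W z - W t) <= W z by rewrite -(ler_pM2r (mulr_gt0 M0 r0)).
  by move: H7; clear; set p := W z; set q := W t => H7; lra.
have W12 z : t <= z -> z <= r -> W1 z <= 2 * M.
  move=> tz zr; have := ratio _ tz; have := W2 _ tz zr => H1 H2.
  rewrite -(ler_pM2r Wt0); apply: le_trans H2 _.
  by rewrite [2 * M]mulrC -mulrA ler_pM2l.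
have c2M : cl1 (fun x => 2 * M * K x) by apply: cl1Z cK; exact: ltW.
have r2 : 0 < r / 2 by rewrite divr_gt0.
have Kr0 : 0 <= K (r / 2) := levyK_ge0 psiN _.
have E : rconv W1 K r = 1.
  by rewrite -(renewal psiN WS r0) expr0n/= mul0r add0r.
have : (convol (restr K) (restr W1) r <=
   (2 * M)%:E * \int[leb]_s cutoff r (restr K) s + (K (r / 2))%:E * \int[leb]_s cutoff t (restr W1) s)%E.
  apply: (convol_le_split CK CW (ltW M20) Kr0) => p s p0 s0 ps; rewrite !restrE// !lee_fin.
  (* Either W' is evaluated beyond t, where it is at most 2 M, or s < t and the argument of K
     exceeds r - t > r / 2. *)
  have [st|ts] := ltP s t; last by left; apply: W12 => //; lra.
  by right; split => //; apply: (levyK_nonincreasing psiN) => //; lra.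
rewrite -(prim_cutoff _ cK) -(prim_cutoff _ cW) -(scale_prim psiN WS t0).
rewrite (convolC CK CW) -(restr_rconv cW cK) (restrE _ r0) E -!EFinM -EFinD lee_fin => H.
have H2 := prim_ge_nonincreasing cK (levyK_nonincreasing psiN) r2.
have H3 : prim K (r / 2) <= prim K r by apply: prim_nondecreasing => //; lra.
(* Monotonicity of K gives (r / 2) K(r / 2) <= prim K r; this 4 and the 2 from the bound on W' make
   up the 6. *)
have H4 : K (r / 2) * W t <= 4 * M * prim K r.
  have -> : K (r / 2) * W t = 4 * M * (r / 2 * K (r / 2)) by rewrite rW; field.
  by apply: ler_wpM2l; [rewrite mulr_ge0// ltW|exact: le_trans H2 H3].
by rewrite -/r; lra.
Qed.

Lemma scale_derive_blowup M : \forall t \near (0 : R)^'+, M < W1 t.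
Proof.
have cK := cl1_levyK psiN; pose N := `|M| + 1.
have N0 : 0 < N by rewrite ltr_wpDl.
have MN : M <= N by rewrite (le_trans (ler_norm _))// lerDl.
have P0 := prim_cvg0 cK.
have [e /= e0 He] : \forall x \near (0 : R)^'+, prim K x < (6 * N)^-1.
  by apply: (cvgr_lt _ P0); rewrite invr_gt0 mulr_gt0.
near=> t; have t0 : 0 < t by near: t; exact: nbhs_right_gt.
rewrite ltNge; apply/negP => WM.
(* [scale_lower] gives W t >= t / prim K t, and prim K t tends to 0. *)
have tW : 4 * N * t < W t.
  have H1 := scale_lower t0; have Wt0 := scale_gt0 t0.
  have H2 : prim K t < (4 * N)^-1.
    by near: t; apply: (cvgr_lt _ P0); rewrite invr_gt0 mulr_gt0.
  have N40 : 0 < 4 * N by rewrite mulr_gt0.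
  rewrite -ltr_pdivlMl//; apply: le_lt_trans H1 _.
  by rewrite mulrC ltr_pM2r.
have := scale_derive_small_contra N0 t0 (le_trans WM MN) tW.
have Wt0 := scale_gt0 t0.
have r0 : 0 < W t / (2 * N) by rewrite divr_gt0// mulr_gt0.
have re : W t / (2 * N) < e.
  rewrite ltr_pdivrMr ?mulr_gt0//; near: t.
  by apply: (cvgr_lt _ (scale_cvg0 psiN WS)); rewrite !mulr_gt0.
have := He (W t / (2 * N)); rewrite /ball_ /= sub0r normrN gtr0_norm// => /(_ re r0) H1 H2.
have N60 : 0 < 6 * N by rewrite mulr_gt0.
by move: H2; rewrite leNgt -[ltRHS](mulfV (lt0r_neq0 N60)) ltr_pM2l// H1.
Unshelve. all: by end_near. Qed.

End scale.
End Blowup.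

(** * Resolvent of the kernel with a Gaussian part *)

Section Resolvent.
Context {R : realType}.
Local Notation leb := (@lebesgue_measure R).
Local Notation RM := (measurableTypeR R).
Implicit Types (x y z s t d : R) (f g h : R -> R).

Lemma rconvE f g y : cl1 f -> cl1 g -> 0 < y ->
  (rconv f g y)%:E = convol (restr f) (restr g) y.
Proof. by move=> cf cg y0; rewrite fineK// convol_cl1_fin_num. Qed.

Lemma rconvDr f g h y : cl1 f -> cl1 g -> cl1 h -> 0 < y ->
  rconv f (fun x => g x + h x) y = rconv f g y + rconv f h y.
Proof.
move=> cf cg ch y0; apply: EFin_inj; rewrite (rconvE cf (cl1D cg ch) y0) restrD.
rewrite (convolDr (cl1_causal cf) (cl1_causal cg) (cl1_causal ch)).
by rewrite [RHS]EFinD (rconvE cf cg y0) (rconvE cf ch y0).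
Qed.

Lemma eq_restr f g : (forall x, 0 < x -> f x = g x) -> restr f = restr g.
Proof. by move=> fg; apply/funext => x; rewrite /restr; case: ifPn => // /fg ->. Qed.

Lemma integral_rconv f g : cl1 f -> cl1 g ->
  (\int[leb]_x restr (rconv f g) x = \int[leb]_x restr f x * \int[leb]_x restr g x)%E.
Proof.
move=> cf cg; have L h : (\int[leb]_x restr h x = laplace 0 (restr h))%E.
  by apply: eq_integral => x _; rewrite mul0r oppr0 expR0 mul1e.
rewrite !L (restr_rconv cf cg); exact: laplace_convol (cl1_causal cf) (cl1_causal cg).
Qed.

Section monotone_limit.
Variables (P : nat -> R -> R) (C : R).
Hypotheses (cP : forall n, cl1 (P n))
  (Pnd : forall n x, 0 < x -> P n x <= P n.+1 x)
  (Pstep : forall n x, 0 < x -> x * (P n.+1 x - P n x) <= 2^-1 ^+ n.+1)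
  (Pint : forall n, (\int[leb]_x restr (P n) x <= C%:E)%E).

Let Pmono x : 0 < x -> nondecreasing_seq (P ^~ x).
Proof. by move=> x0; apply/nondecreasing_seqP => n; exact: Pnd. Qed.

Let Pincr N n x : 0 < x -> x * P (N + n)%N x <= x * P N x + 2^-1 ^+ N - 2^-1 ^+ (N + n).
Proof.
move=> x0; elim: n => [|n IH]; first by rewrite addn0; lra.
have := Pstep (N + n) x0; rewrite addnS exprS; lra.
Qed.

(** The remainder of the limit past N is at most 2^(-N) / x: uniform away from 0, which yields
    continuity, although the functions may blow up at 0. *)
Let Pub N n x : 0 < x -> P n x <= P N x + 2^-1 ^+ N / x.
Proof.
move=> x0; have p0 k : 0 <= 2^-1 ^+ k :> R by rewrite exprn_ge0.
have [nN|Nn] := leqP n N.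
  by apply: le_trans (Pmono x0 nN) _; rewrite lerDl divr_ge0// ltW.
have := Pincr N (n - N) x0; rewrite subnKC ?(ltnW Nn)// => H.
rewrite -(ler_pM2l x0) mulrDr [x * (_ / _)]mulrC divfK ?gt_eqF//.
by have := p0 n; lra.
Qed.

Definition limfun x := limn (P ^~ x).

Lemma limfun_cvg x : 0 < x -> P n x @[n --> \oo] --> limfun x.
Proof.
move=> x0; apply: nondecreasing_is_cvgn; first exact: Pmono.
by exists (P 0%N x + 2^-1 ^+ 0 / x) => _ [n _ <-]; exact: Pub.
Qed.

Let lim_ge n x : 0 < x -> P n x <= limfun x.
Proof. by move=> x0; apply: nondecreasing_cvgn_le; [exact: Pmono|exact: limfun_cvg]. Qed.

Let lim_le N x : 0 < x -> limfun x <= P N x + 2^-1 ^+ N / x.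
Proof.
move=> x0; apply: limr_le; first exact: limfun_cvg.
by apply: nearW => n; exact: Pub.
Qed.

Lemma cl1_limfun : cl1 limfun.
Proof.
have l0 x : 0 < x -> 0 <= limfun x.
  by move=> x0; apply: le_trans (lim_ge 0 x0); exact: cl1_ge0 (cP 0) _ x0.
have cl x : 0 < x -> {for x, continuous limfun}.
  move=> x0; apply/cvgrPdist_le => e e0.
  have G : 2^-1 ^+ n @[n --> \oo] --> (0 : R) by apply: cvg_expr; rewrite ger0_norm; lra.
  have [N _ /(_ N (leqnn N)) HN] : \forall n \near \oo, 2^-1 ^+ n <= (e / 4) * (x / 2).
    by apply: (cvgr_le _ G); rewrite !mulr_gt0.
  have cPN := cl1_cont (cP N) x0.
  near=> y.
  have xy : x / 2 < y by near: y; apply: lt_nbhsr; lra.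
  have y0 : 0 < y by lra.
  have HP : `|P N x - P N y| <= e / 2.
    by near: y; move/cvgrPdist_le: cPN; apply; rewrite divr_gt0.
  have T z : x / 2 < z -> P N z <= limfun z <= P N z + e / 4.
    move=> xz; have z0 : 0 < z by lra.
    rewrite lim_ge//=; apply: le_trans (lim_le N z0) _; rewrite lerD2l.
    rewrite ler_pdivrMr//; apply: (le_trans HN); rewrite ler_pM2l ?divr_gt0//; lra.
  have /T/andP[? ?] : x / 2 < x by lra.
  have /T/andP[? ?] := xy.
  by move: HP; rewrite !ler_norml => /andP[? ?]; apply/andP; split; lra.
split => // a; have Cl := pos_continuous_causal l0 cl.
apply: (@le_lt_trans _ _ C%:E); last exact: ltry.
rewrite integral_restr_itv.
apply: (@le_trans _ _ (\int[leb]_x restr limfun x)%E).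
  apply: ge0_subset_integral => //; first exact: causal_measurable.
  by move=> x _; exact: causal_ge0.
have MC := @cvg_monotone_convergence _ RM R leb setT measurableT (fun n => restr (P n)).
have E x : restr limfun x = limn (fun n => restr (P n) x).
  apply/esym/cvg_lim => //; have [x0|x0] := leP x 0.
    rewrite (causal_le0 Cl x0) (_ : (fun n => _) = fun=> 0%E); first exact: cvg_cst.
    by apply/funext => n; rewrite (causal_le0 (cl1_causal (cP n)) x0).
  rewrite (restrE _ x0) (_ : (fun n => _) = fun n => (P n x)%:E).
    by apply: cvg_EFin; [exact: nearW|exact: limfun_cvg].
  by apply/funext => n; rewrite restrE.
have -> : (\int[leb]_x restr limfun x = \int[leb]_x limn (fun n => restr (P n) x))%E.
  by apply: eq_integral => x _; exact: E.
rewrite -(cvg_lim _ (MC _ _ _))//.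
- apply: lime_le; last by apply: nearW => n; exact: Pint.
  apply/cvg_ex; eexists; apply: MC.
  + by move=> n; exact: causal_measurable (cl1_causal (cP n)).
  + by move=> n x _; exact: causal_ge0 (cl1_causal (cP n)) _.
  + move=> x _; apply/nondecreasing_seqP => n; rewrite /restr; case: ifP => // x0.
    by rewrite lee_fin Pnd.
- by move=> n; exact: causal_measurable (cl1_causal (cP n)).
- by move=> n x _; exact: causal_ge0 (cl1_causal (cP n)) _.
- move=> x _; apply/nondecreasing_seqP => n; rewrite /restr; case: ifP => // x0.
  by rewrite lee_fin Pnd.
Unshelve. all: by end_near. Qed.

Lemma rconv_limfun f y : cl1 f -> 0 < y ->
  rconv f (P n) y @[n --> \oo] --> rconv f limfun y.
Proof.
move=> cf y0; have Cf := cl1_causal cf; have cl := cl1_limfun; have Cl := cl1_causal cl.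
apply: fine_cvg; rewrite fineK ?convol_cl1_fin_num//.
have CP n := cl1_causal (cP n).
have MC := @cvg_monotone_convergence _ RM R leb setT measurableT
  (fun n r => restr f r * restr (P n) (y - r)%R)%E.
have -> : convol (restr f) (restr limfun) y =
   (\int[leb]_r limn (fun n => restr f r * restr (P n) (y - r)%R))%E.
  apply: eq_integral => r _; apply/esym/cvg_lim => //.
  have [r0|r0] := leP r 0.
    rewrite (causal_le0 Cf r0) mul0e (_ : (fun n => _) = fun=> 0%E); first exact: cvg_cst.
    by apply/funext => n; rewrite mul0e.
  have [yr|yr] := leP (y - r) 0.
    rewrite (causal_le0 Cl yr) mule0 (_ : (fun n => _) = fun=> 0%E); first exact: cvg_cst.
    by apply/funext => n; rewrite (causal_le0 (CP n) yr) mule0.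
  rewrite !restrE// (_ : (fun n => _) = fun n => (f r * P n (y - r))%:E).
    rewrite -EFinM; apply: cvg_EFin; first exact: nearW.
    by apply: cvgM; [exact: cvg_cst|exact: limfun_cvg].
  by apply/funext => n; rewrite restrE// EFinM.
apply: MC.
- by move=> n; exact: measurable_convol_integrand.
- by move=> n r _; apply: mule_ge0; [exact: causal_ge0|exact: causal_ge0 (CP n) _].
- move=> r _; apply/nondecreasing_seqP => n; apply: lee_wpmul2l; first exact: causal_ge0.
  by rewrite /restr; case: ifP => // r0; rewrite lee_fin Pnd.
Qed.

End monotone_limit.

Section series_limit.
Variable f_ : nat -> R -> R.
Hypotheses (cf_ : forall n, cl1 (f_ n))
  (bf_ : forall n x, 0 < x -> x * f_ n x <= 2^-1 ^+ n.+1)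
  (if_ : forall n, (\int[leb]_x restr (f_ n) x <= (2^-1 ^+ n.+1)%:E)%E).

Definition psum n y := \sum_(k < n) f_ k y.

Lemma psumS n : psum n.+1 = fun y => psum n y + f_ n y.
Proof. by apply/funext => y; rewrite /psum big_ord_recr. Qed.

Lemma cl1_psum n : cl1 (psum n).
Proof.
elim: n => [|n IH]; last by rewrite psumS; exact: cl1D.
rewrite (_ : psum 0 = fun=> 0); first exact: cl1_cst.
by apply/funext => y; rewrite /psum big_ord0.
Qed.

Lemma psum_nondecreasing n x : 0 < x -> psum n x <= psum n.+1 x.
Proof. by move=> x0; rewrite psumS lerDl; exact: cl1_ge0 (cf_ n) _ x0. Qed.

Lemma psum_step n x : 0 < x -> x * (psum n.+1 x - psum n x) <= 2^-1 ^+ n.+1.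
Proof. by move=> x0; rewrite psumS addrC addKr; exact: bf_. Qed.

Lemma psum_integral n : (\int[leb]_x restr (psum n) x <= 1%:E)%E.
Proof.
suff H : (\int[leb]_x restr (psum n) x <= (1 - 2^-1 ^+ n)%:E)%E.
  by apply: le_trans H _; rewrite lee_fin gerBl exprn_ge0.
elim: n => [|n IH].
  rewrite expr0 subrr integral0_eq// => x _.
  by rewrite /restr /psum big_ord0; case: ifP.
rewrite psumS restrD.
have Cf := cl1_causal (cf_ n); have Cp := cl1_causal (cl1_psum n).
rewrite (integral_causalD Cp Cf).
apply: le_trans (leeD IH (if_ n)) _; rewrite -EFinD lee_fin exprS; lra.
Qed.

End series_limit.

Lemma half_pow_bound n : n.+1%:R * 4^-1 ^+ n.+1 <= 2^-1 ^+ n.+1 :> R.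
Proof.
have -> : 4^-1 = 2^-1 * 2^-1 :> R by field.
rewrite exprMn mulrA ger_pMl ?exprn_gt0//.
rewrite exprVn ler_pdivrMr ?exprn_gt0// mul1r -natrX ler_nat.
exact: ltnW (ltn_expl _ _).
Qed.

Section small_resolvent.
Variable f : R -> R.
Hypotheses (cf : cl1 f) (nif : forall x y, 0 < x -> x <= y -> f y <= f x)
  (intf : (\int[leb]_x restr f x <= (4^-1)%:E)%E).

(** Convolution powers with index shifted by one: [rpow n] has n + 1 factors. *)
Fixpoint rpow n : R -> R := if n is n'.+1 then rconv f (rpow n') else f.

Let crpow n : cl1 (rpow n).
Proof. by elim: n => //= n IH; exact: cl1_rconv. Qed.

Let rpow_integral n : (\int[leb]_x restr (rpow n) x <= (4^-1 ^+ n.+1)%:E)%E.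
Proof.
elim: n => [|n IH]; first by rewrite expr1.
rewrite /= integral_rconv// exprS EFinM; apply: lee_pmul => //.
- by apply: integral_ge0 => x _; exact: causal_ge0 (cl1_causal cf) _.
- by apply: integral_ge0 => x _; exact: causal_ge0 (cl1_causal (crpow n)) _.
Qed.

(** Multiplication by x acts as a derivation on convolutions, x = r + (x - r). For f itself,
    monotonicity gives z f z <= prim f z <= 1/4, and each further factor contributes its mass
    1/4. *)
Let rpow_bound n x : 0 < x -> x * rpow n x <= n.+1%:R * 4^-1 ^+ n.+1.
Proof.
have base z : 0 < z -> z * f z <= 4^-1.
  move=> z0; apply: le_trans (prim_ge_nonincreasing cf nif z0) _.
  rewrite -lee_fin (prim_cutoff _ cf); apply: le_trans intf; have Cf := cl1_causal cf.
  apply: le_integral_causal => //; first exact: causal_cutoff.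
  by move=> s _; rewrite /cutoff; case: ifP => // _; exact: (causal_ge0 Cf).
elim: n x => [|n IH] x x0; first by rewrite expr1 mul1r; exact: base.
have Cf := cl1_causal cf; have Cp := cl1_causal (crpow n).
have mp : measurable_fun setT (fun r : RM => restr (rpow n) (x - r)%R).
  exact: (measurableT_comp (causal_measurable Cp) (measurable_reflection x)).
pose q : R := n.+1%:R * 4^-1 ^+ n.+1.
have CC := causal_scale (ltW x0) (causal_convol_integrand x Cf Cp).
have q0 : 0 <= q by rewrite mulr_ge0.
rewrite -lee_fin EFinM (rconvE cf (crpow n) x0).
rewrite -(integral_causalZ (ltW x0) (causal_convol_integrand x Cf Cp)).
apply: (@le_trans _ _ (\int[leb]_r ((4^-1)%:E * restr (rpow n) (x - r)%R + q%:E * restr f r))%E).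
  apply: ge0_le_integral => //.
  - by move=> r _; exact: (causal_ge0 CC).
  - exact: (causal_measurable CC).
  - apply: emeasurable_funD; first exact: measurable_funeM.
    by apply: measurable_funeM; exact: causal_measurable.
  move=> r _; have [r0|r0] := leP r 0.
    rewrite (causal_le0 Cf r0) mul0e !mule0 adde0 mule_ge0//; exact: causal_ge0 Cp _.
  have [xr|xr] := leP (x - r) 0.
    rewrite (causal_le0 Cp xr) !mule0 add0e mule_ge0//; exact: causal_ge0 Cf _.
  rewrite !restrE// -!EFinM -EFinD lee_fin.
  have H1 := base _ r0; have H2 := IH _ xr.
  have f0 := cl1_ge0 cf r0; have p0 := cl1_ge0 (crpow n) xr.
  have := ler_wpM2r p0 H1; have := ler_wpM2l f0 H2; rewrite -/q.
  have -> : x * (f r * rpow n (x - r)) = r * f r * rpow n (x - r) + f r * ((x - r) * rpow n (x - r)).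
    by ring.
  lra.
have c4 : 0 <= 4^-1 :> R by [].
rewrite ge0_integralD//; first last.
- by apply: measurable_funeM; exact: causal_measurable.
- by move=> r _; apply: mule_ge0; [rewrite lee_fin|exact: causal_ge0].
- exact: measurable_funeM.
- by move=> r _; apply: mule_ge0; [rewrite lee_fin|exact: causal_ge0 Cp _].
rewrite ge0_integralZl_EFin//; last by move=> r _; exact: causal_ge0 Cp _.
rewrite (integral_causalZ q0 Cf).
rewrite (integral_reflection x (causal_measurable Cp) (causal_ge0 Cp)).
have H1 : ((4^-1)%:E * \int[leb]_y restr (rpow n) y <= (4^-1 * 4^-1 ^+ n.+1)%:E)%E.
  by rewrite EFinM; apply: lee_wpmul2l; [rewrite lee_fin|exact: rpow_integral].
have H2 : (q%:E * \int[leb]_r restr f r <= (q * 4^-1)%:E)%E.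
  by rewrite [leRHS]EFinM; apply: lee_wpmul2l; [rewrite lee_fin|exact: intf].
apply: le_trans (leeD H1 H2) _.
by rewrite -EFinD lee_fin /q [in leRHS]exprS -[n.+2%:R]natr1; lra.
Qed.

Let half_mono n k : (n <= k)%N -> 2^-1 ^+ k <= 2^-1 ^+ n :> R.
Proof. by move=> nk; apply: ler_wiXn2l => //; rewrite invf_le1// ler1n. Qed.

(** The alternating Neumann series split by sign: [fA] runs over the odd numbers of factors, [fB]
    over the even ones. *)
Let fA n := rpow n.*2.
Let fB n := rpow n.*2.+1.

Let double_bound (b : nat -> nat) (g := fun n => rpow (b n)) : (forall n, (n <= b n)%N) ->
  [/\ forall n, cl1 (g n), forall n x, 0 < x -> x * g n x <= 2^-1 ^+ n.+1 &
      forall n, (\int[leb]_x restr (g n) x <= (2^-1 ^+ n.+1)%:E)%E].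
Proof.
move=> bn; split => [n|n x x0|n]; first exact: crpow.
  apply: le_trans (rpow_bound _ x0) _; apply: le_trans (half_pow_bound _) _.
  by apply: half_mono; rewrite ltnS.
apply: le_trans (rpow_integral _) _; rewrite lee_fin.
apply: (@le_trans _ _ (2^-1 ^+ (b n).+1)); last by apply: half_mono; rewrite ltnS.
by apply: le_trans (half_pow_bound _); rewrite ler_peMl ?exprn_ge0// ler1n.
Qed.

(** A - B is the resolvent f - f * f + f * f * f - ...; the two relations encode its equation (A -
    B) + f * (A - B) = f without subtraction. *)
Lemma small_resolvent : exists A B, [/\ cl1 A, cl1 B,
  forall y, 0 < y -> A y = f y + rconv f B y & forall y, 0 < y -> B y = rconv f A y].
Proof.
have [] := @double_bound double; first by move=> n; rewrite -addnn leq_addr.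
rewrite -/fA => cA bA iA.
have [] := @double_bound (fun n => n.*2.+1).
  by move=> n; apply: leqW; rewrite -addnn leq_addr.
rewrite -/fB => cB bB iB.
have pA := cl1_psum cA; have pB := cl1_psum cB.
have ndA := psum_nondecreasing cA; have ndB := psum_nondecreasing cB.
have stA := psum_step bA; have stB := psum_step bB.
have inA := psum_integral cA iA; have inB := psum_integral cB iB.
have r0 (fs : nat -> R -> R) y : 0 < y -> rconv f (psum fs 0) y = 0.
  move=> y0; rewrite /rconv /convol integral0_eq// => r _.
  by rewrite {2}/restr /psum big_ord0; case: ifP => _; rewrite mule0.
have EB n y : 0 < y -> psum fB n y = rconv f (psum fA n) y.
  move=> y0; elim: n => [|n IH]; first by rewrite r0// /psum big_ord0.
  by rewrite !psumS (rconvDr cf (pA n) (cA n) y0) IH.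
have EA n y : 0 < y -> psum fA n.+1 y = f y + rconv f (psum fB n) y.
  move=> y0; elim: n => [|n IH].
    by rewrite r0// addr0 /psum big_ord_recr big_ord0/= add0r.
  by rewrite psumS IH (psumS fB) (rconvDr cf (pB n) (cB n) y0) addrA.
have cAl := cl1_limfun pA ndA stA inA; have cBl := cl1_limfun pB ndB stB inB.
exists (limfun (psum fA)), (limfun (psum fB)); split => // y y0.
  have L1 := limfun_cvg ndA stA y0.
  have L2 := rconv_limfun pB ndB stB inB cf y0.
  have L3 : psum fA n.+1 y @[n --> \oo] --> limfun (psum fA) y by rewrite (cvg_shiftS (psum fA ^~ y)).
  have L4 : psum fA n.+1 y @[n --> \oo] --> f y + rconv f (limfun (psum fB)) y.
    by under eq_cvg do rewrite EA//; apply: cvgD => //; exact: cvg_cst.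
  exact: (cvg_unique (@Rhausdorff R) L3 L4).
have L1 := limfun_cvg ndB stB y0.
have L2 := rconv_limfun pA ndA stA inA cf y0.
have L3 : psum fB n y @[n --> \oo] --> rconv f (limfun (psum fA)) y.
  by under eq_cvg do rewrite EB//.
exact: (cvg_unique (@Rhausdorff R) L1 L3).
Qed.

End small_resolvent.
End Resolvent.

(** * Resolvents without smallness, and W' when sigma > 0 *)

Section WeightedResolvent.
Context {R : realType}.
Local Notation leb := (@lebesgue_measure R).
Local Notation RM := (measurableTypeR R).
Implicit Types (x y z l a c : R) (f g h : R -> R).

Lemma rconv_expw l f g y : cl1 f -> cl1 g -> 0 < y ->
  rconv (expw l f) (expw l g) y = expw l (rconv f g) y.
Proof.
move=> cf cg y0; have Cf := cl1_causal cf; have Cg := cl1_causal cg.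
apply: EFin_inj; rewrite (rconvE (cl1_expw l cf) (cl1_expw l cg) y0).
rewrite [RHS]EFinM (rconvE cf cg y0) /convol -ge0_integralZl_EFin ?expR_ge0//.
- apply: eq_integral => r _; have [r0|r0] := leP r 0.
    by rewrite (causal_le0 Cf r0) (causal_le0 (cl1_causal (cl1_expw l cf)) r0) !mul0e mule0.
  have [yr|yr] := leP (y - r) 0.
    by rewrite (causal_le0 Cg yr) (causal_le0 (cl1_causal (cl1_expw l cg)) yr) !mule0.
  rewrite !restrE// -!EFinM /expw; congr EFin.
  rewrite (_ : l * y = l * r + l * (y - r)); first by rewrite expRD; ring.
  by ring.
- by move=> r _; apply: mule_ge0; exact: causal_ge0.
- exact: measurable_convol_integrand.
Qed.

Lemma expwK l f : expw l (expw (- l) f) = f.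
Proof.
by apply/funext => x; rewrite /expw mulrA -expRD -mulrDl subrr mul0r expR0 mul1r.
Qed.

(* Multiplication by [expR (- (l * x))] is compatible with convolutions and makes
   the kernel small enough for the Neumann series. *)
Lemma small_weight f : cl1 f -> (forall x y, 0 < x -> x <= y -> f y <= f x) ->
  exists2 l : R, 0 < l & (\int[leb]_x restr (expw (- l) f) x <= (4^-1)%:E)%E.
Proof.
move=> cf nif; have Cf := cl1_causal cf.
(* The bound 1/4 is shared out: 1/8 for the mass below a, 1/8 for the weighted mass beyond it. *)
have [a a0 Ha] : exists2 a, 0 < a & prim f a <= 8^-1.
  have : \forall a \near 0^'+, prim f a <= 8^-1 by apply: (cvgr_le _ (prim_cvg0 cf)).
  move=> H; near (0 : R)^'+ => a; exists a; last by near: a.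
  by near: a; exact: nbhs_right_gt.
(* Beyond a, f <= f a, so the weighted mass is at most f a / l <= 1/8. *)
pose l : R := 8 * (f a + 1).
have fa0 := cl1_ge0 cf a0.
have l0 : 0 < l by rewrite /l; move: fa0; set q : R := f a; lra.
exists l => //.
have Ca := causal_cutoff a Cf.
have ch := continuous_cl1 (fun x _ => expR_ge0 (- (l * x))) (@continuous_expN R l).
have Ch := cl1_causal ch.
have Cw := cl1_causal (cl1_expw (- l) cf).
apply: (@le_trans _ _ (\int[leb]_x (cutoff a (restr f) x + (f a)%:E * restr (fun x => expR (- (l * x))) x))%E).
  apply: le_integral_causal => // [|x x0]; first exact: causal_add Ca (causal_scale fa0 Ch).
  rewrite /cutoff !restrE// /expw mulNr; case: ifPn => xa.
    rewrite -EFinM -EFinD lee_fin; have fx0 := cl1_ge0 cf x0.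
    have e1 : expR (- (l * x)) <= 1.
      by rewrite -[leRHS]expR0 ler_expR oppr_le0 mulr_ge0// ltW.
    have e0 := expR_ge0 (- (l * x)); nra.
  rewrite add0e -EFinM lee_fin mulrC ler_wpM2r ?expR_ge0//.
  by apply: nif => //; rewrite leNgt.
rewrite (integral_causalD Ca (causal_scale fa0 Ch)) -(prim_cutoff _ cf) (integral_causalZ fa0 Ch).
have -> : (\int[leb]_x restr (fun x => expR (- (l * x))) x = (l^-1)%:E)%E.
  rewrite -(laplace_heaviside l0); apply: eq_integral => x _.
  by rewrite /restr /heaviside; case: ifP => _; rewrite ?mule1 ?mule0.
rewrite -EFinM -EFinD lee_fin.
have : f a / l <= 8^-1.
  by rewrite ler_pdivrMr// /l; move: fa0; set q : R := f a; lra.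
move: Ha; set q : R := prim f a; set p : R := f a / l; lra.
Unshelve. all: by end_near. Qed.

Lemma resolvent f : cl1 f -> (forall x y, 0 < x -> x <= y -> f y <= f x) ->
  exists A B, [/\ cl1 A, cl1 B,
  forall y, 0 < y -> A y = f y + rconv f B y & forall y, 0 < y -> B y = rconv f A y].
Proof.
move=> cf nif; have [l l0 fl] := small_weight cf nif.
have [|A [B [cA cB HA HB]]] := small_resolvent (cl1_expw (- l) cf) _ fl.
  move=> x y x0 xy; rewrite /expw; apply: ler_pM; rewrite ?expR_ge0//.
  - by apply: (cl1_ge0 cf); exact: lt_le_trans xy.
  - by rewrite ler_expR !mulNr lerN2 ler_pM2l.
  - exact: nif.
exists (expw l A), (expw l B); split; [exact: cl1_expw|exact: cl1_expw| |] => y y0.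
  rewrite -{1 2}(expwK l f) (rconv_expw l (cl1_expw _ cf) cB y0) /expw HA//.
  by rewrite mulrDr.
by rewrite -{1}(expwK l f) (rconv_expw l (cl1_expw _ cf) cA y0) /expw HB.
Qed.

Lemma rconvA f g h y : cl1 f -> cl1 g -> cl1 h ->
  rconv f (rconv g h) y = rconv (rconv f g) h y.
Proof.
move=> cf cg ch; rewrite {1}/rconv {2}/rconv (restr_rconv cg ch) (restr_rconv cf cg).
by rewrite convolA//; exact: cl1_causal.
Qed.

Lemma prim_scale c f y : 0 <= c -> cl1 f -> prim (fun x => c * f x) y = rconv (fun=> c) f y.
Proof.
move=> c0 cf; have Cf := cl1_causal cf; have CH := @causal_heaviside R.
apply: EFin_inj; rewrite (primE y (cl1Z c0 cf)).
rewrite restrZ.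
rewrite (convolZr c0 CH Cf) -(primE y cf) -EFinM.
congr EFin; rewrite /rconv.
rewrite restr_cst.
by rewrite (convolZl c0 CH Cf) -(primE y cf) -EFinM.
Qed.

Lemma rconv_ge0 f g y : cl1 f -> cl1 g -> 0 <= rconv f g y.
Proof.
move=> cf cg; apply: fine_ge0.
by apply: (causal_ge0 (causal_convol (cl1_causal cf) (cl1_causal cg))).
Qed.

Lemma eq_rconvl f g h y : (forall x, 0 < x -> f x = g x) -> rconv f h y = rconv g h y.
Proof. by move=> fg; rewrite /rconv (eq_restr fg). Qed.

Lemma eq_rconvr f g h y : (forall x, 0 < x -> f x = g x) -> rconv h f y = rconv h g y.
Proof. by move=> fg; rewrite /rconv (eq_restr fg). Qed.

Lemma rconvDl f g h y : cl1 f -> cl1 g -> cl1 h -> 0 < y ->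
  rconv (fun x => g x + h x) f y = rconv g f y + rconv h f y.
Proof.
move=> cf cg ch y0; rewrite (rconvC (cl1D cg ch) cf) (rconvDr cf cg ch y0).
by rewrite (rconvC cg cf) (rconvC ch cf).
Qed.

(** Convolving the equation with A and B gives c * A = g * A + g * B and c * B = g * B + g * (f *
    B), with c read as a constant function. As g * A = g * f + g * (f * B), the difference c * A - c
    * B is g * f = c - g. *)
Lemma renewal_solution f g c : cl1 f -> cl1 g -> 0 <= c ->
  (forall x y, 0 < x -> x <= y -> f y <= f x) ->
  (forall x, 0 < x -> g x + rconv g f x = c) ->
  exists (d1 d2 : R -> R), [/\ cl1 d1, cl1 d2 &
    forall x, 0 < x -> g x + prim d2 x = c + prim d1 x].
Proof.
move=> cf cg c0 nif H; have [A [B [cA cB HA HB]]] := resolvent cf nif.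
have cgf := cl1_rconv cg cf.
exists (fun x => c * B x), (fun x => c * A x); split; [exact: cl1Z|exact: cl1Z|] => x x0.
rewrite !prim_scale//.
have Ec h : cl1 h -> rconv (fun=> c) h x = rconv g h x + rconv g (rconv f h) x.
  move=> ch; rewrite -(eq_rconvl h x H) (rconvDl ch cg cgf x0); congr (_ + _).
  by rewrite rconvA.
rewrite (Ec _ cA) (Ec _ cB) -(eq_rconvr g x HB) -(H x x0).
have EA : rconv g A x = rconv g f x + rconv g (rconv f B) x.
  by rewrite (eq_rconvr g x HA) (rconvDr cg cf (cl1_rconv cf cB) x0).
by rewrite EA; ring.
Qed.

Section scale.
Variables (sigma m : R) (Pi : {measure set RM -> \bar R}) (psi W : R -> R).
Hypotheses (psiN : in_N sigma m Pi psi) (WS : scale_function psi W) (s0 : 0 < sigma).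
Local Notation K := (levyK m Pi).
Local Notation W1 := (derive1 W).

Lemma scale_derive_renewal x : 0 < x ->
  W1 x + rconv W1 (fun x => (sigma ^+ 2)^-1 * K x) x = (sigma ^+ 2)^-1.
Proof.
move=> x0; have cW := cl1_scale_derive WS; have cK := cl1_levyK psiN.
have CW := cl1_causal cW; have CK := cl1_causal cK.
have s20 : 0 < sigma ^+ 2 by rewrite exprn_gt0.
have i0 : 0 <= (sigma ^+ 2)^-1 by rewrite invr_ge0 ltW.
have -> : rconv W1 (fun x => (sigma ^+ 2)^-1 * K x) x = (sigma ^+ 2)^-1 * rconv W1 K x.
  apply: EFin_inj; rewrite (rconvE cW (cl1Z i0 cK) x0) EFinM (rconvE cW cK x0).
  rewrite restrZ.
  by rewrite (convolZr i0 CW CK).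
have sn0 : sigma ^+ 2 != 0 by rewrite gt_eqF.
by apply: (mulfI sn0); rewrite mulrDr mulVKf// mulfV//; exact: (renewal psiN WS x0).
Qed.

Lemma cl1_scaled_kernel : cl1 (fun x => (sigma ^+ 2)^-1 * K x).
Proof. by apply: cl1Z (cl1_levyK psiN); rewrite invr_ge0 sqr_ge0. Qed.

Lemma scale_derive_le x : 0 < x -> W1 x <= (sigma ^+ 2)^-1.
Proof.
move=> x0; rewrite -(scale_derive_renewal x0) lerDl.
exact: (rconv_ge0 _ (cl1_scale_derive WS) cl1_scaled_kernel).
Qed.

Lemma scale_derive_decomposition : exists (d1 d2 : R -> R), [/\ cl1 d1, cl1 d2 &
    forall x, 0 < x -> W1 x + prim d2 x = (sigma ^+ 2)^-1 + prim d1 x].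
Proof.
have i0 : 0 <= (sigma ^+ 2)^-1 by rewrite invr_ge0 sqr_ge0.
apply: (renewal_solution cl1_scaled_kernel (cl1_scale_derive WS) i0).
  by move=> x y x0 xy; rewrite ler_wpM2l// (levyK_nonincreasing psiN).
exact: scale_derive_renewal.
Qed.

Lemma scale_derive_cvg : W1 x @[x --> 0^'+] --> (sigma ^+ 2)^-1.
Proof.
have [d1 [d2 [c1 c2 H]]] := scale_derive_decomposition.
have L : (sigma ^+ 2)^-1 + prim d1 x - prim d2 x @[x --> 0^'+] --> (sigma ^+ 2)^-1 + 0 - 0.
  apply: cvgB; last exact: prim_cvg0.
  by apply: cvgD; [exact: cvg_cst|exact: prim_cvg0].
rewrite addr0 subr0 in L; apply: cvg_trans L; apply: near_eq_cvg; near=> x.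
have x0 : 0 < x by near: x; exact: nbhs_right_gt.
by rewrite -H// [LHS]addrK.
Unshelve. all: by end_near. Qed.

End scale.
End WeightedResolvent.

(** * Behaviour of kappa at 0 *)

Section LimitsAtZero.
Context {R : realType}.
Implicit Types (f g : R -> R) (M l : R).

Lemma limsup0_le f M : (\forall y \near 0^'+, f y <= M) -> (limsup0 f <= M%:E)%E.
Proof.
move=> H; rewrite /limsup0 limf_esupE; apply: ge_ereal_inf.
exists (ereal_sup ((EFin \o f) @` [set y | f y <= M])); first by exists [set y | f y <= M].
by apply: ge_ereal_sup => _ [y fy <-]; rewrite lee_fin.
Qed.

Lemma liminf0_ge f M : (\forall y \near 0^'+, M <= f y) -> (M%:E <= liminf0 f)%E.
Proof.
move=> H; rewrite /liminf0 limf_einfE; apply: le_ereal_sup_tmp.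
exists (ereal_inf ((EFin \o f) @` [set y | M <= f y])); first by exists [set y | M <= f y].
by apply: le_ereal_inf_tmp => _ [y fy <-]; rewrite lee_fin.
Qed.

Lemma liminf0_le_limsup0 f : (liminf0 f <= limsup0 f)%E.
Proof.
rewrite /liminf0 limf_einfE /limsup0 limf_esupE.
apply: ge_ereal_sup => _ [V FV <-]; apply: le_ereal_inf_tmp => _ [U FU <-].
have [y [Vy Uy]] : exists y : R, V y /\ U y.
  by near (0 : R)^'+ => y; exists y; split; near: y.
apply: (@le_trans _ _ (f y)%:E).
  by apply: ereal_inf_lbound; exists y.
by apply: ereal_sup_ubound; exists y.
Unshelve. all: by end_near. Qed.

Lemma liminf0_homo f g : (\forall y \near 0^'+, f y <= g y) ->
  (liminf0 f <= liminf0 g)%E.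
Proof.
move=> H; rewrite /liminf0 !limf_einfE; apply: ge_ereal_sup => _ [V FV <-].
apply: le_ereal_sup_tmp; pose U := V `&` [set y | f y <= g y].
exists (ereal_inf ((EFin \o g) @` U)).
  by exists U => //; exact: filterI.
apply: le_ereal_inf_tmp => _ [y [Vy fy] <-]; apply: (@le_trans _ _ (f y)%:E).
  by apply: ereal_inf_lbound; exists y.
by rewrite lee_fin.
Qed.

Lemma cvg_liminf0_limsup0 f l : f y @[y --> 0^'+] --> l ->
  liminf0 f = l%:E /\ limsup0 f = l%:E.
Proof.
move=> fl.
have L : (l%:E <= liminf0 f)%E.
  apply/lee_subgt0Pr => e e0; rewrite -EFinB; apply: liminf0_ge.
  by apply: (cvgr_ge _ fl); lra.
have U : (limsup0 f <= l%:E)%E.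
  apply/lee_addgt0Pr => e e0; rewrite -EFinD; apply: limsup0_le.
  by apply: (cvgr_le _ fl); lra.
have M := liminf0_le_limsup0 f.
by split; apply/eqP; rewrite eq_le ?U ?L ?(le_trans M U)// (le_trans L M).
Qed.

Lemma liminf0_pinfty f : (forall M, \forall y \near 0^'+, M <= f y) -> liminf0 f = +oo%E.
Proof.
move=> H; apply/eqyP => A A0; exact: liminf0_ge.
Qed.

Lemma limsup0_pinfty f : (forall M, \forall y \near 0^'+, M <= f y) -> limsup0 f = +oo%E.
Proof.
by move=> /liminf0_pinfty H; apply/eqP; rewrite -leye_eq -H liminf0_le_limsup0.
Qed.

End LimitsAtZero.

(** * Tails of the Levy measure of phi *)

Section Subordinator.
Context {R : realType}.
Local Notation leb := (@lebesgue_measure R).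
Local Notation RM := (measurableTypeR R).
Implicit Types (x y z a c M l : R) (f g : R -> R).

Lemma integral_itv_cst (c a : R) : 0 <= a -> (\int[leb]_(r in `]0%R, a[) c%:E = (c * a)%:E)%E.
Proof.
move=> a0; rewrite integral_cst//= lebesgue_measure_itv/= lte_fin.
have [a1|a1] := ltP 0 a; first by rewrite -EFinB -EFinM subr0.
by rewrite mule0 (_ : a = 0) ?mulr0//; apply/eqP; rewrite eq_le a0 a1.
Qed.

Section in_B.
Variables (b : R) (mu : {measure set RM -> \bar R}) (phi : R -> R).
Hypothesis phiB : in_B b mu phi.

Let mmin : measurable_fun setT (EFin \o (fun r : RM => Num.min 1 r) : RM -> \bar R).
Proof. by apply/measurable_EFinP; exact: measurable_minr. Qed.

Lemma B_levy : levy mu.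
Proof.
split; first exact: B_mu phiB.
move=> y y0; have c0 : 0 < Num.min 1 y by rewrite lt_min ltr01.
have F := B_mu_integrable phiB.
rewrite -(@lte_pmul2l _ (Num.min 1 y)%:E)//.
rewrite [ltRHS]gt0_muley ?lte_fin//; apply: le_lt_trans F.
rewrite -integral_cst//.
apply: (@le_trans _ _ (\int[mu]_(w in `]y, +oo[) (Num.min 1 w)%:E)%E).
  apply: ge0_le_integral => //.
  - by move=> x _; rewrite lee_fin ltW.
  - exact: measurable_funTS mmin.
  - move=> x /=; rewrite in_itv/= andbT => yx; rewrite lee_fin.
    by rewrite le_min ge_min lexx ge_min (ltW yx) orbT.
apply: ge0_subset_integral => //.
- exact: measurable_funTS mmin.
- by move=> x /=; rewrite in_itv/= andbT => x0; rewrite lee_fin le_min ler01 ltW.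
- by apply: subset_itvr; rewrite bnd_simp ltW.
Qed.

(** By [integral_tail] the integral of the tail over ]0, a[ is the mu-integral of min(w, a), which
    is at most max(1, a) min(1, w). *)
Lemma B_tail_integrable a : (\int[leb]_s cutoff a (restr (tail mu)) s < +oo)%E.
Proof.
have CH := @causal_heaviside R; have CC := causal_cutoff a CH.
have := integral_tail B_levy CC.
rewrite (_ : (\int[leb]_s _ = \int[leb]_s cutoff a (restr (tail mu)) s)%E); last first.
  apply: eq_integral => s _; rewrite /cutoff /restr /heaviside.
  by case: ifP => _; case: ifP => _; rewrite ?mule1 ?mule0.
move=> ->; pose c := Num.max 1 a; have c0 : 0 <= c by rewrite le_max ler01.
apply: (@le_lt_trans _ _ (\int[mu]_(w in `]0%R, +oo[) (c%:E * (Num.min 1 w)%:E))%E); last first.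
  rewrite ge0_integralZl_EFin//.
  - by rewrite lte_mul_pinfty//; exact: (B_mu_integrable phiB).
  - by move=> x /=; rewrite in_itv/= andbT => x0; rewrite lee_fin le_min ler01 ltW.
  - exact: measurable_funTS mmin.
rewrite [leRHS]integral_mkcond; apply: ge0_le_integral => //.
- by move=> w _; exact: (causal_ge0 (causal_convol CH CC)).
- exact: (causal_measurable (causal_convol CH CC)).
- have mc : measurable_fun (`]0, +oo[ : set RM) (fun w : RM => (c%:E * (Num.min 1 w)%:E))%E.
    by apply: measurable_funTS; apply: measurable_funeM; exact: mmin.
  by apply: (measurable_restrictT (fun w : RM => (c%:E * (Num.min 1 w)%:E))%E _).1.
move=> w _; rewrite patchE; have [w0|w0] := leP w 0.
  rewrite (causal_le0 (causal_convol CH CC) w0); case: ifP => // .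
  by rewrite inE/= in_itv/= andbT ltNge w0.
rewrite mem_set/= ?in_itv/= ?w0// -EFinM.
have -> : c * Num.min 1 w = Num.min c (c * w) by rewrite minr_pMr// mulr1.
have c1 : 1 <= c by rewrite le_max lexx.
rewrite EFin_min le_min; apply/andP; split.
  rewrite (convol_heavisideE _ CC).
  apply: (@le_trans _ _ (\int[leb]_r cutoff a heaviside r)%E).
    apply: ge0_subset_integral => //; first exact: (causal_measurable CC).
    by move=> r _; exact: (causal_ge0 CC).
  rewrite integral_cutoff//; have [a0|a0] := leP a 0.
    by rewrite set_itv_ge ?integral_set0// bnd_simp -leNgt.
  apply: (@le_trans _ _ (1 * a)%:E); last by rewrite mul1r lee_fin /c le_max lexx orbT.
  rewrite -integral_itv_cst ?(ltW a0)//; apply: ge0_le_integral => //.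
  - by move=> r _; exact: (causal_ge0 CH).
  - by apply: measurable_funTS; exact: (causal_measurable CH).
  - by move=> r _; rewrite /heaviside lee_fin; case: ifP.
rewrite (convol_heavisideE _ CC).
apply: (@le_trans _ _ (1 * w)%:E); last by rewrite mul1r lee_fin ler_peMl// ltW.
rewrite -integral_itv_cst ?(ltW w0)//; apply: ge0_le_integral => //.
- by move=> r _; exact: (causal_ge0 CC).
- by apply: measurable_funTS; exact: (causal_measurable CC).
- by move=> r _; rewrite /cutoff /heaviside; case: ifP => _; rewrite lee_fin//; case: ifP.
Qed.

End in_B.
End Subordinator.

(** * Estimates of kappa near 0 *)

Section Kappa.
Context {R : realType}.
Local Notation leb := (@lebesgue_measure R).
Local Notation RM := (measurableTypeR R).
Implicit Types (x y z a c M l : R) (f g h : R -> R).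

(** [tail mu] may jump, so it need not be in [cl1]; monotonicity replaces continuity by bounding h
    by h(y / 2) on the half where f is singular. *)
Lemma convol_monotone_lty h f y : causal (restr h) ->
  (forall x y, 0 < x -> x <= y -> h y <= h x) -> (\int[leb]_x cutoff y (restr h) x < +oo)%E ->
  cl1 f -> 0 < y -> (convol (restr h) (restr f) y < +oo)%E.
Proof.
move=> Ch nih ih cf y0; have Cf := cl1_causal cf.
have y2 : 0 < y / 2 by rewrite divr_gt0.
have [M [M0 fM]] := continuous_segment_bounded y y2 (cl1_cont cf).
have h0 : 0 <= h (y / 2) by have := causal_ge0 Ch (y / 2); rewrite restrE// lee_fin.
apply: le_lt_trans (convol_le_split Ch Cf M0 h0 (t := y) _) _ => [r s r0 s0 rs|].
  rewrite !restrE// !lee_fin; have [ry|yr] := ltP r (y / 2); first by left; apply: fM; lra.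
  by right; split; [lra|exact: nih].
by rewrite -(prim_cutoff _ cf) lte_add_pinfty// ?lte_mul_pinfty// ltry.
Qed.

Section scale.
Variables (sigma m b : R) (Pi mu : {measure set RM -> \bar R}) (psi phi W : R -> R).
Hypotheses (psiN : in_N sigma m Pi psi) (phiB : in_B b mu phi) (WS : scale_function psi W).
Local Notation W1 := (derive1 W).
Local Notation h := (tail mu).
Local Notation k := (kappa b mu W).

Let cW : cl1 W1. Proof. exact: cl1_scale_derive WS. Qed.
Let CW : causal (restr W1). Proof. exact: cl1_causal cW. Qed.
Let muL : levy mu. Proof. exact: B_levy phiB. Qed.
Let Ch : causal (restr h). Proof. exact: causal_tail muL. Qed.
Let nih x y : 0 < x -> x <= y -> h y <= h x. Proof. exact: (tail_nonincreasing muL). Qed.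
Let W0 y : 0 < y -> 0 <= W y. Proof. by move=> y0; apply: (scale_ge0 WS); exact: ltW. Qed.

Lemma kappaE y : k y = b * W1 y + rconv h W1 y.
Proof.
rewrite /kappa /Rintegral; congr (_ + fine _).
rewrite [LHS]integral_mkcond; apply: eq_integral => r _; rewrite patchE.
have [r0|r0] := leP r 0.
  by rewrite (causal_le0 Ch r0) mul0e memNset//= in_itv/= ltNge r0.
have [ry|yr] := ltP r y; last first.
  rewrite (causal_le0 CW) ?subr_le0// mule0 memNset//= in_itv/= r0/=.
  by apply/negP; rewrite -leNgt.
by rewrite mem_set/= ?in_itv/= ?r0// !restrE ?subr_gt0// -EFinM mulrC.
Qed.

Lemma kappa_rconvE y : 0 < y -> (rconv h W1 y)%:E = convol (restr h) (restr W1) y.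
Proof.
move=> y0; rewrite fineK// ge0_fin_numE; last exact: (causal_ge0 (causal_convol Ch CW)).
by apply: (convol_monotone_lty Ch nih _ cW) => //; exact: (B_tail_integrable phiB).
Qed.

Lemma kappa_rconv_ge0 y : 0 <= rconv h W1 y.
Proof. by apply: fine_ge0; exact: (causal_ge0 (causal_convol Ch CW)). Qed.

Lemma integral_cutoff_scale y : 0 < y ->
  (\int[leb]_x cutoff y (restr W1) x = (W y)%:E)%E.
Proof. by move=> y0; rewrite -(prim_cutoff _ cW) -(scale_prim psiN WS). Qed.

(** On ]0, y[ the tail is at least h y, and W' has integral W y there because W(0+) = 0. *)
Lemma kappa_rconv_ge y : 0 < y -> h y * W y <= rconv h W1 y.
Proof.
move=> y0; rewrite -lee_fin (kappa_rconvE y0) (convolC Ch CW) EFinM.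
rewrite -(integral_cutoff_scale y0); apply: convol_ge_cst => //; first exact: tail_ge0.
by move=> x; rewrite subrr => x0 xy; apply: nih => //; exact: ltW.
Qed.

Lemma kappa_rconv_le c y : 0 < y -> 0 <= c -> (forall x, 0 < x -> x < y -> h x <= c) ->
  rconv h W1 y <= c * W y.
Proof.
move=> y0 c0 H; rewrite -lee_fin (kappa_rconvE y0) (convolC Ch CW) EFinM.
by rewrite -(integral_cutoff_scale y0); apply: convol_le_cst.
Qed.

Lemma kappa_blowup_drift : sigma = 0 -> 0 < b -> forall M, \forall y \near (0 : R)^'+, M <= k y.
Proof.
move=> s0 b0 M; have psiN0 := psiN; rewrite s0 in psiN0.
have := scale_derive_blowup psiN0 WS (M / b).
apply: filterS => y; rewrite ltr_pdivrMr// => /ltW H.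
by rewrite kappaE mulrC (le_trans H)// lerDl kappa_rconv_ge0.
Qed.

(** The drift term converges with W'; the convolution is at most sigma^(-2) times the integral of
    the tail over ]0, y[, which vanishes. *)
Lemma kappa_cvg : 0 < sigma -> k y @[y --> 0^'+] --> b / sigma ^+ 2.
Proof.
move=> s0; pose c := (sigma ^+ 2)^-1; have c0 : 0 <= c by rewrite invr_ge0 sqr_ge0.
have -> : k = (fun y => b * W1 y + rconv h W1 y) by apply/funext => y; exact: kappaE.
rewrite -[_ / _]addr0; apply: cvgD.
  by apply: cvgM; [exact: cvg_cst|exact: (scale_derive_cvg psiN WS)].
have Wc x : 0 < x -> W1 x <= c by move=> x0; exact: (scale_derive_le psiN WS).
have L : (rconv h W1 y)%:E @[y --> 0^'+] --> (0 : \bar R).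
  apply: (squeeze_cvge (f := fun=> 0%E) (h := fun y => (c%:E * \int[leb]_x cutoff y (restr h) x)%E)).
  - near=> y; have y0 : 0 < y by near: y; exact: nbhs_right_gt.
    rewrite lee_fin kappa_rconv_ge0 (kappa_rconvE y0)/=.
    by apply: convol_le_cst => // x x0 _; exact: Wc.
  - exact: cvg_cst.
  - rewrite -(mule0 c%:E); apply: cvgeZl => //.
    exact: (integral_cutoff_cvg0 Ch (B_tail_integrable phiB 2)).
by move/fine_cvg: L.
Unshelve. all: by end_near. Qed.

(** A tail bounded by c gives kappa <= c W, and W(0+) = 0. *)
Lemma kappa_cvg0 c : b = 0 -> 0 <= c -> (forall x, 0 < x -> h x <= c) ->
  k y @[y --> 0^'+] --> (0 : R).
Proof.
move=> b0 c0 H; apply: (squeeze_cvgr (f := fun=> 0) (h := fun y => c * W y)).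
- near=> y; have y0 : 0 < y by near: y; exact: nbhs_right_gt.
  rewrite kappaE b0 mul0r add0r kappa_rconv_ge0/=.
  by apply: kappa_rconv_le => // x x0 _; exact: H.
- exact: cvg_cst.
- by rewrite -[X in _ --> X](mulr0 c); apply: cvgM; [exact: cvg_cst|exact: (scale_cvg0 psiN WS)].
Unshelve. all: by end_near. Qed.

Lemma tail_nonincreasing_cvg : exists l : \bar R,
  [/\ (0 <= l)%E, lim0 h = l & (h y)%:E @[y --> 0^'+] --> l].
Proof.
pose l := ereal_sup [set (h y)%:E | y in [set y : R | 0 < y]].
have L : (h y)%:E @[y --> 0^'+] --> l.
  suff -> : l = ereal_sup ((fun y => (h y)%:E) @` `]0, 1[).
    apply: nonincreasing_at_right_cvge; first by rewrite bnd_simp.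
    by move=> x y; rewrite !in_itv/= => /andP[x0 _] _ xy; rewrite lee_fin; exact: nih.
  apply/eqP; rewrite eq_le andbC; apply/andP; split.
    apply: ereal_sup_le; apply: image_subset => y /=; by rewrite in_itv/= => /andP[].
  apply: ge_ereal_sup => _ [y /= y0 <-]; apply: le_ereal_sup_tmp.
  exists (h (Num.min y 2^-1))%:E.
    exists (Num.min y 2^-1) => //=; rewrite in_itv/= lt_min y0/= gt_min.
    by apply/andP; split; [|apply/orP; right; lra].
  rewrite lee_fin; apply: nih; first by rewrite lt_min y0/=.
  by rewrite ge_min lexx.
exists l; split => //; last exact: cvg_lim L.
by apply: le_ereal_sup_tmp; exists (h 1)%:E; [exists 1 => //=|rewrite lee_fin tail_ge0].
Qed.

Lemma tail_lim0_fin : (lim0 h < +oo)%E -> exists2 c : R, 0 <= c &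
  h y @[y --> 0^'+] --> c /\ forall x, 0 < x -> h x <= c.
Proof.
have [l [l0 -> L]] := tail_nonincreasing_cvg => ly.
have lf : l \is a fin_num by rewrite ge0_fin_numE.
exists (fine l); first exact: fine_ge0.
have Lf : h y @[y --> 0^'+] --> fine l.
  by move: L; rewrite -{1}(fineK lf) => /fine_cvg.
split => // x x0; apply: (cvgr_to_ge Lf).
near=> y; apply: nih; first by near: y; exact: nbhs_right_gt.
by near: y; exact: nbhs_right_le.
Unshelve. all: by end_near. Qed.

End scale.
End Kappa.

(** * Power bounds on the tails *)

Section PowerBounds.
Context {R : realType}.
Local Notation leb := (@lebesgue_measure R).
Local Notation RM := (measurableTypeR R).
Implicit Types (x y z a c M l p : R) (f g h : R -> R).

Lemma powRD_gt0 x a c : 0 < x -> x `^ (a + c) = x `^ a * x `^ c.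
Proof. by move=> x0; apply: powRD; rewrite (gt_eqF x0) implybT. Qed.

Lemma continuous_powR p x : 0 < x -> {for x, continuous (fun x => x `^ p)}.
Proof. by move=> x0; have H := is_derive1_powR p x0; exact: (is_derive_continuous H). Qed.

Lemma is_derive_scale f df c x : is_derive x 1 f df -> is_derive x 1 (fun x => c * f x) (c * df).
Proof. by move=> H; exact: is_deriveZ. Qed.

Lemma is_derive_powR_primitive p x : 0 < x -> p != 0 ->
  is_derive x 1 (fun x => p^-1 * x `^ p) (x `^ (p - 1)).
Proof.
move=> x0 pn0; rewrite -[X in is_derive _ _ _ X](mulKf pn0).
exact: is_derive_scale (is_derive1_powR p x0).
Qed.

Lemma cl1_powR p : -1 < p -> cl1 (fun x => x `^ p).
Proof.
move=> p1; have pn : p + 1 != 0 by rewrite gt_eqF//; lra.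
apply: (@cl1_of_derive R _ (fun x => (p + 1)^-1 * x `^ (p + 1)) 0) => x x0.
- exact: powR_ge0.
- exact: continuous_powR.
- by have := is_derive_powR_primitive x0 pn; rewrite addrK.
- by rewrite mulr_ge0 ?powR_ge0// invr_ge0; lra.
Qed.

Lemma prim_powR p x : -1 < p -> 0 < x -> prim (fun x => x `^ p) x = (p + 1)^-1 * x `^ (p + 1).
Proof.
move=> p1 x0; have pn : p + 1 != 0 by rewrite gt_eqF//; lra.
have c : (p + 1)^-1 * x `^ (p + 1) @[x --> 0^'+] --> (0 : R).
  rewrite -[X in _ --> X](mulr0 (p + 1)^-1); apply: cvgM; first exact: cvg_cst.
  by apply: powR_cvg0; lra.
rewrite (prim_eq (cl1_powR p1) _ c x0) ?add0r// => z z0.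
by have := is_derive_powR_primitive z0 pn; rewrite addrK.
Qed.

Lemma primZ c f y : 0 <= c -> cl1 f -> prim (fun x => c * f x) y = c * prim f y.
Proof.
move=> c0 cf; apply: EFin_inj; rewrite (primE y (cl1Z c0 cf)).
rewrite restrZ.
by rewrite (convolZr c0 (@causal_heaviside R) (cl1_causal cf)) -(primE y cf) -EFinM.
Qed.

Section scale.
Variables (m b : R) (Pi mu : {measure set RM -> \bar R}) (psi phi W : R -> R).
Hypotheses (psiN : in_N 0 m Pi psi) (phiB : in_B b mu phi) (WS : scale_function psi W).
Local Notation K := (levyK m Pi).

(** The tail bound is integrated over ]x, d] only; what remains is the constant m + tail2 Pi d. *)
Lemma tail2_powR_bound alpha C d : 1 < alpha -> 0 <= C -> 0 < d ->
  (forall x, 0 < x -> x <= d -> tail Pi x <= C * x `^ (- alpha)) ->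
  exists2 D : R, 0 <= D & forall x, 0 < x -> x <= d -> K x <= D * x `^ (1 - alpha).
Proof.
move=> a1 C0 d0 H; pose e : R := alpha - 1; have e0 : 0 < e by rewrite /e; lra.
have en : 1 - alpha != 0 by rewrite lt_eqF//; lra.
have PL := N_levy psiN; have P2 := N_tail_integrable psiN.
have cp : forall x : R, 0 < x -> {for x, continuous (fun x => C * x `^ (- alpha))}.
  by move=> x x0; apply: cvgM; [exact: cvg_cst|exact: continuous_powR].
have T x : 0 < x -> x <= d -> tail2 Pi x <= C / e * x `^ (1 - alpha) + tail2 Pi d.
  move=> x0 xd; rewrite -lee_fin (tail2_split PL P2 x0 xd) EFinD leeD2r//.
  apply: (@le_trans _ _ (\int[leb]_(r in `[x, d]) (C * r `^ (- alpha))%:E)%E).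
    apply: (@le_trans _ _ (\int[leb]_(r in `]x, d]) (C * r `^ (- alpha))%:E)%E).
      apply: ge0_le_integral => //.
      - by move=> r _; rewrite lee_fin tail_ge0.
      - apply: (measurable_tail_itv PL) => r /=; rewrite !in_itv/= andbT => /andP[xr _].
        exact: lt_trans xr.
      - apply/measurable_EFinP; apply: measurable_funS (continuous_pos_measurable cp) => //.
        by move=> r /=; rewrite !in_itv/= andbT => /andP[xr _]; exact: lt_trans xr.
      - move=> r /=; rewrite in_itv/= => /andP[xr rd]; rewrite lee_fin; apply: H => //.
        exact: lt_trans xr.
    apply: ge0_subset_integral => //.
    - apply/measurable_EFinP; apply: measurable_funS (continuous_pos_measurable cp) => //.
      by move=> r /=; rewrite !in_itv/= andbT => /andP[xr _]; exact: lt_le_trans xr.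
    - by move=> r _; rewrite lee_fin mulr_ge0// powR_ge0.
    - by apply: subset_itvr; rewrite bnd_simp.
  have dp (r : R) : 0 < r -> is_derive r 1 (fun r => C * ((1 - alpha)^-1 * r `^ (1 - alpha))) (C * r `^ (- alpha)).
    move=> r0; apply: is_derive_scale.
    have := is_derive_powR_primitive r0 en.
    by rewrite (_ : 1 - alpha - 1 = - alpha)//; ring.
  rewrite (integral_derive x0 xd cp dp) lee_fin (_ : (1 - alpha)^-1 = - e^-1); last first.
    by rewrite -invrN /e opprB.
  have : 0 <= C * (e^-1 * d `^ (1 - alpha)) by rewrite !mulr_ge0 ?invr_ge0 ?powR_ge0// ltW.
  by set q := d `^ _; set r := x `^ _; lra.
pose Z := m + tail2 Pi d.
have Z0 : 0 <= Z by exact: (levyK_ge0 psiN).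
have de : 0 < d `^ (1 - alpha) by exact: powR_gt0.
(* The exponent 1 - alpha is negative, so x^(1 - alpha) >= d^(1 - alpha) and the constant Z is
   absorbed into the power. *)
exists (C / e + Z / d `^ (1 - alpha)).
  by rewrite addr_ge0// divr_ge0// ltW.
move=> x x0 xd; have H1 := T _ x0 xd.
have H2 : d `^ (1 - alpha) <= x `^ (1 - alpha).
  have -> : 1 - alpha = - e by rewrite /e; ring.
  rewrite !powRN lef_pV2 ?posrE ?powR_gt0//.
  by apply: ge0_ler_powR => //; rewrite ?nnegrE; exact: ltW.
have H3 : Z <= Z / d `^ (1 - alpha) * x `^ (1 - alpha).
  by rewrite mulrAC ler_pdivlMr// ler_wpM2l.
rewrite /levyK mulrDl; move: H1 H3; rewrite /Z.
set p := x `^ _; set q := d `^ _ => H1 H3; lra.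
Qed.

(** K = O(y^(1 - alpha)) integrates to O(y^(2 - alpha)), so [scale_lower] bounds W below by a
    multiple of y^(alpha - 1); the tail of mu is at least a multiple of y^(-beta), and alpha - 1 -
    beta < 0. *)
Lemma tail_scale_blowup alpha beta : 1 < alpha -> alpha < 1 + beta -> 1 + beta < 2 ->
  tail Pi =O_ (0^'+) (fun y : R => y `^ (- alpha)) ->
  (\forall y \near 0^'+, 0 < tail mu y) ->
  (fun y : R => (tail mu y)^-1%R) =O_ (0^'+) (fun y : R => y `^ beta) ->
  forall M, \forall y \near 0^'+, M <= tail mu y * W y.
Proof.
move=> a1 ab b2 /eqO_exP[C C0 HC] mu0 /eqO_exP[B B0 HB] M.
have [d d0 Hd] : exists2 d, 0 < d &
    forall x, 0 < x -> x <= d -> tail Pi x <= C * x `^ (- alpha).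
  move: HC => [e /= e0 He]; exists (e / 2); first by rewrite divr_gt0.
  move=> x x0 xe; have := He x; rewrite /ball_/= sub0r normrN gtr0_norm// => /(_ _ x0).
  by rewrite [`|tail _ _|]ger0_norm ?tail_ge0// ger0_norm ?powR_ge0//; apply; lra.
have [D D0 HD] := tail2_powR_bound a1 (ltW C0) d0 Hd.
have a2 : -1 < 1 - alpha by lra.
have cp := cl1Z D0 (cl1_powR a2).
pose E := D * (2 - alpha)^-1; have E0 : 0 <= E by rewrite mulr_ge0// invr_ge0; lra.
have PK y : 0 < y -> y <= d -> prim K y <= E * y `^ (2 - alpha).
  move=> y0 yd; apply: le_trans (prim_le_dom (cl1_levyK psiN) cp _) _.
    by move=> x x0 xy; apply: HD => //; lra.
  rewrite (primZ _ D0 (cl1_powR a2)).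
  by rewrite prim_powR// /E -mulrA (_ : 1 - alpha + 1 = 2 - alpha)//; ring.
pose N := `|M| + 1; have N0 : 0 < N by rewrite ltr_wpDl.
have MN : M <= N by rewrite (le_trans (ler_norm _))// lerDl.
pose g := beta + 1 - alpha; have g0 : 0 < g by rewrite /g; lra.
have L : N * B * E * y `^ g @[y --> 0^'+] --> (0 : R).
  rewrite -[X in _ --> X](mulr0 (N * B * E)); apply: cvgM; first exact: cvg_cst.
  exact: powR_cvg0.
near=> y; have y0 : 0 < y by near: y; exact: nbhs_right_gt.
have yd : y <= d by near: y; exact: nbhs_right_le.
have h0 : 0 < tail mu y by near: y.
have hB : (tail mu y)^-1 <= B * y `^ beta.
  have : `|(tail mu y)^-1| <= B * `|y `^ beta| by near: y.
  by move=> H; apply: le_trans (ler_norm _) (le_trans H _); rewrite ger0_norm ?powR_ge0.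
have small : N * B * E * y `^ g <= 1 by near: y; apply: (cvgr_le _ L).
have Wy := scale_lower psiN WS y0; have W0 := ltW (scale_gt0 psiN WS y0).
have H1 : y <= W y * (E * y `^ (2 - alpha)).
  by apply: le_trans Wy _; rewrite ler_wpM2l// PK.
have H2 : 1 <= tail mu y * (B * y `^ beta) by rewrite -ler_pdivrMl// mulr1.
apply: le_trans MN _; rewrite -(ler_pM2r y0).
have P0 := powR_gt0 beta y0; have P1 := powR_gt0 (2 - alpha) y0.
have H3 : 1 * y <= tail mu y * (B * y `^ beta) * (W y * (E * y `^ (2 - alpha))).
  by apply: ler_pM => //; exact: ltW.
have Eg : y `^ beta * y `^ (2 - alpha) = y * y `^ g.
  rewrite -{3}(powRr1 (ltW y0)) -!powRD_gt0//; congr (_ `^ _); rewrite /g; ring.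
have Q0 : 0 <= tail mu y * W y by rewrite mulr_ge0// ltW.
have H4 : y <= tail mu y * W y * (B * E * (y * y `^ g)).
  by rewrite -Eg; move: H3; rewrite mul1r; congr (_ <= _); ring.
move: (ler_wpM2l (ltW N0) H4) (ler_wpM2l Q0 (ler_wpM2r (ltW y0) small)).
rewrite mul1r => A1 A2; apply: le_trans A1 _; apply: le_trans _ A2.
by rewrite le_eqVlt; apply/orP; left; apply/eqP; ring.
Unshelve. all: by end_near. Qed.

End scale.
End PowerBounds.

(** * Smoothness of kappa *)

Section Smoothness.
Context {R : realType}.
Local Notation leb := (@lebesgue_measure R).
Local Notation RM := (measurableTypeR R).
Implicit Types (x y z a c M l : R) (f g h : R -> R).

Lemma nonincreasing_derive_le0 f df x : 0 < x ->
  (forall x y, 0 < x -> x <= y -> f y <= f x) ->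
  (forall x : R, 0 < x -> is_derive x 1 f (df x)) -> df x <= 0.
Proof.
move=> x0 nif dF; apply/ler_addgt0Pl => e e0; rewrite addr0.
(* The tilt makes the function strictly decreasing, as the derivative-sign lemma requires; e is then
   arbitrary. *)
pose g z := f z - e * z.
have dg (z : R) : 0 < z -> is_derive z 1 g (df z - e).
  move=> z0; apply: is_deriveB; first exact: dF.
  by rewrite -[X in is_derive _ _ _ X]mulr1; exact: is_derive_scale.
rewrite -subr_le0; have [_ <-] := dg _ x0; rewrite -derive1E.
apply: (@decr_derive1_le0_itvy R g false 0).
- by move=> z; rewrite inE/= in_itv/= andbT => z0; have [] := dg _ z0.
- move=> y z; rewrite !in_itv/= !andbT => y0 z0 zy.
  by have := nif _ _ z0 (ltW zy); have := zy; rewrite -(ltr_pM2l e0) /g; lra.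
- by rewrite in_itv/= x0.
Qed.

Lemma derive1_is_derive f g x : (forall x : R, 0 < x -> is_derive x 1 f (g x)) -> 0 < x ->
  derive1 f x = g x.
Proof. by move=> dF x0; rewrite derive1E; have [] := dF x x0. Qed.

Lemma Ck2P k p : (forall y : R, 0 < y -> is_derive y 1 k (p y)) -> Ck 1 p -> Ck 2 k.
Proof.
move=> dk [dp cp]; have E1 y : 0 < y -> \forall z \near y, p z = derive1 k z.
  move=> y0; near=> z; have z0 : 0 < z by near: z; exact: lt_nbhsr.
  by rewrite (derive1_is_derive dk z0).
have E2 y : 0 < y -> derive1n 1 p y = derive1n 2 k y.
  by move=> y0; rewrite /= !derive1E; exact: near_eq_derive (E1 y y0).
split.
  case=> [|[|i i2]]; last by case: (notF i2).
    by move=> _ y y0; have [dd _] := dk _ y0; exact: dd.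
  move=> _ y y0.
  exact: near_eq_derivable (E1 y y0) (dp 0%N isT y y0).
move=> y y0; rewrite /prop_for /continuous_at -E2//; apply: cvg_trans (cp y y0).
apply: near_eq_cvg; near=> z; rewrite E2//; near: z; exact: lt_nbhsr.
Unshelve. all: by end_near. Qed.

Lemma cl1_is_derive_cont g d1 d2 c y : cl1 d1 -> cl1 d2 ->
  (forall x, 0 < x -> g x + prim d2 x = c + prim d1 x) -> 0 < y ->
  is_derive y 1 g (d1 y - d2 y).
Proof.
move=> c1 c2 H y0; apply: (@near_eq_is_derive _ _ _ (fun x => c + (prim d1 x - prim d2 x))).
  near=> x; rewrite addrA -H; first exact: addrK.
  by near: x; exact: lt_nbhsr.
have D := is_deriveB (prim_is_derive c1 y0) (prim_is_derive c2 y0).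
have := is_deriveD (is_derive_cst c y 1) D; by rewrite add0r.
Unshelve. all: by end_near. Qed.

(* The derivative is kept explicit, as it is differentiated once more below. *)
Lemma drift_rconv_C1 b f g d1 d2 c : 0 <= b -> cl1 f -> cl1 g -> cl1 d1 -> cl1 d2 ->
  0 <= c -> (forall x, 0 < x -> g x + prim d2 x = c + prim d1 x) ->
  let k y := b * g y + rconv f g y in
  let p y := b * (d1 y - d2 y) + (c * f y + rconv f d1 y - rconv f d2 y) in
  (forall y : R, 0 < y -> is_derive y 1 k (p y)) /\ (Ck 1 k /\ L1loc (derive1 k)).
Proof.
move=> b0 cf cg c1 c2 c0 H k p.
have c3 := cl1_rconv cf c1; have c4 := cl1_rconv cf c2.
have dk (y : R) : 0 < y -> is_derive y 1 k (p y).
  move=> y0; apply: is_deriveD; last exact: rconv_is_derive.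
  by apply: is_derive_scale; exact: (cl1_is_derive_cont c1 c2 H).
split => //; pose q y := b * (d1 y + d2 y) + (c * f y + rconv f d1 y + rconv f d2 y).
apply: (@Ck1_L1locP R k p q dk).
- move=> y y0; apply: cvgD.
    by apply: cvgM; [exact: cvg_cst|apply: cvgB; exact: cl1_cont].
  apply: cvgB; last exact: cl1_cont.
  by apply: cvgD; [apply: cvgM; [exact: cvg_cst|exact: cl1_cont]|exact: cl1_cont].
- by apply: cl1D; [apply: cl1Z => //; exact: cl1D|apply: cl1D => //; apply: cl1D => //; exact: cl1Z].
- move=> y y0; rewrite /p /q.
  have h1 := cl1_ge0 c1 y0; have h2 := cl1_ge0 c2 y0; have h3 := cl1_ge0 c3 y0.
  have h4 := cl1_ge0 c4 y0; have h5 := mulr_ge0 c0 (cl1_ge0 cf y0).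
  have h6 := mulr_ge0 b0 h1; have h7 := mulr_ge0 b0 h2.
  move: h3 h4 h5; set r1 := rconv _ _ _; set r2 := rconv _ _ _; set t := c * f y => h3 h4 h5.
  by rewrite ler_norml; apply/andP; split; move: h6 h7; set u := d1 y; set v := d2 y; lra.
Qed.

Section scale.
Variables (sigma m b : R) (Pi mu : {measure set RM -> \bar R}) (psi phi W : R -> R).
Hypotheses (psiN : in_N sigma m Pi psi) (phiB : in_B b mu phi) (WS : scale_function psi W).
Local Notation W1 := (derive1 W).
Local Notation h := (tail mu).
Local Notation k := (kappa b mu W).

Let muL : levy mu. Proof. exact: B_levy phiB. Qed.
Let nih x y : 0 < x -> x <= y -> h y <= h x. Proof. exact: (tail_nonincreasing muL). Qed.
Let b0 : 0 <= b. Proof. exact: B_b phiB. Qed.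
Let cW : cl1 W1. Proof. exact: cl1_scale_derive WS. Qed.
Let c00 : cl1 (fun=> 0 : R). Proof. exact: cl1_cst. Qed.
Let p0 x : prim (fun=> 0 : R) x = 0. Proof. by rewrite /prim /Rintegral integral0_eq. Qed.
Let r0 f x : rconv f (fun=> 0) x = 0.
Proof.
rewrite /rconv /convol integral0_eq// => r _.
by rewrite {2}/restr; case: ifP => _; rewrite mule0.
Qed.

Lemma cl1_tail : Ck 0 h -> cl1 h.
Proof.
move=> [_ ch]; split => [x x0|x x0|a]; [exact: tail_ge0|exact: ch|].
rewrite integral_restr_itv -(integral_cutoff _ (causal_tail muL)).
exact: (B_tail_integrable phiB).
Qed.

Lemma Ck1_is_derive f y : Ck 1 f -> 0 < y -> is_derive y 1 f (derive1 f y).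
Proof. by move=> [df _] y0; rewrite derive1E; apply: DeriveDef => //; exact: (df 0%N). Qed.

Lemma Ck1_Ck0 f : Ck 1 f -> Ck 0 f.
Proof.
move=> cf; split => // y y0.
by have H := Ck1_is_derive cf y0; exact: (is_derive_continuous H).
Qed.

Lemma tail_derive_le0 x : Ck 1 h -> 0 < x -> derive1 h x <= 0.
Proof.
move=> ch x0; apply: (nonincreasing_derive_le0 x0 nih) => y y0.
exact: Ck1_is_derive.
Qed.

(** The tail in the form required by [rconv_is_derive]: c is its limit at 0, d = - h' its
    nonnegative rate of decrease, integrable because h is bounded. *)
Lemma bounded_tail_decomposition : Ck 1 h -> (lim0 h < +oo)%E ->
  exists (d : R -> R) (c : R), [/\ cl1 d, 0 <= c, forall x, d x = - derive1 h x &
    forall x, 0 < x -> h x + prim d x = c + prim (fun=> 0) x].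
Proof.
move=> ch /(tail_lim0_fin phiB)[c c0 [hc hle]]; exists (fun x => - derive1 h x), c.
have dN (x : R) : 0 < x -> is_derive x 1 (fun x => - h x) (- derive1 h x).
  by move=> x0; apply: is_deriveN; exact: Ck1_is_derive.
have cd : cl1 (fun x => - derive1 h x).
  apply: (@cl1_of_derive R _ (fun x => - h x) (- c)) => x x0.
  - by rewrite oppr_ge0 tail_derive_le0.
  - by apply: cvgN; exact: ch.2.
  - by rewrite lerN2 hle.
split => // x x0; have hN : - h x @[x --> 0^'+] --> - c by apply: cvgN.
have := prim_eq cd dN hN x0; rewrite p0 addr0.
by set u := h x; set v := prim _ _; lra.
Qed.

(** The convolution is differentiated through the tail, finite at 0, so that W' may be singular
    there and no second derivative of W occurs. *)
Lemma kappa_C1_bounded_tail : b = 0 -> (lim0 h < +oo)%E -> Ck 1 h ->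
  Ck 1 k /\ L1loc (derive1 k).
Proof.
move=> bz hl ch; have [d [c [cd c0 _ H]]] := bounded_tail_decomposition ch hl.
have cT := cl1_tail (Ck1_Ck0 ch).
have [_] := drift_rconv_C1 (lexx 0) cW cT c00 cd c0 H.
rewrite (_ : (fun y => _) = k)//; apply/funext => y.
by rewrite (kappaE phiB WS) bz (rconvC cW cT) !mul0r.
Qed.

(** Here the derivative falls on W', so a continuous tail is enough. The derivative found contains
    h, h * d1 and h * d2; a C^1 bounded tail lets it be differentiated again, this time through
    h. *)
Lemma kappa_C1_gaussian : 0 < sigma -> Ck 0 h ->
  (Ck 1 k /\ L1loc (derive1 k)) /\ (b = 0 -> (lim0 h < +oo)%E -> Ck 1 h -> Ck 2 k).
Proof.
move=> s0 ch; have cT := cl1_tail ch.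
have [d1 [d2 [c1 c2 H]]] := scale_derive_decomposition psiN WS s0.
have c0 : 0 <= (sigma ^+ 2)^-1 by rewrite invr_ge0 sqr_ge0.
have E : (fun y => b * W1 y + rconv h W1 y) = k.
  by apply/funext => y; rewrite (kappaE phiB WS).
have [] := drift_rconv_C1 b0 cT cW c1 c2 c0 H.
rewrite E => dk K1; split; first exact: K1.
move=> bz hl ch1.
apply: Ck2P dk _.
have [e [l [ce l0 eE He]]] := bounded_tail_decomposition ch1 hl.
have i1 := (drift_rconv_C1 (lexx 0) c1 cT c00 ce l0 He).1.
have i2 := (drift_rconv_C1 (lexx 0) c2 cT c00 ce l0 He).1.
have E3 f : cl1 f -> rconv h f = (fun y => 0 * h y + rconv f h y).
  by move=> cf; apply/funext => y; rewrite mul0r add0r rconvC.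
pose s f y := 0 * (0 - e y) + (l * f y + rconv f (fun=> 0) y - rconv f e y).
have cs f : cl1 f -> forall y, 0 < y -> {for y, continuous (s f)}.
  move=> cf y y0; apply: cvgD.
    by apply: cvgM; [exact: cvg_cst|apply: cvgB; [exact: cvg_cst|exact: cl1_cont]].
  apply: cvgB; last exact: (cl1_cont (cl1_rconv cf ce) y0).
  by apply: cvgD; [apply: cvgM; [exact: cvg_cst|exact: cl1_cont]|exact: (cl1_cont (cl1_rconv cf c00) y0)].
apply: (@Ck1P R _ (fun y => (sigma ^+ 2)^-1 * derive1 h y + s d1 y - s d2 y)); last first.
  move=> y y0; apply: cvgB; last exact: cs.
  apply: cvgD; last exact: cs.
  by apply: cvgM; [exact: cvg_cst|exact: ch1.2].
move=> y y0; rewrite bz.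
have -> : (fun y : R => 0 * (d1 y - d2 y) + ((sigma ^+ 2)^-1 * h y + rconv h d1 y - rconv h d2 y)) =
  (fun y : R => (sigma ^+ 2)^-1 * h y + rconv h d1 y - rconv h d2 y).
  by apply/funext => z; rewrite mul0r add0r.
apply: is_deriveB; last by rewrite (E3 _ c2); exact: i2.
apply: is_deriveD; last by rewrite (E3 _ c1); exact: i1.
by apply: is_derive_scale; exact: Ck1_is_derive.
Qed.

End scale.
End Smoothness.

(** * Differentiating a half-convolution through its regular factor *)

Section HalfConvolutionPrimitive.
Context {R : realType}.
Local Notation leb := (@lebesgue_measure R).
Local Notation RM := (measurableTypeR R).
Implicit Types (x y z a c M l r s Y : R) (f g h n p G N V : R -> R).

Lemma measurable_pos_itv f (i : interval R) : (forall x, 0 < x -> {for x, continuous f}) ->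
  [set` i] `<=` `]0, +oo[%classic -> measurable_fun ([set` i] : set RM) f.
Proof. by move=> cf iS; apply: measurable_funS (continuous_pos_measurable cf). Qed.

(** For fixed r, the integrand of the half-convolution in the variable s = z - r: the conditions z <
    Y and 2 r < z become r < s < Y - r. *)
Definition window n r Y : RM -> \bar R :=
  fun s => (if s < Y - r then zext n s * theta (s - r) else 0)%:E.

Lemma measurable_window n r Y : (forall x, 0 < x -> 0 <= n x) ->
  (forall x, 0 < x -> {for x, continuous n}) -> measurable_fun setT (window n r Y).
Proof.
move=> n0 cn; apply/measurable_EFinP; apply: measurable_fun_if => //.
  exact: measurable_fun_ltr.
apply: measurable_funTS; apply: measurable_funM.
  exact: (causal_measurable_zext (pos_continuous_causal n0 cn)).
by apply: (measurableT_comp measurable_theta); exact: measurable_funB.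
Qed.

Lemma window_ge0 n r Y s : (forall x, 0 < x -> 0 <= n x) -> (0 <= window n r Y s)%E.
Proof.
move=> n0; rewrite lee_fin; case: ifP => // _.
by rewrite mulr_ge0 ?zext_ge0//; have /andP[] := theta01 (s - r).
Qed.

Lemma integral_window n N r Y : 0 < r -> (forall x, 0 < x -> 0 <= n x) ->
  (forall x, 0 < x -> {for x, continuous n}) ->
  (forall x : R, 0 < x -> is_derive x 1 N (n x)) ->
  (\int[leb]_s window n r Y s = (if (r < Y / 2)%R then N (Y - r) - N r else 0%R)%:E)%E.
Proof.
move=> r0 n0 cn dN.
have E : window n r Y = (window n r Y \_ `[r, (Y - r)%R[)%E.
  apply/funext => s; rewrite patchE; case: ifPn => // /negP; rewrite inE/= in_itv/= => H.
  rewrite /window; case: ifPn => // sY; have sr : s < r.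
    by rewrite ltNge; apply/negP => rs; apply: H; rewrite rs.
  by rewrite theta_lt0 ?mulr0// subr_lt0.
rewrite E -integral_mkcond; case: ifPn => [rY|]; last first.
  rewrite -leNgt => Yr; rewrite set_itv_ge ?integral_set0// bnd_simp -leNgt; lra.
have rY2 : r <= Y - r by lra.
rewrite -(integral_derive r0 rY2 cn dN) [LHS]integral_itv_bndoo; last first.
  exact: measurable_funTS (measurable_window r Y n0 cn).
have mn : measurable_fun (`]r, (Y - r)%R[ : set RM) (fun s => (n s)%:E).
  apply/measurable_EFinP; apply: (measurable_pos_itv cn) => s /=.
  by rewrite !in_itv/= andbT => /andP[rs _]; exact: lt_trans rs.
rewrite [RHS]integral_itv_bndoo//; apply: eq_integral => s.
rewrite inE/= in_itv/= => /andP[rs sY]; rewrite /window sY theta_gt0 ?subr_gt0// mulr1 zextE//.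
exact: lt_trans rs.
Qed.

Definition hcr f n := fun y => fine (hc f n y).

Definition hcprim f N Y : RM -> \bar R :=
  fun r => (restr f r * (if r < Y / 2 then N (Y - r) - N r else 0)%R%:E)%E.

Lemma causal_hcr f n : cl1 f -> (forall x, 0 < x -> 0 <= n x) ->
  (forall x, 0 < x -> {for x, continuous n}) -> causal (restr (hcr f n)).
Proof.
move=> cf n0 cn; apply: pos_continuous_causal => x x0; last exact: hc_continuous.
by apply: fine_ge0; exact: hc_ge0.
Qed.

(** Tonelli integrates in z first; the window then contributes N(Y - r) - N(r), so n need not be
    integrable at 0. *)
Lemma integral_hc f n N Y : cl1 f -> (forall x, 0 < x -> 0 <= n x) ->
  (forall x, 0 < x -> {for x, continuous n}) ->
  (forall x : R, 0 < x -> is_derive x 1 N (n x)) ->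
  (\int[leb]_z cutoff Y (restr (hcr f n)) z = \int[leb]_r hcprim f N Y r)%E.
Proof.
move=> cf n0 cn dN; have Cf := cl1_causal cf; have Cn := pos_continuous_causal n0 cn.
have f0 := cl1_ge0 cf.
pose F (u : RM * RM) : \bar R :=
  (if u.1 < Y then zext f u.2 * (zext n (u.1 - u.2) * theta (u.1 - 2 * u.2)) else 0)%:E.
have F0 u : (0 <= F u)%E.
  by rewrite lee_fin; case: ifP => // _; rewrite hc_integrand_ge0.
have mF : measurable_fun setT F.
  apply/measurable_EFinP; apply: measurable_fun_if => //.
    by apply: measurable_fun_ltr => //; exact: measurable_fst.
  apply: measurable_funTS; apply: measurable_funM.
    exact: (measurableT_comp (causal_measurable_zext Cf) (@measurable_snd _ _ RM RM)).
  apply: measurable_funM.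
    apply: (measurableT_comp (causal_measurable_zext Cn)).
    by apply: measurable_funB; [exact: measurable_fst|exact: measurable_snd].
  apply: (measurableT_comp measurable_theta); apply: measurable_funB; first exact: measurable_fst.
  by apply: measurable_funM => //; exact: measurable_snd.
have sfl : sigma_finite setT leb by exact: sigma_finiteT.
transitivity (\int[leb]_x \int[leb]_y F (x, y))%E.
  apply: eq_integral => z _; rewrite /cutoff /F/=; case: ifPn => zY; last first.
    by rewrite integral0.
  have [z0|z0] := leP z 0; last first.
    by rewrite (restrE _ z0); exact: (fineK (hc_fin_num cf n0 cn z0)).
  rewrite (causal_le0 (causal_hcr cf n0 cn) z0); apply/esym.
  rewrite integral0_eq// => r _; have [r0|r0] := leP r 0; first by rewrite zext0// mul0r.
  by rewrite theta_lt0 ?mulr0//; lra.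
rewrite (lebesgue_tonelli sfl mF F0) {sfl mF F0}; apply: eq_integral => r _; rewrite /hcprim; have [r0|r0] := leP r 0.
  rewrite (causal_le0 Cf r0) mul0e integral0_eq// => z _; rewrite /F/=.
  by case: ifP => // _; rewrite zext0// mul0r.
rewrite (restrE _ r0) -(integral_window Y r0 n0 cn dN).
rewrite -(integral_translation (- r) (measurable_window r Y n0 cn) (fun s => window_ge0 r Y s n0)).
rewrite -ge0_integralZl_EFin//; first last.
- exact: f0.
- apply: (measurableT_comp (measurable_window r Y n0 cn)).
  exact: measurable_funD.
- by move=> s _; exact: window_ge0.
apply: eq_integral => z _; rewrite /F /window/= -EFinM; congr EFin.
rewrite (addrC (- r)) ltrD2r; case: ifP => _; last by rewrite mulr0.
by rewrite zextE//; congr (_ * (_ * theta _)); ring.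
Qed.

Lemma hcE f G y : cl1 f -> (forall x, 0 < x -> 0 <= G x) ->
  (forall x, 0 < x -> {for x, continuous G}) -> 0 < y ->
  (hc f G y = \int[leb]_(r in `]0%R, (y / 2)%R[) (f r * G (y - r)%R)%:E)%E.
Proof.
move=> cf G0 cG y0; have Cf := cl1_causal cf; have CG := pos_continuous_causal G0 cG.
pose F : RM -> \bar R := fun r => (zext f r * (zext G (y - r) * theta (y - 2 * r)))%:E.
have mF : measurable_fun setT F by apply/measurable_EFinP; exact: measurable_hc_integrand.
have E : F = (F \_ `]0%R, (y / 2)%R])%E.
  apply/funext => r; rewrite patchE; case: ifPn => // /negP; rewrite inE/= in_itv/= => H.
  rewrite /F; have [r0|r0] := leP r 0; first by rewrite zext0// mul0r.
  rewrite theta_lt0 ?mulr0//; have : ~ (r <= y / 2) by move=> ry; apply: H; rewrite r0.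
  by move/negP; rewrite -ltNge; lra.
rewrite /hc -/F E -integral_mkcond integral_itv_bndoo; last exact: measurable_funTS.
apply: eq_integral => r; rewrite inE/= in_itv/= => /andP[r0 ry].
by rewrite /F !zextE ?theta_gt0 ?mulr1//; lra.
Qed.

Section primitive.
Variables f G p n : R -> R.
Hypotheses (cf : cl1 f) (G0 : forall x, 0 < x -> 0 <= G x) (cp : cl1 p)
  (n0 : forall x, 0 < x -> 0 <= n x) (cn : forall x, 0 < x -> {for x, continuous n})
  (dG : forall x : R, 0 < x -> is_derive x 1 G (p x - n x))
  (cfG : cl1 (fun x => f x * G x)).

Let cG x : 0 < x -> {for x, continuous G}.
Proof. by move=> x0; have H := dG x0; exact: (is_derive_continuous H). Qed.

(** A primitive of n = p - G' that does not integrate n down to 0, where n may fail to be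
    integrable. *)
Let N x := prim p x - G x.

Let dN (x : R) : 0 < x -> is_derive x 1 N (n x).
Proof.
move=> x0; rewrite (_ : n x = p x - (p x - n x)); last by rewrite subKr.
by apply: is_deriveB; [exact: prim_is_derive|exact: dG].
Qed.

Let dP (x : R) : 0 < x -> is_derive x 1 (prim p) (p x).
Proof. exact: prim_is_derive. Qed.

Let mitv g b : (forall x, 0 < x -> x < b -> {for x, continuous g}) ->
  measurable_fun (`]0, b[ : set RM) (EFin \o g).
Proof.
move=> cg; apply/measurable_EFinP; apply: open_continuous_measurable_fun.
  exact: interval_open.
by move=> x; rewrite inE/= in_itv/= => /andP[x0 xb]; exact: cg.
Qed.

Let continuous_reflection g Y x : x < Y -> (forall x, 0 < x -> {for x, continuous g}) ->
  {for x, continuous (fun r => g (Y - r))}.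
Proof.
move=> xY cg; apply: (@continuous_comp _ _ _ (fun r => Y - r) g).
  by apply: cvgB; [exact: cvg_cst|exact: cvg_id].
by apply: cg; rewrite subr_gt0.
Qed.

Let integral_hcprim V Y : (\int[leb]_r hcprim f V Y r =
  \int[leb]_(r in `]0%R, (Y / 2)%R[) (f r * (V (Y - r) - V r))%:E)%E.
Proof.
rewrite [RHS]integral_mkcond; apply: eq_integral => r _; rewrite patchE /hcprim.
have [r0|r0] := leP r 0.
  by rewrite (causal_le0 (cl1_causal cf) r0) mul0e memNset//= in_itv/= ltNge r0.
case: ifPn => rY; first by rewrite mem_set/= ?in_itv/= ?r0//(restrE _ r0).
by rewrite mule0 memNset//= in_itv/= r0/=; exact/negP.
Qed.

Let increment_ge0 V (m : R -> R) r s : 0 < r -> r <= s -> (forall x, 0 < x -> 0 <= m x) ->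
  (forall x, 0 < x -> {for x, continuous m}) ->
  (forall x : R, 0 < x -> is_derive x 1 V (m x)) -> 0 <= V s - V r.
Proof.
move=> r0 rs m0 cm dM; rewrite -lee_fin -(integral_derive r0 rs cm dM).
apply: integral_ge0 => x /=; rewrite in_itv/= => /andP[rx _]; rewrite lee_fin m0//.
exact: lt_le_trans rx.
Qed.

(** The integrated form of the derivative of [hc f G], arranged so that every term is nonnegative;
    pointwise it is the identity N = prim p - G. *)
Let half_balance Y : 0 < Y ->
  (\int[leb]_r hcprim f (prim p) Y r + \int[leb]_r cutoff (Y / 2) (restr (fun x => f x * G x)%R) r =
   \int[leb]_r hcprim f N Y r + hc f G Y)%E.
Proof.
move=> Y0; have CfG := cl1_causal cfG.
rewrite !integral_hcprim (integral_cutoff _ CfG) -integral_restr_itv (hcE cf G0 cG Y0).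
have cP x : 0 < x -> {for x, continuous (prim p)}.
  by move=> x0; have H := dP x0; exact: (is_derive_continuous H).
have cN x : 0 < x -> {for x, continuous N}.
  by move=> x0; have H := dN x0; exact: (is_derive_continuous H).
have c1 V : (forall x, 0 < x -> {for x, continuous V}) ->
    measurable_fun (`]0, (Y / 2)[ : set RM) (fun r => (f r * (V (Y - r) - V r))%:E).
  move=> cM; apply: mitv => x x0 xY; apply: cvgM; first exact: cl1_cont.
  by apply: cvgB; [apply: continuous_reflection => //; lra|exact: cM].
have i0 V (q : R -> R) : (forall x, 0 < x -> 0 <= q x) -> (forall x, 0 < x -> {for x, continuous q}) ->
    (forall x : R, 0 < x -> is_derive x 1 V (q x)) ->
    forall r, r \in `]0, (Y / 2)[ -> (0 <= (f r * (V (Y - r) - V r))%:E)%E.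
  move=> q0 cq dM r /=; rewrite in_itv/= => /andP[r0 rY].
  rewrite lee_fin mulr_ge0//; first exact: cl1_ge0.
  by apply: (increment_ge0 r0 _ q0 cq dM); lra.
rewrite -ge0_integralD//; first last.
- by apply: mitv => x x0 _; exact: cl1_cont.
- by move=> r /=; rewrite in_itv/= => /andP[r0 _]; rewrite lee_fin; exact: (cl1_ge0 cfG).
- exact: c1.
- by apply: (i0 _ p) => //; [exact: cl1_ge0|exact: cl1_cont].
rewrite -ge0_integralD//; first last.
- apply: mitv => x x0 xY; apply: cvgM; first exact: cl1_cont.
  by apply: continuous_reflection => //; lra.
- move=> r /=; rewrite in_itv/= => /andP[r0 rY]; rewrite lee_fin mulr_ge0//; first exact: cl1_ge0.
  by apply: G0; lra.
- exact: c1.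
- exact: (i0 _ n).
by apply: eq_integral => r _; rewrite -!EFinD; congr EFin; rewrite /N; ring.
Qed.

Lemma cl1_hcr_cl1 : cl1 (hcr f p).
Proof.
have [p0 c_p _] := cp; have Cf := cl1_causal cf; have Cp := cl1_causal cp.
apply: cl1_dom => [x x0|x x0|a]; [by apply: fine_ge0; exact: hc_ge0|exact: hc_continuous|].
exists (rconv f p) => [|x x0 _]; first exact: cl1_rconv.
rewrite /hcr /rconv (convol_half x Cf Cp (cl1_ge0 cf) p0).
have h1 := hc_fin_num cf p0 c_p x0.
have h2 := hc_fin_num cp (cl1_ge0 cf) (cl1_cont cf) x0.
by rewrite (fineD h1 h2) lerDl; apply: fine_ge0; apply: hc_ge0 => //; exact: cl1_ge0.
Qed.

Let balance Y : 0 < Y ->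
  ((prim (hcr f p) Y + prim (fun x => f x * G x) (Y / 2))%:E =
   \int[leb]_z cutoff Y (restr (hcr f n)) z + (hcr f G Y)%:E)%E.
Proof.
move=> Y0; have [p0 c_p _] := cp.
rewrite (integral_hc Y cf n0 cn dN) {2}/hcr (fineK (hc_fin_num cf G0 cG Y0)).
rewrite -half_balance// -(integral_hc Y cf p0 c_p dP) EFinD.
by rewrite -(prim_cutoff _ cl1_hcr_cl1) -(prim_cutoff _ cfG).
Qed.

(** Integrability near 0 is read off from [balance]: the integral is bounded by a sum of two finite
    primitives. *)
Lemma cl1_hcr : cl1 (hcr f n).
Proof.
have C := causal_hcr cf n0 cn; split.
- by move=> x x0; apply: fine_ge0; exact: hc_ge0.
- by move=> x x0; exact: hc_continuous.
move=> a; rewrite integral_restr_itv -(integral_cutoff _ C).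
have [a0|a0] := leP a 0.
  rewrite integral0_eq ?ltry// => x _; rewrite /cutoff; case: ifPn => // xa.
  by rewrite (causal_le0 C)//; lra.
apply: le_lt_trans (ltry (prim (hcr f p) a + prim (fun x => f x * G x) (a / 2))).
by rewrite balance// leeDl// lee_fin; apply: fine_ge0; exact: hc_ge0.
Qed.

(** Besides f paired with G' = p - n, the moving endpoint y / 2 contributes half of f G at y / 2. *)
Lemma hcr_is_derive (y : R) : 0 < y ->
  is_derive y 1 (hcr f G) (hcr f p y + 2^-1 * (f (y / 2) * G (y / 2)) - hcr f n y).
Proof.
move=> y0; have y2 : 0 < y / 2 by rewrite divr_gt0.
pose H z := prim (hcr f p) z + prim (fun x => f x * G x) (z * 2^-1) - prim (hcr f n) z.
apply: (@near_eq_is_derive _ _ _ H).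
  near=> z; have z0 : 0 < z by near: z; exact: lt_nbhsr.
  rewrite /H (_ : prim (hcr f p) z + _ = prim (hcr f n) z + hcr f G z); first by rewrite addrC addKr.
  by apply: EFin_inj; rewrite (balance z0) -(prim_cutoff _ cl1_hcr) -EFinD.
apply: is_deriveB; last exact: (prim_is_derive cl1_hcr y0).
apply: is_deriveD; first exact: (prim_is_derive cl1_hcr_cl1 y0).
have d2 : is_derive y 1 (fun z : R => z * 2^-1) 2^-1.
  have -> : (fun z : R => z * 2^-1) = (fun z : R => 2^-1 * z) by apply/funext => z; rewrite mulrC.
  by rewrite -[X in is_derive _ _ _ X]mulr1; exact: is_derive_scale.
rewrite [X in is_derive _ _ _ X]mulrC.
exact: (@is_derive1_comp R (prim (fun x => f x * G x)) (fun z => z * 2^-1) y _ _ (prim_is_derive cfG y2) d2).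
Unshelve. all: by end_near. Qed.

End primitive.
End HalfConvolutionPrimitive.

(** * An unbounded tail of mu with sigma = 0 *)

Section UnboundedTail.
Context {R : realType}.
Local Notation leb := (@lebesgue_measure R).
Local Notation RM := (measurableTypeR R).
Implicit Types (x y z a c l : R) (f g h n p : R -> R).

Lemma cl1_near0 f (d : R) : 0 < d -> (forall x, 0 < x -> 0 <= f x) ->
  (forall x, 0 < x -> {for x, continuous f}) ->
  (\int[leb]_(x in `]0%R, d[) (f x)%:E < +oo)%E -> cl1 f.
Proof.
move=> d0 f0 cf fi; split => // a; have C := pos_continuous_causal f0 cf.
have [M [M0 fM]] := continuous_segment_bounded a d0 cf.
have CM := cl1_causal (cl1_cst M0).
rewrite integral_restr_itv -(integral_cutoff _ C).
rewrite integral_restr_itv -(integral_cutoff _ C) in fi.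
have Ca := causal_cutoff a C; have Cd := causal_cutoff d C; have CaM := causal_cutoff a CM.
apply: (@le_lt_trans _ _ (\int[leb]_x (cutoff d (restr f) x + cutoff a (restr (fun=> M)) x))%E).
  apply: le_integral_causal => // [|x x0]; first exact: causal_add.
  have Md := causal_ge0 Cd x; have MM := causal_ge0 CaM x.
  have [xd|xd] := ltP x d.
    apply: (@le_trans _ _ (cutoff d (restr f) x)); last by rewrite leeDl.
    by rewrite /cutoff xd; case: ifP => // _; exact: (causal_ge0 C).
  apply: (@le_trans _ _ (cutoff a (restr (fun=> M)) x)); last by rewrite leeDr.
  rewrite /cutoff; case: ifPn => // xa; rewrite !(restrE _ x0) lee_fin fM//.
  by rewrite xd ltW.
rewrite (integral_causalD Cd CaM).
by rewrite -(prim_cutoff _ (cl1_cst M0)) lte_add_pinfty// ltry.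
Qed.

Lemma cl1_half f : cl1 f -> cl1 (fun y => 2^-1 * f (y / 2)).
Proof.
move=> cf; have h2 x : 0 < x -> 0 < x / 2 by move=> x0; rewrite divr_gt0.
have d2 (y : R) : is_derive y 1 (fun z : R => z / 2) 2^-1.
  have -> : (fun z : R => z / 2) = (fun z : R => 2^-1 * z) by apply/funext => z; rewrite mulrC.
  by rewrite -[X in is_derive _ _ _ X]mulr1; exact: is_derive_scale.
have cs x : {for x, continuous (fun z => z / 2)} by have H := d2 x; exact: (is_derive_continuous H).
apply: (@cl1_of_derive R _ (fun y => prim f (y / 2)) 0) => x x0.
- by rewrite mulr_ge0//; apply: (cl1_ge0 cf); exact: h2.
- apply: cvgM; first exact: cvg_cst.
  by apply: (@continuous_comp _ _ _ (fun z => z / 2) f); [exact: cs|apply: (cl1_cont cf); exact: h2].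
- rewrite [X in is_derive _ _ _ X]mulrC.
  exact: (@is_derive1_comp R (prim f) (fun z => z / 2) x _ _ (prim_is_derive cf (h2 _ x0)) (d2 x)).
- exact: prim_ge0.
Qed.

Section scale.
Variables (m b : R) (Pi mu : {measure set RM -> \bar R}) (psi phi W : R -> R).
Hypotheses (psiN : in_N 0 m Pi psi) (phiB : in_B b mu phi) (WS : scale_function psi W).
Local Notation W1 := (derive1 W).
Local Notation K := (levyK m Pi).
Local Notation h := (tail mu).
Local Notation k := (kappa b mu W).
Local Notation I := (prim (tail2 Pi)).

Let PL := N_levy psiN.
Let P2 := N_tail_integrable psiN.
Let t2K x : tail2 Pi x <= K x.
Proof. by rewrite lerDr ltW// (N_m psiN). Qed.

Lemma cl1_tail2 : cl1 (tail2 Pi).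
Proof.
apply: cl1_dom => [x _|x x0|a]; [exact: tail2_ge0|exact: (tail2_continuous PL P2)|].
by exists K => //; exact: cl1_levyK psiN.
Qed.

(** Otherwise monotonicity makes [tail2 Pi] vanish everywhere, so that K = m and [scale_lower]
    forces W >= 1 / m, contradicting W(0+) = 0. *)
Lemma prim_tail2_gt0 y : 0 < y -> 0 < I y.
Proof.
move=> y0; rewrite ltNge; apply/negP => Iy.
have cT := cl1_tail2; have cK := cl1_levyK psiN; have nit := tail2_nonincreasing PL P2.
have m0 := N_m psiN; have cm := cl1_cst (ltW m0).
have t0 z : 0 < z -> tail2 Pi z <= 0.
  move=> z0; pose w := Num.min y z; have w0 : 0 < w by rewrite lt_min y0.
  apply: (@le_trans _ _ (tail2 Pi w)); first by apply: nit => //; rewrite ge_min lexx orbT.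
  rewrite -(ler_pM2l w0) mulr0; apply: le_trans (prim_ge_nonincreasing cT nit w0) _.
  by apply: le_trans Iy; apply: prim_nondecreasing => //; rewrite ge_min lexx.
have KM z : 0 < z -> prim K z <= m * z.
  move=> z0; rewrite -(prim_cst m z0).
  by apply: prim_le_dom => // x x0 _; rewrite /levyK gerDl t0.
have [z z0 Wz] : exists2 z, 0 < z & W z < m^-1.
  by apply: (scale_small psiN WS); rewrite invr_gt0.
have := scale_lower psiN WS z0; rewrite leNgt => /negP; apply.
apply: (@le_lt_trans _ _ (W z * (m * z))).
  by rewrite ler_wpM2l// ?KM// (scale_ge0 WS)// ltW.
by rewrite mulrA -[ltRHS]mul1r ltr_pM2r// -ltr_pdivlMr// mul1r.
Qed.

(** From [scale_upper] and [tail2 Pi] <= K. This bound translates the integral condition on the tail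
    into the integrability of - W h' near 0. *)
Lemma scale_le_prim_tail2 y : 0 < y -> W y <= 2 * (y / I y).
Proof.
move=> y0; rewrite mulrA ler_pdivlMr ?prim_tail2_gt0//.
apply: le_trans _ (scale_upper psiN WS y0); apply: ler_wpM2l.
  by rewrite (scale_ge0 WS)// ltW.
by apply: prim_le_dom => //; [exact: cl1_tail2|exact: (cl1_levyK psiN)].
Qed.

Section regular.
Hypotheses (ch : Ck 1 h) (cg : Ck 1 W1).
Variable d : R.
Hypotheses (d0 : 0 < d) (g0 : forall y, 0 < y < d -> derive1n 2 W y <= 0)
  (hi : (- (\int[leb]_(y in `]0%R, d[) (y * derive1 h y / I y)%:E) < +oo)%E).

Let cW : cl1 W1. Proof. exact: cl1_scale_derive WS. Qed.
Let cT : cl1 h. Proof. exact: cl1_tail phiB (Ck1_Ck0 ch). Qed.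
Let e x := - derive1 h x.
Let e0 x : 0 < x -> 0 <= e x.
Proof. by move=> x0; rewrite oppr_ge0; exact: (tail_derive_le0 phiB). Qed.
Let ce x : 0 < x -> {for x, continuous e}.
Proof. by move=> x0; apply: cvgN; exact: ch.2. Qed.

Lemma cl1_scale_tail_derive : cl1 (fun x => W x * e x).
Proof.
have W0 x : 0 < x -> 0 <= W x by move=> x0; rewrite (scale_ge0 WS)// ltW.
have cWe x : 0 < x -> {for x, continuous (fun x => W x * e x)}.
  by move=> x0; apply: cvgM; [exact: (scale_function_continuous WS)|exact: ce].
apply: (cl1_near0 d0) => //; first by move=> x x0; rewrite mulr_ge0 ?e0 ?W0.
pose q x := x / I x * e x.
have q0 x : 0 < x -> 0 <= q x.
  by move=> x0; rewrite mulr_ge0 ?e0// divr_ge0 ?ltW// prim_tail2_gt0.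
have cq x : 0 < x -> {for x, continuous q}.
  move=> x0; apply: cvgM; last exact: ce.
  apply: cvgM; first exact: cvg_id.
  apply: cvgV; first by rewrite gt_eqF// prim_tail2_gt0.
  by have H := prim_is_derive cl1_tail2 x0; exact: (is_derive_continuous H).
have dS : `]0, d[ `<=` (`]0, +oo[ : set RM).
  by move=> x /=; rewrite !in_itv/= => /andP[->].
have mq : measurable_fun (`]0, d[ : set RM) (EFin \o q).
  by apply/measurable_EFinP; exact: measurable_pos_itv cq dS.
have q0i x : (`]0%R, d[%classic : set RM) x -> (0 <= (q x)%:E)%E.
  by rewrite /= in_itv/= => /andP[x0 _]; rewrite lee_fin q0.
have qi : (\int[leb]_(x in `]0%R, d[) (q x)%:E < +oo)%E.
  suff E : (\int[leb]_(x in `]0%R, d[) (q x)%:E =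
      - \int[leb]_(y in `]0%R, d[) (y * derive1 h y / I y)%:E)%E by rewrite E; exact: hi.
  rewrite -[LHS]oppeK -(integral_ge0N leb q0i); congr (- _)%E.
  by apply: eq_integral => x _; rewrite -EFinN; congr EFin; rewrite /q /e; ring.
apply: (@le_lt_trans _ _ (\int[leb]_(x in `]0%R, d[) (2%:E * (q x)%:E))%E).
  apply: ge0_le_integral => //.
  - by move=> x /=; rewrite in_itv/= => /andP[x0 _]; rewrite lee_fin mulr_ge0 ?e0 ?W0.
  - by apply/measurable_EFinP; exact: measurable_pos_itv cWe dS.
  - exact: measurable_funeM.
  - move=> x /=; rewrite in_itv/= => /andP[x0 _]; rewrite -EFinM lee_fin /q mulrA.
    by rewrite ler_wpM2r ?e0// scale_le_prim_tail2.
by rewrite ge0_integralZl_EFin// lte_mul_pinfty.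
Qed.

Let dh (x : R) : 0 < x -> is_derive x 1 h (derive1 h x).
Proof. exact: Ck1_is_derive. Qed.

(* Integration by parts: [W1 * h] has the primitive [W * h + prim (W * e)]. *)
Lemma cl1_scale_derive_tail : cl1 (fun x => W1 x * h x).
Proof.
have cWe := cl1_scale_tail_derive.
apply: (@cl1_of_derive R _ (fun x => W x * h x + prim (fun x => W x * e x) x) 0) => x x0.
- by apply: mulr_ge0; [exact: cl1_ge0|exact: cl1_ge0].
- by apply: cvgM; exact: cl1_cont.
- have D := is_deriveM (scale_is_derive WS x0) (dh x0).
  have := is_deriveD D (prim_is_derive cWe x0).
  rewrite (_ : _ + _ = W1 x * h x)//.
  by rewrite -[_ *: derive1 h x]/(_ * _) -[_ *: W1 x]/(_ * _) /e; ring.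
- by rewrite addr_ge0 ?prim_ge0// mulr_ge0 ?tail_ge0// (scale_ge0 WS)// ltW.
Qed.

Let g1 := derive1 W1.
(** Positive and negative parts of W''. The sign condition makes p vanish near 0, so p is in [cl1];
    n is not integrable there, since W'(0+) = +oo. *)
Let p x := 2^-1 * (`|g1 x| + g1 x).
Let n x := 2^-1 * (`|g1 x| - g1 x).

Let cg1 x : 0 < x -> {for x, continuous g1}.
Proof. by move=> x0; exact: cg.2. Qed.

Let cn1 x : 0 < x -> {for x, continuous (fun x => `|g1 x|)}.
Proof. by move=> x0; apply: cvg_norm; exact: cg1. Qed.

Let cn x : 0 < x -> {for x, continuous n}.
Proof.
by move=> x0; apply: cvgM; [exact: cvg_cst|apply: cvgB; [exact: cn1|exact: cg1]].
Qed.

Let n0 x : 0 < x -> 0 <= n x.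
Proof. by move=> _; rewrite mulr_ge0// subr_ge0 ler_norm. Qed.

Let cp : cl1 p.
Proof.
apply: (cl1_near0 d0).
- by move=> x _; rewrite mulr_ge0//; have := ler_norm (- g1 x); rewrite normrN; lra.
- by move=> x x0; apply: cvgM; [exact: cvg_cst|apply: cvgD; [exact: cn1|exact: cg1]].
- rewrite integral0_eq// => x /=; rewrite in_itv/= => x0d; rewrite /p ler0_norm.
    by rewrite addNr mulr0.
  exact: g0.
Qed.

Let dg (x : R) : 0 < x -> is_derive x 1 W1 (p x - n x).
Proof.
move=> x0; rewrite (_ : p x - n x = derive1 W1 x); first exact: Ck1_is_derive.
by rewrite /p /n -/(g1 x); set u := `|_|; field.
Qed.

(** Neither W' nor the tail need be finite at 0, so neither can carry the derivative alone: each
    half-convolution is differentiated through the factor kept away from 0. *)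
Lemma kappa_C1_unbounded_tail : b = 0 -> Ck 1 k /\ L1loc (derive1 k).
Proof.
move=> bz; have c00 : cl1 (fun=> 0 : R) by exact: cl1_cst.
have dh0 (x : R) : 0 < x -> is_derive x 1 h (0 - e x).
  by move=> x0; rewrite sub0r opprK; exact: dh.
have cgh := cl1_scale_derive_tail.
have chg : cl1 (fun x => h x * W1 x).
  by rewrite (_ : (fun x => _) = fun x => W1 x * h x)//; apply/funext => x; rewrite mulrC.
have A1 := hcr_is_derive cW (cl1_ge0 cT) c00 e0 ce dh0 cgh.
have A2 := cl1_hcr cW (cl1_ge0 cT) c00 e0 ce dh0 cgh.
have A3 := cl1_hcr_cl1 cW c00.
have B1 := hcr_is_derive cT (cl1_ge0 cW) cp n0 cn dg chg.
have B2 := cl1_hcr cT (cl1_ge0 cW) cp n0 cn dg chg.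
have B3 := cl1_hcr_cl1 cT cp.
have C1 := cl1_half cgh; have C2 := cl1_half chg.
pose D y := (hcr h p y + 2^-1 * (h (y / 2) * W1 (y / 2)) - hcr h n y) +
  (hcr W1 (fun=> 0) y + 2^-1 * (W1 (y / 2) * h (y / 2)) - hcr W1 e y).
(* The majorant of |D| is D with every sign made positive; all six terms are locally integrable. *)
pose q y := (hcr h p y + 2^-1 * (h (y / 2) * W1 (y / 2)) + hcr h n y) +
  (hcr W1 (fun=> 0) y + 2^-1 * (W1 (y / 2) * h (y / 2)) + hcr W1 e y).
apply: (@Ck1_L1locP R k D q).
- move=> y y0; apply: (@near_eq_is_derive _ _ _ (fun z => hcr h W1 z + hcr W1 h z)); last first.
    by apply: is_deriveD; [exact: B1|exact: A1].
  near=> z; have z0 : 0 < z by near: z; exact: lt_nbhsr.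
  rewrite (kappaE phiB WS) bz mul0r add0r /rconv.
  rewrite (convol_half z (cl1_causal cT) (cl1_causal cW) (cl1_ge0 cT) (cl1_ge0 cW)).
  have F1 := hc_fin_num cT (cl1_ge0 cW) (cl1_cont cW) z0.
  have F2 := hc_fin_num cW (cl1_ge0 cT) (cl1_cont cT) z0.
  by rewrite (fineD F1 F2).
- move=> y y0; apply: cvgD.
    apply: cvgB; last exact: (cl1_cont B2).
    by apply: cvgD; [exact: (cl1_cont B3)|exact: (cl1_cont C2)].
  apply: cvgB; last exact: (cl1_cont A2).
  by apply: cvgD; [exact: (cl1_cont A3)|exact: (cl1_cont C1)].
- by apply: cl1D; apply: cl1D => //; apply: cl1D.
- move=> y y0; rewrite /D /q.
  have := cl1_ge0 A2 y0; have := cl1_ge0 A3 y0; have := cl1_ge0 B2 y0.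
  have := cl1_ge0 B3 y0; have := cl1_ge0 C1 y0; have := cl1_ge0 C2 y0.
  set r1 := hcr _ _ _; set r2 := hcr _ _ _; set r3 := hcr _ _ _; set r4 := hcr _ _ _.
  set u1 := 2^-1 * _; set u2 := 2^-1 * _.
  move: r1 r2 r3 r4 u1 u2 => r1 r2 r3 r4 u1 u2 h1 h2 h3 h4 h5 h6.
  by rewrite ler_norml; apply/andP; split; lra.
Unshelve. all: by end_near. Qed.

End regular.
End scale.
End UnboundedTail.

Theorem proposition1p6 (R : realType) (sigma m b : R)
    (Pi mu : {measure set (measurableTypeR R) -> \bar R})
    (psi phi W : R -> R)
    (psiN : in_N sigma m Pi psi) (phiB : in_B b mu phi)
    (WS : scale_function psi W) :
  let mubar := tail mu in
  let k := kappa b mu W in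
  let kinf := liminf0 k in
  let ksup := limsup0 k in
  (* (1)(i) *)
  (0 < sigma ^+ 2 + b ->
    let q : \bar R := if sigma == 0 then +oo%E else (b / sigma ^+ 2)%:E in
    [/\ kinf = q, ksup = q & (0 <= q)%E]) /\
  (* (1)(ii) *)
  (sigma ^+ 2 + b = 0 ->
    [/\ (liminf0 (fun y => (mubar y * W y)%R) <= kinf)%E,
        (forall alpha beta : R,
          1 < alpha -> alpha < 1 + beta -> 1 + beta < 2 ->
          tail Pi =O_ (0^'+) (fun y : R => y `^ (- alpha)) ->
          (* mubar may vanish and 0^-1 = 0, so the O-bound alone is too weak *)
          (\forall y \near 0^'+, 0 < mubar y) ->
          (fun y : R => (mubar y)^-1%R) =O_ (0^'+) (fun y : R => y `^ beta) ->
          kinf = +oo%E)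
      & ((lim0 mubar < +oo)%E -> ksup = 0%E)]) /\
  (* (2) *)
  (kinf = ksup -> (ksup < +oo)%E ->
    (* (2)(i) *)
    ((sigma = 0 -> Ck 1 (derive1 W) -> Ck 1 mubar ->
      forall delta : R, 0 < delta ->
      (forall y : R, 0 < y < delta -> derive1n 2 W y <= 0) ->
      (- (\int[lebesgue_measure]_(y in `]0%R, delta[)
          (y * derive1 mubar y /
            \int[lebesgue_measure]_(r in `]0, y[) tail2 Pi r)%:E) < +oo)%E ->
      Ck 1 k /\ L1loc (derive1 k))) /\
    (* (2)(ii) *)
    (sigma = 0 -> (lim0 mubar < +oo)%E -> Ck 1 mubar -> L1loc (derive1 mubar) ->
      Ck 1 k /\ L1loc (derive1 k)) /\
    (* (2)(iii) *)
    (0 < sigma -> Ck 0 mubar ->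
      (Ck 1 k /\ L1loc (derive1 k)) /\
      (b = 0 -> (lim0 mubar < +oo)%E -> Ck 1 mubar -> L1loc (derive1 mubar) ->
        Ck 2 k))).
Proof.
have s_ge0 := N_sigma psiN; have b_ge0 := B_b phiB.
have blow : sigma = 0 -> 0 < b -> limsup0 (kappa b mu W) = +oo%E.
  by move=> s0 b0; apply: limsup0_pinfty; exact: (kappa_blowup_drift psiN phiB WS).
move=> mubar k kinf ksup; split; [|split].
- move=> sb q; rewrite /q; case: eqP => [s0|/eqP sn0].
    have b0 : 0 < b by move: sb; rewrite s0 expr0n/= add0r.
    have M := kappa_blowup_drift psiN phiB WS s0 b0.
    by split => //; [exact: liminf0_pinfty|exact: limsup0_pinfty].
  have s0 : 0 < sigma by rewrite lt_def sn0.
  have [? ?] := cvg_liminf0_limsup0 (kappa_cvg psiN phiB WS s0).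
  by split => //; rewrite lee_fin divr_ge0 ?sqr_ge0.
- move=> /eqP; rewrite paddr_eq0 ?sqr_ge0// expf_eq0/= => /andP[/eqP s0 /eqP b0].
  have psiN0 := psiN; rewrite s0 in psiN0.
  have le_k y : 0 < y -> mubar y * W y <= k y.
    by move=> y0; rewrite /k (kappaE phiB WS) b0 mul0r add0r (kappa_rconv_ge psiN phiB WS).
  have near_k : \forall y \near (0 : R)^'+, mubar y * W y <= k y.
    by near=> y; apply: le_k; near: y; exact: nbhs_right_gt.
  split.
  + exact: liminf0_homo.
  + move=> alpha beta a1 ab b2 O1 mu0 O2; apply: liminf0_pinfty => M.
    have := tail_scale_blowup psiN0 WS a1 ab b2 O1 mu0 O2 M.
    by move=> H; near=> y; apply: (@le_trans _ _ (mubar y * W y)); near: y.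
  + move=> /(tail_lim0_fin phiB)[c c0 [_ hc]].
    exact: (cvg_liminf0_limsup0 (kappa_cvg0 psiN phiB WS b0 c0 hc)).2.
(* A drift without Gaussian part would make the upper limit of kappa infinite, because W'(0+) = +oo;
   finiteness thus removes the drift term. *)
- move=> _ ksup_fin; have bz : sigma = 0 -> b = 0.
    move=> s0; apply/eqP; rewrite eq_le b_ge0 andbT leNgt; apply/negP => b0.
    by move: ksup_fin; rewrite /ksup /k blow.
  split; [|split].
  + move=> s0 cW ch d d0 g0 hi; have psiN0 := psiN; rewrite s0 in psiN0.
    exact: (kappa_C1_unbounded_tail psiN0 phiB WS ch cW d0 g0 hi (bz s0)).
  + by move=> s0 hl ch _; exact: (kappa_C1_bounded_tail phiB WS (bz s0) hl ch).
  + move=> s0 ch; have [K1 K2] := kappa_C1_gaussian psiN phiB WS s0 ch.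
    by split; [exact: K1|move=> b0 hl ch1 _; exact: K2].
Unshelve. all: by end_near. Qed.
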